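(* Let $R(z)$ be a rational function on $\mathbb{P}^1$, let $p$ be an attracting fixed point of $R$ with basin of attraction $\mathcal{A}(p)$, and let $\Omega_i$ ($i=1,2,\dots$) be the connected components of $\mathcal{A}(p)$, indexed so that $p\in\Omega_1$. (a) If all $\Omega_i$ are simply connected and $R^{-1}(p)\cap\Omega_1\neq\{p\}$, then there is a constant $C$ such that for every $i$ and every point $z_0\in\Omega_i$ there exists a point $q\in\Omega_i\cap\bigcup_{k\ge 0}R^{-k}(p)$ with $d_{\Omega_i}(z_0,q)\le C$. (b) Suppose that either all $\Omega_i$ are simply connected and $R^{-1}(p)\cap\Omega_1=\{p\}$, or at least one $\Omega_i$ is not simply connected. Let $p_0\in\Omega_1$, $p_0\neq p$, be (sufficiently) close to $p$. Then there exists a constant $C$ such that for every $i$ and every point $z_0\in\Omega_i$ there is a point $q\in\Omega_i\cap\bigcup_{k\ge 0}R^{-k}(p_0)$ with $d_{\Omega_i}(z_0,q)\le C$.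
   Context: $\mathbb{P}^1=\mathbb{C}\cup\{\infty\}$ is the Riemann sphere. $R^n$ denotes the $n$-fold iterate of $R$ and $R^{-k}(w)$ denotes the set of all points $z$ with $R^k(z)=w$ ($R^{-0}(w)=\{w\}$). A fixed point $p$ is attracting if its multiplier has modulus less than $1$ (superattracting points are included). The basin of attraction of $p$ is $\mathcal{A}(p)=\{z\in\mathbb{P}^1: R^n(z)\to p \text{ as } n\to\infty\}$. For a domain $\Omega\subset\mathbb{P}^1$, with $\triangle$ the unit disk, the Kobayashi metric at $z\in\Omega$ and a tangent vector $\xi$ is $F_\Omega(z,\xi)=\inf\{\lambda>0:\ \exists f:\triangle\to\Omega \text{ holomorphic},\ f(0)=z,\ \lambda f'(0)=\xi\}$, and the Kobayashi distance $d_\Omega(z_1,z_2)$ is the infimum over piecewise smooth curves $\gamma:[0,1]\to\Omega$ joining $z_1$ to $z_2$ of the length of $\gamma$ measured with $F_\Omega$, i.e. $\int_0^1F_\Omega(\gamma(t),\gamma'(t))\,dt$ (on the unit disk, $F_\triangle(z,\xi)=|\xi|/(1-|z|^2)$). ''Sufficiently close'' means that there is a neighborhood of $p$ such that the statement holds for every $p_0\neq p$ in that neighborhood; the constant $C$ may depend on $R$, $p$ and $p_0$ but not on $z_0$ or $i$. *)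

(* Defs.v *)
From HB Require Import structures.
From mathcomp Require Import all_boot all_order all_algebra.
From mathcomp Require Import all_classical all_reals all_analysis.
From mathcomp.real_closed Require Export complex.

Set Implicit Arguments.
Unset Strict Implicit.
Unset Printing Implicit Defensive.

Import Order.TTheory GRing.Theory Num.Theory.
Import numFieldNormedType.Exports.

Local Open Scope classical_set_scope.
Local Open Scope complex_scope.
Local Open Scope ring_scope.

(* [numFieldNormedType] equips only the abstract number structures, not the
   concrete type R[i]: the topology and the normed module structure of R[i] over
   itself have to be declared, as those of the regular module. *)
HB.instance Definition _ (R : realType) := PseudoPointedMetric.copy R[i] R[i]^o.
HB.instance Definition _ (R : realType) := GRing.ComAlgebra.copy R[i] R[i]^o.
HB.instance Definition _ (R : realType) := Vector.copy R[i] R[i]^o.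
HB.instance Definition _ (R : realType) := NormedModule.copy R[i] R[i]^o.

(* The sphere C u {oo}: [Some z] is the point z of C, [None] is oo. *)
Notation P1 R := (one_point_compactification R[i]).

Section RiemannSphere.
Variable R : realType.
Implicit Types (b z : P1 R) (U : set (P1 R)).

(* Each point b of the sphere has a preferred holomorphic chart around it: the
   identity of C if b is finite, and z |-> 1/z if b = oo. [chart b] is that
   chart and [chart_inv b] its inverse. The value of [chart b] at the single point
   outside the domain of the chart (oo, respectively 0) is a dummy. A tangent
   vector at b is represented by its component in C in the preferred chart. *)
Definition chart b z : R[i] :=
  match b, z with
  | Some _, Some x => x
  | None, Some x => x^-1
  | _, None => 0
  end.

Definition chart_inv b (x : R[i]) : P1 R :=
  if b is Some _ then Some x else if x == 0 then None else Some x^-1.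

(* Continuity keeps the nearby values in the domain of the chart, so that the
   dummy value of [chart] is never seen. *)
Definition holomorphic_at (f : R[i] -> P1 R) (x : R[i]) : Prop :=
  {for x, continuous f} /\ derivable (chart (f x) \o f) x 1.

Definition hderive (f : R[i] -> P1 R) (x : R[i]) : R[i] :=
  derive1 (chart (f x) \o f) x.

Record ratfun := RatFun {
  rnum : {poly R[i]};
  rden : {poly R[i]};
  rden_neq0 : rden != 0;
  rcoprime : coprimep rnum rden }.

Definition quot (x y : R[i]) : P1 R := if y == 0 then None else Some (x / y).

(* At oo the value is the quotient of the coefficients of degree
   max(deg rnum, deg rden), which are not both 0. *)
Definition ratfun_eval (f : ratfun) z : P1 R :=
  if z is Some x then quot (rnum f).[x] (rden f).[x]
  else let n := (maxn (size (rnum f)) (size (rden f))).-1 in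
       quot (rnum f)`_n (rden f)`_n.

Definition multiplier (f : P1 R -> P1 R) (p : P1 R) : R[i] :=
  derive1 (chart p \o f \o chart_inv p) (chart p p).

Definition attracting_fixed_point (f : P1 R -> P1 R) (p : P1 R) : Prop :=
  f p = p /\ `|multiplier f p| < 1.

Definition basin (f : P1 R -> P1 R) (p : P1 R) : set (P1 R) :=
  [set z | (fun n => iter n f z) @ \oo --> p].

Definition backward_orbit (f : P1 R -> P1 R) (w : P1 R) : set (P1 R) :=
  \bigcup_(k : nat) [set z | iter k f z = w].

Definition is_component A U : Prop :=
  exists2 z, A z & U = connected_component A z.

Definition path_in U (g : R -> P1 R) : Prop :=
  {within `[0, 1], continuous g} /\ (forall t : R, t \in `[0, 1] -> U (g t)).

Definition path_connected U : Prop :=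
  forall x y, U x -> U y -> exists g, [/\ path_in U g, g 0 = x & g 1 = y].

Definition null_homotopic U (g : R -> P1 R) : Prop :=
  exists H : R * R -> P1 R,
    [/\ {within `[0, 1] `*` `[0, 1], continuous H},
        forall s t : R, s \in `[0, 1] -> t \in `[0, 1] -> U (H (s, t)),
        forall t : R, t \in `[0, 1] -> H (0, t) = g t /\ H (1, t) = g 0 &
        forall s : R, s \in `[0, 1] -> H (s, 0) = g 0 /\ H (s, 1) = g 0].

Definition simply_connected U : Prop :=
  path_connected U /\
  forall g, path_in U g -> g 0 = g 1 -> null_homotopic U g.

Definition unit_disk : set R[i] := [set x | `|x| < 1].

Definition kobayashi_metric U z (xi : R[i]) : \bar R :=
  ereal_inf [set l%:E | l in [set l : R | 0 < l /\
    exists f : R[i] -> P1 R,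
      [/\ forall x, unit_disk x -> holomorphic_at f x /\ U (f x),
          f 0 = z & l%:C * hderive f 0 = xi]]].

Definition velocity (g : R -> P1 R) (t : R) : R[i] :=
  let c := chart (g t) \o g in
  derive1 (@complex.Re R \o c) t +i* derive1 (@complex.Im R \o c) t.

Definition smooth_at (g : R -> P1 R) (t : R) : Prop :=
  let c := chart (g t) \o g in
  {for t, continuous g} /\
  \forall s \near t, forall n : nat,
    derivable (derive1n n (@complex.Re R \o c)) s 1 /\
    derivable (derive1n n (@complex.Im R \o c)) s 1.

(* Smoothness up to the endpoints, by extension to a neighborhood of [a, b]. *)
Definition smooth_on (a b : R) (g : R -> P1 R) : Prop :=
  exists h : R -> P1 R,
    forall t, t \in `[a, b] -> h t = g t /\ smooth_at h t.

(* [itv_partition 0 1 s] says that 0 :: s is strictly increasing and ends at 1,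
   hence [nth 0 (0 :: s) i] and [nth 0 s i] are consecutive. *)
Definition piecewise_smooth (g : R -> P1 R) : Prop :=
  exists s : seq R, itv_partition 0 1 s /\
    forall i, (i < size s)%N -> smooth_on (nth 0 (0 :: s) i) (nth 0 s i) g.

(* The velocity is a dummy at the breakpoints, which form a null set. *)
Definition kobayashi_length U (g : R -> P1 R) : \bar R :=
  (\int[@lebesgue_measure R]_(t in `[0%R, 1%R]%classic)
    kobayashi_metric U (g t) (velocity g t))%E.

Definition kobayashi_dist U (z1 z2 : P1 R) : \bar R :=
  ereal_inf [set kobayashi_length U g | g in [set g : R -> P1 R |
    [/\ path_in U g, piecewise_smooth g, g 0 = z1 & g 1 = z2]]].

End RiemannSphere.

Coercion ratfun_eval : ratfun >-> Funclass.

(* Main.v *)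
(** A fixed point of the map other than p is sent to infinity; the map becomes a
quotient F = n / d of polynomials with deg d < deg n, and the basin a subset of C.
Let v <> p be a point of the basin. The critical orbits in the basin tend to p, so
they miss a punctured disk around v; and the local degrees over v of all the
iterates F^N are bounded, because an orbit ending at v meets each critical point at
most once. Hence for one M and one r > 0 the disk x |-> v + r x^M lifts through every
F^N, from any starting point over a value other than v. The lifts are holomorphic
disks in the basin, so that a point z with F^N z close to v is joined, by a curve
whose Kobayashi length is bounded independently of N and z, to some z' whose image
F^N z' is any prescribed point close to v. By connectedness of the component of p
the prescribed point may be taken to be p0 whenever v is close to p. Finally every
orbit starting away from p visits the compact set |x - p| >= r, |F x - p| <= r, whose
points are close to points that F sends near p but not onto p: this gives a single
bound. In case (a) the same is applied to a preimage of p in its component, other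
than p. *)

(* The point [p] is never the center of a lifted disk: critical orbits accumulate there, and if [p]
   is critical the local degrees over [p] of the iterates are unbounded. What happens near [p] is
   therefore treated one iterate earlier, at points that [F] sends near [p]. Lifts of an ordinary
   disk around [v] would branch over [v]. With [M] a multiple of all local degrees over [v], each
   branch becomes single-valued in [x]; a proper multiple moreover gives the lift derivative 0 at
   the center, where a quadratic estimate then replaces a removable singularity theorem. The lifts
   come from roots of polynomials near the center, and are then continued from radius to radius by
   steps of a fixed size. Lengths are never computed. A curve is a chain of pieces, and each point
   of a piece is the center of a holomorphic disk in the basin whose derivative is half the
   velocity; a chain of [m] pieces thus has length at most [2 * m], and only [m] has to be
   bounded. *)
Require Import Defs.
From mathcomp Require Import all_boot all_order all_algebra.
From mathcomp Require Import all_classical all_reals all_analysis.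
From mathcomp Require Import measurable_realfun.
From mathcomp Require Import ring lra.

Set Implicit Arguments.
Unset Strict Implicit.
Unset Printing Implicit Defensive.

Import Order.TTheory GRing.Theory Num.Theory.
Import numFieldNormedType.Exports.

Local Open Scope classical_set_scope.
Local Open Scope ring_scope.

(** * Modulus and continuity *)

Section Modulus.
Variable R : realType.
Local Notation C := R[i].
Implicit Types (x y z : C) (P : set C) (p : {poly C}).

(** The norm of [R[i]] takes its values in [R[i]]; a modulus in [R] opens the estimates to [lra] and
    [nra]. *)
Definition cabs z : R := complex.Re `|z|.

Lemma cabsE z : `|z| = (cabs z)%:C%C.
Proof. by rewrite /cabs RRe_real // normr_real. Qed.

Lemma cabs_ge0 z : 0 <= cabs z.
Proof. by rewrite -ler0c -cabsE. Qed.

Lemma cabsM z w : cabs (z * w) = cabs z * cabs w.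
Proof. by apply: (@complexI R); rewrite rmorphM -!cabsE normrM. Qed.

Lemma cabsX z n : cabs (z ^+ n) = cabs z ^+ n.
Proof. by apply: (@complexI R); rewrite rmorphXn -!cabsE normrX. Qed.

Lemma cabsV z : cabs z^-1 = (cabs z)^-1.
Proof. by apply: (@complexI R); rewrite fmorphV -!cabsE normfV. Qed.

Lemma cabsN z : cabs (- z) = cabs z.
Proof. by apply: (@complexI R); rewrite -!cabsE normrN. Qed.

Lemma cabsB z w : cabs (z - w) = cabs (w - z).
Proof. by rewrite -cabsN opprB. Qed.

Lemma cabs0 : cabs 0 = 0.
Proof. by apply: (@complexI R); rewrite -cabsE normr0. Qed.

Lemma cabs1 : cabs 1 = 1.
Proof. by apply: (@complexI R); rewrite -cabsE normr1. Qed.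

Lemma cabs_real (r : R) : cabs r%:C%C = `|r|.
Proof.
by rewrite /cabs normc_def /= expr0n /= addr0 sqrtr_sqr.
Qed.

Lemma cabs_i : cabs 'i%C = 1.
Proof. by rewrite /cabs normc_def /= expr0n /= add0r expr1n sqrtr1. Qed.

Lemma cabs_eq0 z : (cabs z == 0) = (z == 0).
Proof. by rewrite -(inj_eq (@complexI R)) -cabsE normr_eq0. Qed.

Lemma cabs_gt0 z : (0 < cabs z) = (z != 0).
Proof. by rewrite lt_def cabs_eq0 cabs_ge0 andbT. Qed.

Lemma cabsD z w : cabs (z + w) <= cabs z + cabs w.
Proof. by rewrite -lecR rmorphD -!cabsE ler_normD. Qed.

Lemma cabs_sub z w u : cabs (z - u) <= cabs (z - w) + cabs (w - u).
Proof. by rewrite (le_trans _ (cabsD _ _)) // addrA subrK. Qed.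

Lemma cabs_prod (I : Type) (s : seq I) (F : I -> C) :
  cabs (\prod_(i <- s) F i) = \prod_(i <- s) cabs (F i).
Proof.
by elim: s => [|a s IH]; rewrite ?big_nil ?cabs1 // !big_cons cabsM IH.
Qed.

Lemma cabs_Re z : `|complex.Re z| <= cabs z.
Proof. by rewrite -lecR -cabsE normc_ge_Re. Qed.

Lemma cabs_Im z : `|complex.Im z| <= cabs z.
Proof.
have := cabs_Re (z * 'i%C).
by rewrite ReiNIm normrN cabsM cabs_i mulr1.
Qed.

Lemma nbhs_cabsP x P :
  nbhs x P <-> exists2 e : R, 0 < e & forall y, cabs (y - x) < e -> P y.
Proof.
split=> [/nbhs_normP[e /= e0 xeP]|[e e0 xeP]].
  have eE : e = (complex.Re e)%:C%C by rewrite RRe_real // gtr0_real.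
  exists (complex.Re e); first by rewrite -ltcR -eE.
  move=> y ye; apply: xeP; rewrite /ball_ /=.
  by rewrite cabsE cabsB eE ltcR.
apply/nbhs_normP; exists e%:C%C; first by rewrite /= ltcR.
move=> y; rewrite /ball_ /=.
by rewrite cabsE ltcR cabsB => /xeP.
Qed.

Lemma near_cabs x (e : R) : 0 < e -> \forall y \near x, cabs (y - x) < e.
Proof. by move=> e0; apply/nbhs_cabsP; exists e. Qed.

Lemma continuous_at_distP (T : topologicalType) (f : T -> R) (a : T) :
  {for a, continuous f} <->
  forall e : R, 0 < e -> \forall b \near a, `|f b - f a| < e.
Proof.
split=> [cf e e0|P].
  have := cf _ (nbhsx_ballx (f a) e e0).
  move=> H; have {H} : nbhs a [set b | ball (f a) e (f b)] by [].
  by apply: filterS; move=> b; rewrite /ball /= distrC.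
apply/cvgrPdist_lt => e e0.
have := P e e0; by apply: filterS; move=> b; rewrite distrC.
Qed.

Lemma continuous_at_cabsP (T : topologicalType) (f : T -> C) (a : T) :
  {for a, continuous f} <->
  forall e : R, 0 < e -> \forall b \near a, cabs (f b - f a) < e.
Proof.
split=> [cf e e0|P A /nbhs_cabsP[e e0 eP]].
  have := cf _ (near_cabs (f a) e0).
  exact.
rewrite nbhs_simpl /=.
have := P e e0; by apply: filterS; move=> b bP; apply: eP.
Qed.

Lemma cabs_continuous : continuous cabs.
Proof.
move=> x; apply/continuous_at_distP => e e0.
near=> y; rewrite ltr_norml; apply/andP.
have yx : cabs (y - x) < e by near: y; exact: near_cabs.
have := cabs_sub x y 0; have := cabs_sub y x 0; rewrite !subr0 (cabsB x y).
by split; lra.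
Unshelve. all: by end_near. Qed.

Lemma Re_continuous : continuous (@complex.Re R).
Proof.
move=> x; apply/continuous_at_distP => e e0.
have := near_cabs x e0; apply: filterS; move=> y; apply: le_lt_trans.
by have := cabs_Re (y - x); case: (x) => a b; case: (y) => c d.
Qed.

Lemma Im_continuous : continuous (@complex.Im R).
Proof.
move=> x; apply/continuous_at_distP => e e0.
have := near_cabs x e0; apply: filterS; move=> y; apply: le_lt_trans.
by have := cabs_Im (y - x); case: (x) => a b; case: (y) => c d.
Qed.

Lemma real_complex_continuous : continuous (fun r : R => r%:C%C : C).
Proof.
move=> r; apply/continuous_at_cabsP => e e0.
have := nbhsx_ballx r e e0; apply: filterS; move=> s.
by rewrite -rmorphB cabs_real /ball /= distrC.
Qed.

(** Continuity at a point in the epsilon form that estimates produce and consume; [ctsP] identifies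
    it with the topological notion. *)
Definition cts (T : topologicalType) (f : T -> C) (a : T) : Prop :=
  forall e : R, 0 < e -> \forall b \near a, cabs (f b - f a) < e.

Lemma ctsP (T : topologicalType) (f : T -> C) a : cts f a <-> {for a, continuous f}.
Proof. by split=> [|/continuous_at_cabsP//] cf; apply/continuous_at_cabsP. Qed.

Lemma cts_cst (T : topologicalType) (k : C) (a : T) : cts (fun=> k) a.
Proof. by move=> e e0; apply: nearW => b; rewrite subrr cabs0. Qed.

Lemma cts_id (a : C) : cts id a.
Proof. by move=> e e0; exact: near_cabs. Qed.

Lemma cts_near (T : topologicalType) (f g : T -> C) a :
  (\forall t \near a, f t = g t) -> cts f a -> cts g a.
Proof.
move=> fg cf e e0; have fga := nbhs_singleton fg; near=> t.
rewrite -fga -(near fg t) //; near: t; exact: cf.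
Unshelve. all: by end_near. Qed.

Lemma cts_comp (T S : topologicalType) (f : T -> S) (g : S -> C) a :
  {for a, continuous f} -> cts g (f a) -> cts (g \o f) a.
Proof. by move=> cf cg e e0; have := cf _ (cg e e0). Qed.

Lemma ctsD (T : topologicalType) (f g : T -> C) a :
  cts f a -> cts g a -> cts (fun t => f t + g t) a.
Proof.
move=> cf cg e e0; have e2 : 0 < e / 2 by lra.
near=> t.
have ft : cabs (f t - f a) < e / 2 by near: t; exact: cf.
have gt : cabs (g t - g a) < e / 2 by near: t; exact: cg.
have -> : f t + g t - (f a + g a) = (f t - f a) + (g t - g a) by ring.
have := cabsD (f t - f a) (g t - g a); lra.
Unshelve. all: by end_near. Qed.

Lemma ctsM (T : topologicalType) (f g : T -> C) a :
  cts f a -> cts g a -> cts (fun t => f t * g t) a.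
Proof.
move=> cf cg e e0; pose K := 1 + cabs (f a) + cabs (g a).
have K0 : 0 < K by have := cabs_ge0 (f a); have := cabs_ge0 (g a); rewrite /K; lra.
(* The increment of the product is at most [d * (d + cabs (f a) + cabs (g a))], hence at most
   [d * K] since [d <= 1]. *)
pose d := Num.min 1 (e / (2 * K)).
have d0 : 0 < d by rewrite lt_min ltr01 divr_gt0 // mulr_gt0.
have d1 : d <= 1 by rewrite ge_min lexx.
have dK : d * K < e.
  have : d <= e / (2 * K) by rewrite ge_min lexx orbT.
  by rewrite ler_pdivlMr ?mulr_gt0 // => ?; nra.
near=> t.
have ft : cabs (f t - f a) < d by near: t; exact: cf.
have gt : cabs (g t - g a) < d by near: t; exact: cg.
have -> : f t * g t - f a * g a =
  (f t - f a) * (g t - g a) + (f a * (g t - g a) + (f t - f a) * g a) by ring.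
apply: (le_lt_trans (cabsD _ _)); rewrite cabsM.
have := cabsD (f a * (g t - g a)) ((f t - f a) * g a); rewrite !cabsM.
have := cabs_ge0 (f a); have := cabs_ge0 (g a).
have := cabs_ge0 (f t - f a); have := cabs_ge0 (g t - g a).
move: dK; rewrite /K; nra.
Unshelve. all: by end_near. Qed.

Lemma ctsN (T : topologicalType) (f : T -> C) a : cts f a -> cts (fun t => - f t) a.
Proof.
move=> cf e e0; have := cf e e0; apply: filterS; move=> t.
by rewrite -opprD cabsN.
Qed.

Lemma ctsB (T : topologicalType) (f g : T -> C) a :
  cts f a -> cts g a -> cts (fun t => f t - g t) a.
Proof. by move=> cf cg; apply/ctsD/ctsN. Qed.

Lemma ctsV (T : topologicalType) (f : T -> C) a : f a != 0 ->
  cts f a -> cts (fun t => (f t)^-1) a.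
Proof. by move=> fa /ctsP cf; apply/ctsP; apply: (@cvgV _ _ _ _ f). Qed.

Lemma ctsX (T : topologicalType) (f : T -> C) n a :
  cts f a -> cts (fun t => f t ^+ n) a.
Proof.
move=> cf; elim: n => [|n IH]; first exact: cts_cst.
rewrite (_ : (fun t => _) = (fun t => f t * f t ^+ n)); first exact: ctsM.
by apply/funext => t; rewrite exprS.
Qed.

Lemma cts_sum (T : topologicalType) (I : Type) (s : seq I)
    (F : I -> T -> C) a :
  (forall i, cts (F i) a) -> cts (fun t => \sum_(i <- s) F i t) a.
Proof.
move=> cF; elim: s => [|i s IH].
  rewrite (_ : (fun t => _) = (fun t => 0)); first exact: cts_cst.
  by apply/funext => t; rewrite big_nil.
rewrite (_ : (fun t => _) = (fun t => F i t + \sum_(j <- s) F j t)).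
  exact: ctsD.
by apply/funext => t; rewrite big_cons.
Qed.

Lemma cts_horner (T : topologicalType) p (f : T -> C) a :
  cts f a -> cts (fun t => p.[f t]) a.
Proof.
move=> cf.
rewrite (_ : (fun t => _) = (fun t => \sum_(i < size p) p`_i * f t ^+ i)).
  by apply: cts_sum => i; apply: ctsM; [exact: cts_cst | exact: ctsX].
by apply/funext => t; rewrite horner_coef.
Qed.

Lemma cts_real (a : R) : cts (fun r : R => r%:C%C) a.
Proof. exact/ctsP/real_complex_continuous. Qed.

Lemma cts_neq0 (T : topologicalType) (f : T -> C) a :
  cts f a -> f a != 0 -> \forall t \near a, f t != 0.
Proof.
move=> cf fa; have fa0 : 0 < cabs (f a) by rewrite cabs_gt0.
have := cf _ fa0; apply: filterS; move=> t; apply: contraTneq => ->.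
by rewrite sub0r cabsN ltxx.
Qed.

Lemma cts_lt (T : topologicalType) (f : T -> C) a (e : R) :
  cts f a -> cabs (f a) < e -> \forall t \near a, cabs (f t) < e.
Proof.
move=> cf fa; have e0 : 0 < e - cabs (f a) by lra.
have := cf _ e0; apply: filterS; move=> t.
by have := cabs_sub (f t) (f a) 0; rewrite !subr0; lra.
Qed.

(* Filter lemmas restated for [nbhs]: filter instances are not inferred at points
   of [R[i]]. *)
Lemma nbhsW (T : topologicalType) (a : T) (P : set T) : (forall t, P t) -> nbhs a P.
Proof. by move=> aP; exact: nearW. Qed.

Lemma nbhsS (T : topologicalType) (a : T) (P Q : set T) :
  nbhs a P -> (forall t, P t -> Q t) -> nbhs a Q.
Proof. by move=> aP PQ; exact: filterS aP. Qed.

Lemma nbhsI (T : topologicalType) (a : T) (P Q : set T) :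
  nbhs a P -> nbhs a Q -> nbhs a (fun t => P t /\ Q t).
Proof. exact: filterI. Qed.

Lemma near_comp (T S : topologicalType) (f : T -> S) (P : set S) (a : T) :
  {for a, continuous f} -> nbhs (f a) P -> nbhs a (fun t => P (f t)).
Proof. by move=> cf /cf. Qed.

End Modulus.

(** * Roots of polynomials and differentiability *)

(** Passage from a continuous slope function [g] to difference quotients. Over a general
    [numFieldType] it serves real and complex derivatives alike. *)
Lemma caratheodory_derive (K : numFieldType) (f g : K -> K) (a : K) :
  {for a, continuous g} ->
  (\forall t \near a, f t - f a = (t - a) * g t) ->
  derivable f a 1 /\ derive1 f a = g a.
Proof.
move=> cg fE.
have cs : h + a @[h --> (0:K)] --> a.
  have := @cvgD _ K^o _ (nbhs (0:K)) _ id (fun=> a) 0 a cvg_id (cvg_cst _).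
  by rewrite add0r; apply.
have sE : (fun h : K => h%:A + a) = (fun h => h + a).
  by apply/funext => h; rewrite /GRing.scale /= mulr1.
have H : h^-1 *: (f (h *: 1 + a) - f a) @[h --> 0^'] --> g a.
  have ch : g (h + a) @[h --> (0:K)^'] --> g a.
    apply: (@cvg_trans _ (g (h + a) @[h --> (0:K)])).
      by move=> P; exact: (@cvg_within _ (nbhs (0:K)) _ _ (fun h => P (g (h + a)))).
    exact: (cvg_comp _ _ cs cg).
  apply: cvg_trans ch; apply: near_eq_cvg.
  have fE' : \forall h \near (0:K), f (h + a) - f a = (h + a - a) * g (h + a).
    by have := cs _ fE.
  near=> h.
  have h0 : h != 0 by near: h; exact: nbhs_dnbhs_neq.
  have fEh : f (h + a) - f a = (h + a - a) * g (h + a).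
    by near: h; apply: cvg_within; exact: fE'.
  have -> : h%:A + a = h + a by rewrite /GRing.scale /= mulr1.
  by rewrite fEh addrK /GRing.scale /= mulKf.
split; first by apply/cvg_ex; exists (g a).
by rewrite derive1E; apply: cvg_lim H.
Unshelve. all: by end_near. Qed.

Section Roots.
Variable R : realType.
Local Notation C := R[i].
Implicit Types (x y z b : C) (p n d : {poly C}).

(** Such a set is closed inside the image of a compact square of [R * R] under
    [(a, b) |-> a + i b]. *)
Lemma compact_closed_bounded (K : set C) (B : R) :
  closed K -> (forall x, K x -> cabs x <= B) -> compact K.
Proof.
move=> cK KB.
pose f (u : R * R) : C := u.1%:C%C + 'i%C * u.2%:C%C.
have cf : continuous f.
  move=> u; apply/ctsP; apply: ctsD.
    apply: (@cts_comp _ _ _ fst); [exact: cvg_fst | exact: cts_real].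
  apply: ctsM; first exact: cts_cst.
  apply: (@cts_comp _ _ _ snd); [exact: cvg_snd | exact: cts_real].
apply: (@subclosed_compact _ K (f @` (`[- B, B] `*` `[- B, B]))) => //.
  apply: continuous_compact; first exact: continuous_subspaceT.
  by apply: compact_setX; exact: segment_compact.
move=> x Kx; exists (complex.Re x, complex.Im x); last by rewrite /f /= -complexE.
have := KB x Kx; have := cabs_Re x; have := cabs_Im x; rewrite !ler_norml.
move=> /andP[? ?] /andP[? ?] ?.
by split; rewrite /= in_itv /=; apply/andP; split; lra.
Qed.

Lemma poly_factor p : exists2 rs : seq C,
  p = lead_coef p *: \prod_(z <- rs) ('X - z%:P) & size rs = (size p).-1.
Proof.
have [->|p0] := eqVneq p 0.
  by exists [::]; rewrite ?lead_coef0 ?scale0r ?size_poly0.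
have [rs E] := closed_field_poly_normal p; exists rs => //.
by rewrite E size_scale ?lead_coef_eq0 // size_prod_XsubC.
Qed.

Lemma cabs_factored (c : C) (rs : seq C) x :
  cabs (c *: \prod_(z <- rs) ('X - z%:P)).[x] = cabs c * \prod_(z <- rs) cabs (x - z).
Proof.
rewrite hornerZ horner_prod cabsM cabs_prod; congr (_ * _).
by apply: eq_bigr => z _; rewrite hornerXsubC.
Qed.

Lemma root_factored (c : C) (rs : seq C) z :
  z \in rs -> root (c *: \prod_(z <- rs) ('X - z%:P)) z.
Proof.
by move=> zr; rewrite /root hornerZ (rootP _) ?mulr0 // root_prod_XsubC.
Qed.

(** If every root [z] were at distance at least [e * cabs (b - z)] from [x], comparing the
    factorizations at [x] and at [b] would bound [cabs p.[x]] below. Referring to [b] instead of the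
    leading coefficient keeps the estimate usable in families where the degree drops. *)
Lemma exists_near_root p x b (e : R) (D : nat) :
  0 < e <= 1 -> p.[b] != 0 -> (size p <= D.+1)%N ->
  cabs p.[x] < e ^+ D * cabs p.[b] ->
  exists2 z, root p z & cabs (x - z) < e * cabs (b - z).
Proof.
move=> /andP[e0 e1] pb sD pxb; have [rs pE srs] := poly_factor p.
apply: contrapT => H.
have {}H z : z \in rs -> e * cabs (b - z) <= cabs (x - z).
  move=> zr; rewrite leNgt; apply/negP => zx; apply: H.
  by exists z => //; rewrite pE root_factored.
move: pxb; apply/negP; rewrite -leNgt pE !cabs_factored mulrCA.
rewrite ler_wpM2l ?cabs_ge0 //.
have -> : e ^+ D = e ^+ (D - size rs) * e ^+ size rs.
  by rewrite -exprD subnK // srs -subn1 leq_subLR add1n.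
have l1 : \prod_(z <- rs) (e * cabs (b - z)) <= \prod_(z <- rs) cabs (x - z).
  rewrite big_seq [leRHS]big_seq; apply: ler_prod => z zr.
  by rewrite H // mulr_ge0 ?cabs_ge0 // ltW.
rewrite big_split /= big_const_seq count_predT iter_mulr_1 in l1.
apply: le_trans l1; have e0' := ltW e0.
rewrite -mulrA ler_piMl ?exprn_ile1 //.
by rewrite mulr_ge0 ?exprn_ge0 // prodr_ge0 // => z _; exact: cabs_ge0.
Qed.

Lemma near_root_of_small p (e : R) x : (1 < size p)%N -> 0 < e ->
  cabs p.[x] < cabs (lead_coef p) * e ^+ (size p).-1 ->
  exists2 z, root p z & cabs (x - z) < e.
Proof.
move=> sp e0; have [rs pE <-] := poly_factor p => px.
apply: contrapT => H.
have {}H z : z \in rs -> e <= cabs (x - z).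
  move=> zr; rewrite leNgt; apply/negP => zx; apply: H.
  by exists z => //; rewrite pE root_factored.
move: px; apply/negP; rewrite -leNgt [in leRHS]pE cabs_factored.
rewrite ler_wpM2l ?cabs_ge0 //.
have l1 : \prod_(z <- rs) e <= \prod_(z <- rs) cabs (x - z).
  rewrite big_seq [leRHS]big_seq; apply: ler_prod => z zr.
  by rewrite H // ltW.
by rewrite big_const_seq count_predT iter_mulr_1 in l1.
Qed.

Lemma poly_nonroot p : p != 0 -> exists b, p.[b] != 0.
Proof.
move=> p0; apply: contrapT => H.
have {}H b : p.[b] = 0 by apply: contrapT => /eqP pb; apply: H; exists b.
have := max_poly_roots p0 (rs := [seq k%:R | k <- iota 0 (size p)]).
rewrite size_map size_iota ltnn => F; suff : false by [].
apply: F; first by apply/allP => z _; apply/rootP.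
rewrite map_inj_uniq ?iota_uniq //.
by move=> i j /eqP; rewrite eqr_nat => /eqP.
Qed.

(** Only pointwise values of [P s] vary continuously and its degree may jump below [D]; so roots are
    located relative to a nonroot [b] of [P s0], by [exists_near_root]. *)
Lemma root_continuity (T : topologicalType) (P : T -> {poly C}) (s0 : T)
    (D : nat) z (e : R) :
  (forall s, size (P s) <= D.+1)%N -> (forall x, cts (fun s => (P s).[x]) s0) ->
  P s0 != 0 -> root (P s0) z -> 0 < e ->
  \forall s \near s0, exists2 y, root (P s) y & cabs (y - z) < e.
Proof.
move=> sP cP P0 /rootP Pz e0; have [b Pb] := poly_nonroot P0.
pose K := cabs (z - b) + 1; have K0 : 0 < K by have := cabs_ge0 (z - b); rewrite /K; lra.
(* From [cabs (z - y) < t * cabs (b - y)] and [t <= 1 / 2] follows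
   [cabs (z - y) < 2 * t * cabs (b - z)], which this choice keeps below [e]. *)
pose t := Num.min (1 / 2) (e / (2 * K)).
have t0 : 0 < t by rewrite lt_min !divr_gt0 ?mulr_gt0.
have t1 : t <= 1 / 2 by rewrite ge_min lexx.
have tK : t * (2 * K) <= e.
  by rewrite -ler_pdivlMr ?mulr_gt0 // ge_min lexx orbT.
have Pb0 : 0 < cabs (P s0).[b] by rewrite cabs_gt0.
have m0 : 0 < t ^+ D * (cabs (P s0).[b] / 2) by rewrite mulr_gt0 ?exprn_gt0 // divr_gt0.
near=> s.
have Psb : cabs ((P s).[b] - (P s0).[b]) < cabs (P s0).[b] / 2.
  by near: s; apply: cP; rewrite divr_gt0.
have {}Psb : cabs (P s0).[b] / 2 < cabs (P s).[b].
  have := cabs_sub (P s0).[b] (P s).[b] 0; rewrite !subr0 cabsB; lra.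
have Psz : cabs (P s).[z] < t ^+ D * (cabs (P s0).[b] / 2).
  by near: s; apply: cts_lt => //; rewrite Pz cabs0.
have [||||y yr] := @exists_near_root (P s) z b t D.
- by apply/andP; split => //; lra.
- by rewrite -cabs_gt0; lra.
- exact: sP.
- by apply: (lt_trans Psz); rewrite ltr_pM2l ?exprn_gt0.
move=> zy; exists y => //; rewrite cabsB.
have := cabs_sub b z y; rewrite (cabsB b z) => by_.
have K1 : K = cabs (z - b) + 1 by [].
have := cabs_ge0 (z - y); have := cabs_ge0 (b - y); nra.
Unshelve. all: by end_near. Qed.

Lemma horner_le p x (r : R) : 1 <= r -> cabs x <= r ->
  cabs p.[x] <= (\sum_(i < size p) cabs p`_i) * r ^+ (size p).-1.
Proof.
move=> r1 xr; rewrite horner_coef mulr_suml.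
elim/big_ind2: _ => [|u u' v v' uu vv|i _].
- by rewrite cabs0.
- by apply: (le_trans (cabsD _ _)); exact: lerD.
rewrite cabsM cabsX ler_wpM2l ?cabs_ge0 //.
apply: (@le_trans _ _ (r ^+ i)); first by apply: lerXn2r; rewrite ?nnegrE ?cabs_ge0 //; lra.
apply: ler_weXn2l => //; have := ltn_ord i.
by move: (nat_of_ord i); case: (size p).
Qed.

(** Preimages of bounded sets under [n / d] are bounded, because the leading term of [n] dominates.
    Without division, the inequality needs no care at the zeros of [d]. *)
Lemma bounded_of_poly_le n d (B : R) : (size d < size n)%N ->
  exists B' : R, forall x, cabs n.[x] <= B * cabs d.[x] -> cabs x <= B'.
Proof.
move=> sdn; pose K : R := \sum_(i < (size n).-1) cabs n`_i.
pose L : R := \sum_(i < size d) cabs d`_i.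
have K0 : 0 <= K by apply: sumr_ge0 => i _; exact: cabs_ge0.
have L0 : 0 <= L by apply: sumr_ge0 => i _; exact: cabs_ge0.
have lc0 : 0 < cabs (lead_coef n).
  by rewrite cabs_gt0 lead_coef_eq0 -size_poly_gt0 (leq_ltn_trans _ sdn).
exists (Num.max 1 ((K + `|B| * L) / cabs (lead_coef n))) => x nd.
rewrite le_max; case: (leP (cabs x) 1) => //= x1.
rewrite ler_pdivlMr //.
have [m sn] : exists m, size n = m.+1 by case: (size n) sdn => // m _; exists m.
case: m => [|m] in sn.
  move: sdn; rewrite sn ltnS leqn0 size_poly_eq0 => /eqP d0; move: nd.
  rewrite d0 horner0 cabs0 mulr0 (size1_polyC (eq_leq sn)) hornerC => h.
  by move: lc0; rewrite lead_coefE sn /=; lra.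
have x0 : 0 < cabs x ^+ m by rewrite exprn_gt0 //; lra.
have dx : cabs d.[x] <= L * cabs x ^+ m.
  apply: (le_trans (horner_le d (ltW x1) (lexx _))).
  rewrite ler_wpM2l //; apply: ler_weXn2l; first exact: ltW.
  by move: sdn; rewrite sn; case: (size d).
have nx : cabs (lead_coef n) * cabs x ^+ m.+1 <= cabs n.[x] + K * cabs x ^+ m.
  have nE : n.[x] = \sum_(i < m.+1) n`_i * x ^+ i + lead_coef n * x ^+ m.+1.
    by rewrite horner_coef lead_coefE sn big_ord_recr.
  have sK : cabs (\sum_(i < m.+1) n`_i * x ^+ i) <= K * cabs x ^+ m.
    rewrite /K sn /= mulr_suml.
    elim/big_ind2: _ => [|u u' v v' uu vv|i _].
    - by rewrite cabs0.
    - by apply: (le_trans (cabsD _ _)); exact: lerD.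
    rewrite cabsM cabsX ler_wpM2l ?cabs_ge0 //.
    by apply: ler_weXn2l; [exact: ltW | rewrite -ltnS].
  rewrite -cabsX -cabsM.
  have -> : lead_coef n * x ^+ m.+1 = n.[x] - \sum_(i < m.+1) n`_i * x ^+ i.
    by rewrite nE addrC addKr.
  by apply: (le_trans (cabsD _ _)); rewrite cabsN lerD2l.
have Bd : B * cabs d.[x] <= `|B| * L * cabs x ^+ m.
  apply: (@le_trans _ _ (`|B| * cabs d.[x])).
    by rewrite ler_wpM2r ?cabs_ge0 // ler_norm.
  by rewrite -mulrA ler_wpM2l.
rewrite -(ler_pM2r x0) mulrDl; move: nx; rewrite exprS.
by rewrite (mulrC (cabs x) (cabs (lead_coef n))) -mulrA => nx; lra.
Qed.

(** The divided difference [(p.[x] - p.[y]) / (x - y)] as a polynomial in both variables: it is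
    continuous across the diagonal, where it is the derivative. *)
Definition dd p x y : C :=
  \sum_(i < size p) p`_i * \sum_(j < i) x ^+ (i.-1 - j) * y ^+ j.

Lemma ddE p x y : p.[x] - p.[y] = (x - y) * dd p x y.
Proof.
rewrite !horner_coef -sumrB mulr_sumr; apply: eq_bigr => i _.
by rewrite -mulrBr subrXX mulrCA.
Qed.

Lemma dd_diag p x : dd p x x = p^`().[x].
Proof.
rewrite /dd /deriv horner_poly; case: (size p) => [|m] /=.
  by rewrite !big_ord0.
rewrite big_ord_recl /= big_ord0 mulr0 add0r; apply: eq_bigr => i _.
rewrite /bump /= add1n mulrnAl -mulrnAr; congr (_ * _).
transitivity (\sum_(j < i.+1) x ^+ i); last by rewrite sumr_const card_ord.
by apply: eq_bigr => j _; rewrite add0n -exprD subnK // -ltnS.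
Qed.

Lemma cts_dd (T : topologicalType) p (f g : T -> C) a :
  cts f a -> cts g a -> cts (fun t => dd p (f t) (g t)) a.
Proof.
move=> cf cg; apply: cts_sum => i; apply: ctsM; first exact: cts_cst.
by apply: cts_sum => j; apply: ctsM; exact: ctsX.
Qed.

Section Caratheodory.
Context {T : topologicalType} (i : T -> C).

(* Differentiability in Caratheodory's form, with respect to the coordinate [i]:
   the identity for holomorphic functions, the embedding of R in C for curves. *)
Definition dif (f : T -> C) (a : T) (D : C) : Prop :=
  exists g : T -> C, [/\ cts g a, g a = D &
    \forall t \near a, f t - f a = (i t - i a) * g t].

Lemma dif_cts f a D : cts i a -> dif f a D -> cts f a.
Proof.
move=> ci [g [cg _ fE]].
have : cts (fun t => f a + (i t - i a) * g t) a.
  apply: ctsD; first exact: cts_cst.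
  by apply: ctsM => //; apply: ctsB => //; exact: cts_cst.
by apply: cts_near; apply: filterS fE; move=> t <-; rewrite addrCA subrr addr0.
Qed.

Lemma dif_near f h a D : (\forall t \near a, f t = h t) -> dif f a D -> dif h a D.
Proof.
move=> fh [g [cg ga fE]]; exists g; split=> //.
have fha := nbhs_singleton fh; near=> t.
rewrite -fha -(near fh t) //; by near: t.
Unshelve. all: by end_near. Qed.

Lemma dif_id a : dif i a 1.
Proof.
exists (fun=> 1); split=> //; first exact: cts_cst.
by apply: nearW => t; rewrite mulr1.
Qed.

Lemma dif_cst k a : dif (fun=> k) a 0.
Proof.
exists (fun=> 0); split=> //; first exact: cts_cst.
by apply: nearW => t; rewrite mulr0 subrr.
Qed.

Lemma difD f g a D E : dif f a D -> dif g a E -> dif (fun t => f t + g t) a (D + E).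
Proof.
move=> [u [cu ua fE]] [v [cv va gE]]; exists (fun t => u t + v t).
split; [exact: ctsD | by rewrite ua va |].
near=> t; rewrite mulrDr -(near fE t) // -(near gE t) //; ring.
Unshelve. all: by end_near. Qed.

Lemma difM f g a D E : cts i a -> dif f a D -> dif g a E ->
  dif (fun t => f t * g t) a (D * g a + f a * E).
Proof.
move=> ci fD gD; have cf := dif_cts ci fD.
case: fD gD => [u [cu ua fE]] [v [cv va gE]].
exists (fun t => u t * g a + f t * v t); split.
- apply: ctsD; apply: ctsM => //; exact: cts_cst.
- by rewrite ua va.
near=> t.
have -> : (i t - i a) * (u t * g a + f t * v t) =
  (i t - i a) * u t * g a + f t * ((i t - i a) * v t) by ring.
rewrite -(near fE t) // -(near gE t) //; ring.
Unshelve. all: by end_near. Qed.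

Lemma difN f a D : dif f a D -> dif (fun t => - f t) a (- D).
Proof.
move=> [u [cu ua fE]]; exists (fun t => - u t); split; [exact: ctsN | by rewrite ua |].
by apply: filterS fE; move=> t fE; rewrite mulrN -fE; ring.
Qed.

Lemma difB f g a D E : dif f a D -> dif g a E -> dif (fun t => f t - g t) a (D - E).
Proof. by move=> fD gD; apply: difD => //; exact: difN. Qed.

Lemma difV f a D : cts i a -> f a != 0 -> dif f a D ->
  dif (fun t => (f t)^-1) a (- D / f a ^+ 2).
Proof.
move=> ci fa fD; have cf := dif_cts ci fD; case: fD => [u [cu ua fE]].
exists (fun t => - u t / (f t * f a)); split.
- apply: ctsM; first exact: ctsN.
  by apply: ctsV; [rewrite mulf_neq0 | apply: ctsM => //; exact: cts_cst].
- by rewrite ua expr2.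
have := cts_neq0 cf fa; apply: filterS2 fE; move=> t fE ft.
have -> : (i t - i a) * (- u t / (f t * f a)) =
  - ((i t - i a) * u t) / (f t * f a) by ring.
by rewrite -fE; field; rewrite fa ft.
Qed.

Lemma dif_eq f a D E : D = E -> dif f a D -> dif f a E.
Proof. by move=> ->. Qed.

End Caratheodory.

Local Notation hol := (dif (@id C)).

Lemma dif_comp (T : topologicalType) (i : T -> C) (f : T -> C) (g : C -> C) a D E :
  cts i a -> dif i f a D -> hol g (f a) E -> dif i (g \o f) a (D * E).
Proof.
move=> ci fD [v [cv va gE]]; have cf := dif_cts ci fD.
case: fD => [u [cu ua fE]]; exists (fun t => u t * v (f t)); split.
- by apply: ctsM => //; apply: (@cts_comp _ _ _ f v) => //; exact/ctsP.
- by rewrite ua va.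
have cf' : \forall t \near a, g (f t) - g (f a) = (f t - f a) * v (f t).
  by apply: near_comp gE; exact/ctsP.
near=> t; rewrite /= (near cf' t) // mulrA; congr (_ * _).
by near: t.
Unshelve. all: by end_near. Qed.

Lemma hol_horner p a : hol (horner p) a p^`().[a].
Proof.
exists (fun t => dd p t a); split.
- by apply: cts_dd; [exact: cts_id | exact: cts_cst].
- exact: dd_diag.
- by apply: nbhsW => t; exact: ddE.
Qed.

Lemma cts_dnbhs (g : C -> C) a k :
  (forall e : R, 0 < e -> \forall t \near a, t != a -> cabs (g t - k) < e) ->
  cts g a -> g a = k.
Proof.
move=> gk cg; apply/eqP; rewrite -subr_eq0 -cabs_eq0 eq_le cabs_ge0 andbT.
apply/ler_addgt0Pl => e e0; rewrite addr0.
have e2 : 0 < e / 2 by lra.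
have /nbhs_cabsP[r r0 rP] := nbhsI (gk _ e2) (cg _ e2).
have r2 : cabs (a + (r / 2)%:C%C - a) = r / 2.
  by rewrite addrAC subrr add0r cabs_real gtr0_norm //; lra.
have [|A B] := rP (a + (r / 2)%:C%C); first by rewrite r2; lra.
have {}A : cabs (g (a + (r / 2)%:C%C) - k) < e / 2.
  by apply: A; rewrite -subr_eq0 -cabs_eq0 r2; apply/eqP; lra.
have := cabs_sub (g a) (g (a + (r / 2)%:C%C)) k.
rewrite (cabsB (g a) (g _)).
by move: A B; lra.
Qed.

Lemma hol_uniq f a D E : hol f a D -> hol f a E -> D = E.
Proof.
move=> [u [cu <- fu]] [v [cv <- fv]].
apply/eqP; rewrite -subr_eq0; apply/eqP.
apply: (@cts_dnbhs (fun t => u t - v t)); last exact: ctsB.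
move=> e e0; near=> t => ta; rewrite subr0.
suff -> : u t = v t by rewrite subrr cabs0.
have ta0 : t - a != 0 by rewrite subr_eq0.
apply: (mulfI ta0); rewrite -[LHS](near fu t) // -[RHS](near fv t) //.
Unshelve. all: by end_near. Qed.

Lemma hol_derive f a D : hol f a D -> derivable f a 1 /\ derive1 f a = D.
Proof.
move=> [g [/ctsP cg <- fE]].
exact: (@caratheodory_derive (R[i] : numFieldType) f g a cg fE).
Qed.

Lemma dif_real_derive (f : R -> C) (a : R) D :
  dif (fun r : R => r%:C%C) f a D ->
  [/\ derivable (@complex.Re R \o f) a 1, derive1 (@complex.Re R \o f) a = complex.Re D,
      derivable (@complex.Im R \o f) a 1 & derive1 (@complex.Im R \o f) a = complex.Im D].
Proof.
move=> [g [/ctsP cg <- fE]].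
have [||d1 e1] := @caratheodory_derive R (@complex.Re R \o f) (@complex.Re R \o g) a.
- apply: (continuous_comp cg); exact: Re_continuous.
- apply: filterS fE; move=> t /= /(congr1 (@complex.Re R)).
  rewrite -rmorphB /=; case: (f t) => ? ?; case: (f a) => ? ? /=.
  by case: (g t) => ? ? /=; rewrite mul0r subr0.
have [||d2 e2] := @caratheodory_derive R (@complex.Im R \o f) (@complex.Im R \o g) a.
- apply: (continuous_comp cg); exact: Im_continuous.
- apply: filterS fE; move=> t /= /(congr1 (@complex.Im R)).
  rewrite -rmorphB /=; case: (f t) => ? ?; case: (f a) => ? ? /=.
  by case: (g t) => ? ? /=; rewrite mul0r addr0.
exact: (And4 d1 e1 d2 e2).
Qed.

End Roots.

(** * Uniform constants from compactness, and radial retraction onto disks *)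

Section Uniformity.
Variable R : realType.
Local Notation C := R[i].

(** A Lebesgue number argument: compactness in near-covering form, against the filter of small
    positive [e]. Upper bounds are made uniform in the same way, as bounds by the inverse of [e]. *)
Lemma compact_uniform (K : set C) (Q : C -> R -> Prop) : compact K ->
  (forall y e e', Q y e -> 0 < e' <= e -> Q y e') ->
  (forall y, K y -> exists2 e : R, 0 < e & \forall y' \near y, Q y' e) ->
  exists2 e : R, 0 < e & forall y, K y -> Q y e.
Proof.
move=> /compact_near_coveringP cK Qm KQ.
have H : \forall e \near (0:R)^'+, K `<=` (fun y => Q y e).
  apply: (cK _ _ (fun e y => Q y e)) => y /KQ[e e0 ye].
  have He : \forall e' \near (0:R)^'+, 0 < e' <= e.
    near=> e'; apply/andP; split; near: e'; [exact: nbhs_right_gt|exact: nbhs_right_le].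
  exists ([set y' | Q y' e], [set e' | 0 < e' <= e]); first exact: conj ye He.
  by move=> [y' e'] /= [yy' ee']; exact: Qm ee'.
have H2 : \forall e \near (0:R)^'+, K `<=` (fun y => Q y e) /\ 0 < e.
  by near=> e; split; near: e => //; exact: nbhs_right_gt.
case: (@filter_ex _ _ (at_right_proper_filter (0:R)) _ H2) => e [He e0].
by exists e => // y; exact: He.
Unshelve. all: by end_near. Qed.

Lemma seq_uniform (T : eqType) (s : seq T) (Q : T -> R -> Prop) :
  (forall y e e', Q y e -> 0 < e' <= e -> Q y e') ->
  (forall y, y \in s -> exists2 e : R, 0 < e & Q y e) ->
  exists2 e : R, 0 < e & forall y, y \in s -> Q y e.
Proof.
move=> Qm; elim: s => [|x s IH] sQ; first by exists 1.
have [|e e0 eQ] := IH; first by move=> y ys; apply: sQ; rewrite inE ys orbT.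
have [|e1 e10 e1Q] := sQ x; first by rewrite inE eqxx.
exists (Num.min e e1); first by rewrite lt_min e0.
move=> y; rewrite inE => /orP[/eqP ->|/eQ yQ].
  by apply: Qm e1Q _; rewrite lt_min e0 e10 ge_min lexx orbT.
by apply: Qm yQ _; rewrite lt_min e0 e10 ge_min lexx.
Qed.

(** Radial retraction onto the closed disk of radius [r]: composing with it extends a function on
    the disk continuously to the plane. *)
Definition clamp (r : R) (x : C) : C := x * (r / Num.max r (cabs x))%:C%C.

Lemma cts_real_div_max (T : topologicalType) (f : T -> R) r a : 0 < r ->
  {for a, continuous f} -> cts (fun t => (r / Num.max r (f t))%:C%C) a.
Proof.
move=> r0 cf; apply: (@cts_comp _ _ _ (fun t => r / Num.max r (f t)) (fun r : R => r%:C%C));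
  last exact: cts_real.
apply: (@cvgM R); first exact: cvg_cst.
apply: cvgV; first by rewrite gt_eqF // lt_max r0.
apply: (@continuous_max R T (fun=> r) f) => //; exact: cst_continuous.
Qed.

Lemma clamp_cts r x : 0 < r -> cts (clamp r) x.
Proof.
move=> r0; apply: ctsM; first exact: cts_id.
by apply: cts_real_div_max => //; exact: cabs_continuous.
Qed.

Lemma clamp_id r x : 0 < r -> cabs x <= r -> clamp r x = x.
Proof.
by move=> r0 xr; rewrite /clamp; move/max_idPl: xr => ->; rewrite divff ?mulr1 ?gt_eqF.
Qed.

Lemma cabs_clamp r x : 0 < r -> cabs (clamp r x) = Num.min r (cabs x).
Proof.
move=> r0; have [xr|rx] := leP (cabs x) r; first by rewrite clamp_id // min_r.
have x0 : 0 < cabs x by apply: lt_trans rx.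
rewrite /clamp cabsM cabs_real ger0_norm; last first.
  by rewrite divr_ge0 // ?ltW // lt_max r0.
by rewrite max_r ?(ltW rx) // mulrCA divff ?gt_eqF // mulr1.
Qed.

Lemma clamp_le r x : 0 < r -> cabs (clamp r x) <= r.
Proof. by move=> r0; rewrite cabs_clamp // ge_min lexx. Qed.

Lemma cabs_clampB r s x : 0 < r -> r <= s -> cabs (clamp s x - clamp r x) <= s - r.
Proof.
move=> r0 rs; have s0 : 0 < s by exact: lt_le_trans rs.
rewrite /clamp -mulrBr -rmorphB cabsM cabs_real.
have [xr|rx] := leP (cabs x) r.
  by rewrite !max_l ?(le_trans xr rs) // !divff ?gt_eqF // subrr normr0 mulr0 subr_ge0.
have x0 : 0 < cabs x by apply: lt_trans rx.
rewrite -[X in X * _]ger0_norm ?cabs_ge0 // -normrM mulrBr.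
rewrite (mulrCA _ r) divff ?gt_eqF // mulr1.
have [xs|sx] := leP (cabs x) s.
  by rewrite divff ?gt_eqF // mulr1 ger0_norm; lra.
by rewrite mulrCA divff ?gt_eqF // mulr1 ger0_norm; lra.
Qed.

Lemma cabs_subXX (x y : C) M : cabs x <= 1 -> cabs y <= 1 ->
  cabs (x ^+ M - y ^+ M) <= M%:R * cabs (x - y).
Proof.
move=> x1 y1; rewrite subrXX cabsM mulrC ler_wpM2r ?cabs_ge0 //.
have -> : M%:R = \sum_(i < M) 1 :> R by rewrite sumr_const card_ord.
elim/big_ind2: _ => [|u u' v v' uu vv|i _].
- by rewrite cabs0.
- by apply: (le_trans (cabsD _ _)); exact: lerD.
by rewrite cabsM !cabsX mulr_ile1 ?exprn_ge0 ?exprn_ile1 ?cabs_ge0.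
Qed.

End Uniformity.

Lemma continuous_lincomb (R : realType) (T : topologicalType) (f g : T -> R) (a b : R) x :
  {for x, continuous f} -> {for x, continuous g} ->
  {for x, continuous (fun y => a * f y - b * g y)}.
Proof.
move=> cf cg; apply: (@cvgB _ R^o).
  by apply: (@cvgM R) => //; exact: cvg_cst.
by apply: (@cvgM R) => //; exact: cvg_cst.
Qed.

Lemma closed_ge0 (R : realType) (T : topologicalType) (f : T -> R) :
  continuous f -> closed [set y | 0 <= f y].
Proof.
move=> cf; have -> : [set y | 0 <= f y] = f @^-1` [set x | 0 <= x] by [].
by apply: closed_comp => //; exact: closed_ge.
Qed.

(** * Lifting a branched disk through a rational function *)

Section Lifting.
Variable R : realType.
Local Notation C := R[i].
Variables (n d : {poly C}) (v : C) (r : R) (M : nat).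
Hypothesis size_dn : (size d < size n)%N.
Hypothesis d_neq0 : d != 0.
Hypothesis nd0 : forall x, d.[x] = 0 -> n.[x] != 0.
Hypothesis r0 : 0 < r.

(** The numerator of the derivative of [a / b]; away from the poles its zeros are the critical
    points. *)
Definition wronskian (a b : {poly C}) : {poly C} := a^`() * b - a * b^`().

Definition root_disk (x : C) : C := v + r%:C%C * x ^+ M.

(* [h] is required to be continuous everywhere, so that no subspace topology is
   involved; its values outside the disk of radius [e] are irrelevant. *)
Definition lift_on (e : R) (h : C -> C) : Prop :=
  (forall x, cts h x) /\
  forall x, cabs x <= e -> n.[h x] = root_disk x * d.[h x].

(** The starting point [x = 0] is excluded: it lies over [v], where branches can meet and [y] does
    not determine a lift. *)
Definition liftable (e : R) : Prop := forall x y, x != 0 -> cabs x <= e ->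
  n.[y] = root_disk x * d.[y] -> exists2 h, lift_on e h & h x = y.

(* [M] is a proper multiple of the local degrees over [v]: being a multiple makes the
   lifts single-valued around [0], and [1 < m] makes their derivative vanish at [0]. *)
Hypothesis orders : forall c, root (n - v *: d) c -> exists k m q,
  [/\ n - v *: d = ('X - c%:P) ^+ k * q, q.[c] != 0, (0 < k)%N, (1 < m)%N & M = (k * m)%N].
Hypothesis noncrit : forall y w, n.[y] = w * d.[y] -> w != v -> cabs (w - v) <= r ->
  (wronskian n d).[y] != 0.

Lemma fiber_pole y w : n.[y] = w * d.[y] -> d.[y] != 0.
Proof.
move=> nE; apply/eqP => dy; have := nd0 dy.
by rewrite nE dy mulr0 eqxx.
Qed.

Lemma size_fiber w : size (n - w *: d) = size n.
Proof.
rewrite size_polyDl // size_polyN.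
by apply: leq_ltn_trans size_dn; exact: size_scale_leq.
Qed.

Lemma lead_coef_fiber w : lead_coef (n - w *: d) = lead_coef n.
Proof.
rewrite lead_coefDl // size_polyN.
by apply: leq_ltn_trans size_dn; exact: size_scale_leq.
Qed.

Lemma size_n_gt1 : (1 < size n)%N.
Proof. by apply: leq_trans size_dn; rewrite ltnS size_poly_gt0. Qed.

Section Local.
Variables (c : C) (k m : nat) (q : {poly C}).
Hypothesis fE : n - v *: d = ('X - c%:P) ^+ k * q.
Hypothesis qc : q.[c] != 0.
Hypothesis k0 : (0 < k)%N.
Hypothesis m0 : (0 < m)%N.
Hypothesis ME : M = (k * m)%N.

Let A := r%:C%C * d.[c] / q.[c].

Lemma rC_neq0 : r%:C%C != 0 :> C.
Proof. by rewrite -cabs_eq0 cabs_real normr_eq0 gt_eqF. Qed.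

Lemma dc_neq0 : d.[c] != 0.
Proof.
apply: (@fiber_pole _ v); apply/eqP; rewrite -subr_eq0 -hornerZ -hornerN -hornerD fE.
by rewrite hornerM horner_exp hornerXsubC subrr expr0n (gtn_eqF k0) mul0r.
Qed.

Lemma A_neq0 : A != 0.
Proof. by rewrite !mulf_neq0 ?invr_neq0 ?rC_neq0 ?dc_neq0. Qed.

(* The substitution [y = c + x ^+ m * t] turns [n.[y] = root_disk x * d.[y]] into
   [root (branch_poly (x ^+ m)) t], and the roots of [branch_poly 0] are simple. *)
Definition branch_poly (s : C) : {poly C} :=
  'X ^+ k * (q \Po (c%:P + s *: 'X)) - r%:C%C *: (d \Po (c%:P + s *: 'X)).

Lemma branch_polyE s t :
  (branch_poly s).[t] = t ^+ k * q.[c + s * t] - r%:C%C * d.[c + s * t].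
Proof. by rewrite /branch_poly !hornerE !horner_comp !hornerE. Qed.

Lemma branch_poly_root s t x : x ^+ m = s ->
  x != 0 -> n.[c + s * t] = root_disk x * d.[c + s * t] <-> root (branch_poly s) t.
Proof.
move=> sE x0; have s0 : s != 0 by rewrite -sE expf_neq0.
set y := c + s * t.
have E : n.[y] - root_disk x * d.[y] = s ^+ k * (branch_poly s).[t].
  have fy : n.[y] - v * d.[y] = (y - c) ^+ k * q.[y].
    have := congr1 (horner^~ y) fE.
    by rewrite hornerM horner_exp hornerXsubC hornerD hornerN hornerZ.
  rewrite branch_polyE -/y /root_disk ME mulnC exprM sE.
  have yc : y - c = s * t by rewrite /y addrAC subrr add0r.
  move: fy; rewrite yc exprMn => fy.
  rewrite (_ : n.[y] = v * d.[y] + s ^+ k * t ^+ k * q.[y]); first by ring.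
  by rewrite -fy addrC subrK.
split=> [nE|/rootP bE]; last by apply/eqP; rewrite -subr_eq0 E bE mulr0.
apply/rootP; apply: (mulfI (expf_neq0 k s0)).
by rewrite -E nE subrr mulr0.
Qed.

Lemma branch_poly_neq0 s : branch_poly s != 0.
Proof.
apply/eqP => b0; have := branch_polyE s 0; rewrite b0 horner0 mulr0 addr0.
rewrite expr0n (gtn_eqF k0) mul0r sub0r => /eqP.
by rewrite eq_sym oppr_eq0 mulf_eq0 (negPf rC_neq0) (negPf dc_neq0).
Qed.

Lemma cts_branch_poly t s : cts (fun s => (branch_poly s).[t]) s.
Proof.
have -> : (fun s : C => (branch_poly s).[t]) =
    (fun s : C => t ^+ k * q.[c + s * t] - r%:C%C * d.[c + s * t]).
  by apply/funext => u; rewrite branch_polyE.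
have ch (p : {poly C}) : cts (fun s : C => p.[c + s * t]) s.
  apply: cts_horner; apply: ctsD; first exact: cts_cst.
  by apply: ctsM; [exact: cts_id | exact: cts_cst].
by apply: ctsB; apply: ctsM => //; exact: cts_cst.
Qed.

Lemma size_branch_poly s : (size (branch_poly s) <= (k + size q + size d).+1)%N.
Proof.
have sl : (size (c%:P + s *: 'X)%R <= 2)%N.
  rewrite (leq_trans (size_polyD _ _)) // geq_max.
  rewrite (leq_trans (size_polyC_leq1 _)) //.
  by rewrite (leq_trans (size_scale_leq _ _)) // size_polyX.
have sc (p : {poly C}) : (size (p \Po (c%:P + s *: 'X))%R <= (size p).+1)%N.
  rewrite (leq_trans (size_comp_poly_leq _ _)) // ltnS.
  apply: (@leq_trans ((size p).-1 * 1)); last by rewrite muln1 leq_pred.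
  move: sl; case: (size (c%:P + _)%R) => [|a] /=; first by rewrite muln0.
  by rewrite ltnS leq_mul2l => ->; rewrite orbT.
rewrite (leq_trans (size_polyD _ _)) // geq_max size_polyN; apply/andP; split.
  rewrite (leq_trans (size_polyMleq _ _)) // size_polyXn addSn /=.
  rewrite (leq_trans (leq_add (leqnn k) (sc q))) // addnS ltnS.
  by rewrite leq_addr.
rewrite (leq_trans (size_scale_leq _ _)) // (leq_trans (sc d)) // ltnS.
by rewrite leq_addl.
Qed.

(** At [s = 0] the polynomial is [q.[c]] times ['X^k - A%:P], whose roots are simple since [A != 0].
    So the divided difference [F] of [branch_poly s] between [t] and [t'] is nonzero at
    [(0, t0, t0)], and nearby by joint continuity. *)
Lemma branch_poly_simple t0 : t0 ^+ k = A ->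
  exists2 e : R, 0 < e & forall s t t', cabs s < e -> cabs (t - t0) < e ->
    cabs (t' - t0) < e -> root (branch_poly s) t -> root (branch_poly s) t' -> t = t'.
Proof.
move=> t0A.
pose s' (u : C * C * C) := u.1.1; pose t1 (u : C * C * C) := u.1.2.
pose t2 (u : C * C * C) := u.2.
pose a : C * C * C := ((0, t0), t0).
have c1 : cts s' a.
  by apply: (@cts_comp _ _ _ (@fst (C * C) C) fst); [|apply/ctsP]; exact: cvg_fst.
have c2 : cts t1 a.
  apply: (@cts_comp _ _ _ (@fst (C * C) C) snd); [|apply/ctsP]; [exact: cvg_fst|exact: cvg_snd].
have c3 : cts t2 a by apply/ctsP; exact: cvg_snd.
pose F u := dd 'X^k (t1 u) (t2 u) * q.[c + s' u * t1 u]
  + t2 u ^+ k * (s' u * dd q (c + s' u * t1 u) (c + s' u * t2 u))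
  - r%:C%C * (s' u * dd d (c + s' u * t1 u) (c + s' u * t2 u)).
have FE s t t' : (branch_poly s).[t] - (branch_poly s).[t'] = (t - t') * F ((s, t), t').
  rewrite !branch_polyE /F /s' /t1 /t2 /=.
  have := ddE 'X^k t t'; rewrite !hornerXn => e1.
  have := ddE q (c + s * t) (c + s * t') => e2.
  have := ddE d (c + s * t) (c + s * t') => e3.
  have -> : t ^+ k * q.[c + s * t] - r%:C%C * d.[c + s * t]
    - (t' ^+ k * q.[c + s * t'] - r%:C%C * d.[c + s * t'])
    = (t ^+ k - t' ^+ k) * q.[c + s * t] + t' ^+ k * (q.[c + s * t] - q.[c + s * t'])
      - r%:C%C * (d.[c + s * t] - d.[c + s * t']) by ring.
  by rewrite e1 e2 e3; ring.
have cF : cts F a.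
  have l1 : cts (fun u => c + s' u * t1 u) a by apply: ctsD; [exact: cts_cst|exact: ctsM].
  have l2 : cts (fun u => c + s' u * t2 u) a by apply: ctsD; [exact: cts_cst|exact: ctsM].
  apply: ctsB; first apply: ctsD.
  - by apply: ctsM; [exact: cts_dd | exact: cts_horner].
  - apply: ctsM; first exact: ctsX.
    by apply: ctsM => //; exact: cts_dd.
  - apply: ctsM; first exact: cts_cst.
    by apply: ctsM => //; exact: cts_dd.
have t00 : t0 != 0.
  by apply: contraTneq A_neq0 => t00; rewrite -t0A t00 expr0n (gtn_eqF k0) eqxx.
have Fa : F a != 0.
  rewrite /F /s' /t1 /t2 /= !mul0r !mulr0 addr0 subr0 addr0 dd_diag derivXn.
  rewrite hornerMn hornerXn mulf_neq0 // -mulr_natr mulf_neq0 ?expf_neq0 //.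
  by rewrite pnatr_eq0 -lt0n.
have [[B1 B2] [/= [[B11 B12] [/= n1 n2] sub1] n3] sub] := cts_neq0 cF Fa.
have [e1 e10 P1] := (iffLR (nbhs_cabsP _ _)) n1.
have [e2 e20 P2] := (iffLR (nbhs_cabsP _ _)) n2.
have [e3 e30 P3] := (iffLR (nbhs_cabsP _ _)) n3.
exists (Num.min e1 (Num.min e2 e3)); first by rewrite !lt_min e10 e20 e30.
move=> s t t'; rewrite !lt_min => /andP[se _] /andP[_ /andP[te _]] /andP[_ /andP[_ te']].
move=> /rootP bt /rootP bt'; apply/eqP; rewrite -subr_eq0.
have := FE s t t'; rewrite bt bt' subrr => /esym/eqP; rewrite mulf_eq0.
suff /negPf -> : F (s, t, t') != 0 by rewrite orbF.
apply: (sub (s, t, t')); split => /=; last exact: P3.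
by apply: (sub1 (s, t)); split => /=; [apply: P1; rewrite subr0 | exact: P2].
Qed.

(** An implicit function argument. For small [s], [branch_poly s] has a root near [t0] by continuity
    of roots and only one by simplicity, so this root [T s] is continuous in [s]; the lift is
    [c + x ^+ m * T (x ^+ m)]. *)
Lemma local_branch t0 : t0 ^+ k = A ->
  exists2 e : R, 0 < e & forall e', 0 < e' <= e -> e' <= 1 ->
    forall x y, x != 0 -> cabs x <= e' -> n.[y] = root_disk x * d.[y] ->
    cabs ((y - c) / x ^+ m - t0) < e -> exists2 h, lift_on e' h & h x = y.
Proof.
move=> t0A; have [e1 e10 uniq_root] := branch_poly_simple t0A.
have rt0 : root (branch_poly 0) t0.
  apply/rootP; rewrite branch_polyE mul0r addr0 t0A /A divfK // subrr.
  by [].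
have [e2 e20 ex_root] := (iffLR (nbhs_cabsP _ _))
  (root_continuity size_branch_poly (fun t => cts_branch_poly t 0) (branch_poly_neq0 0) rt0 e10).
pose e0 := Num.min e1 e2.
have e00 : 0 < e0 by rewrite lt_min e10.
have e01 : e0 <= e1 by rewrite ge_min lexx.
have e02 : e0 <= e2 by rewrite ge_min lexx orbT.
have /choice[T TP] : forall s, exists t, cabs s < e0 ->
    root (branch_poly s) t /\ cabs (t - t0) < e1.
  move=> s; have [se|se] := ltP (cabs s) e0; last by exists 0.
  have [|t rt tt0] := ex_root s; first by rewrite subr0; exact: lt_le_trans e02.
  by exists t.
have cT s : cabs s < e0 -> cts T s.
  move=> se e e_gt0; have [rT Tt0] := TP s se.
  pose e' := Num.min e (e1 - cabs (T s - t0)).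
  have e'0 : 0 < e' by rewrite lt_min e_gt0 subr_gt0.
  have se' : \forall s' \near s, cabs s' < e0 by apply: cts_lt => //; exact: cts_id.
  have H := root_continuity size_branch_poly (fun t => cts_branch_poly t s)
    (branch_poly_neq0 s) rT e'0.
  near=> s'.
  have s'e : cabs s' < e0 by near: s'.
  have [t rt tTs] : exists2 t, root (branch_poly s') t & cabs (t - T s) < e' by near: s'.
  have [rT' T't0] := TP s' s'e.
  suff -> : T s' = t by apply: lt_le_trans tTs _; rewrite ge_min lexx.
  apply: (uniq_root s') => //; first exact: lt_le_trans e01.
  apply: le_lt_trans (cabs_sub _ (T s) _) _.
  have : e' <= e1 - cabs (T s - t0) by rewrite ge_min lexx orbT.
  lra.
exists (e0 / 2); first lra.
move=> e' /andP[e'0 e'e] e'1 x y x0 xe' nE ye.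
have cle z : cabs (clamp e' z ^+ m) < e0.
  rewrite cabsX; apply: (@le_lt_trans _ _ e'); last by lra.
  have ce := clamp_le z e'0.
  apply: le_trans ce; rewrite -[leRHS]expr1.
  by apply: ler_wiXn2l => //; [exact: cabs_ge0 | exact: le_trans (clamp_le z e'0) _].
pose h z := c + clamp e' z ^+ m * T (clamp e' z ^+ m).
have hE z : cabs z <= e' -> h z = c + z ^+ m * T (z ^+ m) by move=> ze; rewrite /h clamp_id.
exists h; last first.
  rewrite hE //.
  have xm : x ^+ m != 0 by rewrite expf_neq0.
  have xme : cabs (x ^+ m) < e0 by have := cle x; rewrite clamp_id.
  have [rT Tt0] := TP _ xme.
  rewrite (_ : T (x ^+ m) = (y - c) / x ^+ m); first by rewrite mulrCA divff // mulr1 addrC subrK.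
  apply: (uniq_root (x ^+ m)) => //; first exact: lt_le_trans e01.
    by apply: lt_le_trans ye _; lra.
  apply/(branch_poly_root _ (erefl _) x0).
  by rewrite mulrCA divff // mulr1 addrC subrK.
split=> [z|z ze'].
  have cc : cts (fun z => clamp e' z ^+ m) z by apply: ctsX; exact: clamp_cts.
  apply: ctsD; first exact: cts_cst.
  apply: ctsM => //; apply: (@cts_comp _ _ _ (fun z => clamp e' z ^+ m) T); first exact/ctsP.
  exact: cT.
rewrite hE //; have [->|z0] := eqVneq z 0.
  rewrite /root_disk ME !expr0n (gtn_eqF m0) muln_eq0 (gtn_eqF k0) (gtn_eqF m0) /=.
  rewrite mul0r mulr0 !addr0; apply/eqP; rewrite -subr_eq0 -hornerZ -hornerN -hornerD fE.
  by rewrite hornerM horner_exp hornerXsubC subrr expr0n (gtn_eqF k0) mul0r.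
apply/(branch_poly_root _ (erefl _) z0).
by have := cle z; rewrite clamp_id // => /TP[].
Unshelve. all: by end_near. Qed.

(** For [y] near [c], the ratio [(y - c) / x ^+ m] has its [k]-th power close to [A], hence is close
    to one of the finitely many [k]-th roots of [A], and [local_branch] applies there. *)
Lemma local_center :
  exists2 e : R, 0 < e & forall e', 0 < e' <= e -> e' <= 1 ->
    forall x y, x != 0 -> cabs x <= e' -> n.[y] = root_disk x * d.[y] ->
    cabs (y - c) < e -> exists2 h, lift_on e' h & h x = y.
Proof.
pose p : {poly C} := 'X^k - A%:P.
have sp : size p = k.+1 by rewrite size_XnsubC.
have p0 : p != 0 by rewrite -size_poly_gt0 sp.
have [rs pE _] := poly_factor p.
have [|z zrs|e e0 eP] := @seq_uniform _ _ rs (fun t0 e => t0 ^+ k = A ->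
  forall e', 0 < e' <= e -> e' <= 1 ->
    forall x y, x != 0 -> cabs x <= e' -> n.[y] = root_disk x * d.[y] ->
    cabs ((y - c) / x ^+ m - t0) < e -> exists2 h, lift_on e' h & h x = y).
- move=> t0 e e' H /andP[e'0 e'e] t0A f /andP[f0 fe'] f1 x y x0 xf nE ye.
  apply: (H t0A f) => //; last exact: lt_le_trans e'e.
  by rewrite f0 (le_trans fe').
- have [zA|zA] := pselect (z ^+ k = A); last by exists 1.
  by have [e e0 eP] := local_branch zA; exists e.
pose f y := r%:C%C * d.[y] / q.[y].
have cf : cts f c.
  apply: ctsM; last by apply: ctsV => //; apply: cts_horner; exact: cts_id.
  apply: ctsM; first exact: cts_cst.
  by apply: cts_horner; exact: cts_id.
have d0 : 0 < cabs (lead_coef p) * e ^+ (size p).-1.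
  by rewrite mulr_gt0 ?exprn_gt0 // cabs_gt0 lead_coef_eq0.
have qn : \forall y \near c, q.[y] != 0.
  by apply: (@cts_neq0 _ _ (horner q)) => //; apply: cts_horner; exact: cts_id.
have [e1 e10 e1P] := (iffLR (nbhs_cabsP _ _)) (nbhsI qn (cf _ d0)).
exists (Num.min e e1); first by rewrite lt_min e0.
move=> e' /andP[e'0]; rewrite !le_min => /andP[e'e _] e'1 x y x0 xe' nE.
rewrite lt_min => /andP[yc /e1P[qy fy]].
have xm : x ^+ m != 0 by rewrite expf_neq0.
pose t := (y - c) / x ^+ m.
have tk : t ^+ k = f y.
  have : (y - c) ^+ k * q.[y] = r%:C%C * x ^+ M * d.[y].
    have := congr1 (horner^~ y) fE.
    rewrite hornerM horner_exp hornerXsubC hornerD hornerN hornerZ nE /root_disk => <-.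
    by ring.
  rewrite /t /f expr_div_n -exprM mulnC -ME => E.
  have -> : (y - c) ^+ k = r%:C%C * x ^+ M * d.[y] / q.[y] by rewrite -E mulfK.
  have : x ^+ M != 0 by rewrite expf_neq0.
  by move=> xM; field; rewrite qy xM.
have ptE z : p.[z] = z ^+ k - A by rewrite /p hornerD hornerN hornerXn hornerC.
have pt : p.[t] = f y - A by rewrite ptE tk.
have [|||z zr tz] := @near_root_of_small _ p e t; first by rewrite sp ltnS.
- exact: e0.
- by rewrite pt.
apply: (eP z) => //; last 1 first.
- by rewrite e'0.
- move: zr; rewrite pE rootE hornerZ mulf_eq0 lead_coef_eq0 (negPf p0) /=.
  by rewrite -rootE root_prod_XsubC.
- by move/rootP: zr; rewrite ptE => /eqP; rewrite subr_eq0 => /eqP.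
Qed.

End Local.

Lemma fiber_bounded : exists2 B : R, 0 < B & forall y w,
  n.[y] = w * d.[y] -> cabs (w - v) <= r -> cabs y <= B /\ cabs d.[y] <= B.
Proof.
have [B BP] := bounded_of_poly_le (cabs v + r) size_dn.
pose B1 := Num.max 1 B.
have B11 : 1 <= B1 by rewrite le_max lexx.
pose L := (\sum_(i < size d) cabs d`_i) * B1 ^+ (size d).-1.
have L0 : 0 <= L.
  apply: mulr_ge0; last by rewrite exprn_ge0 // (le_trans _ B11).
  by apply: sumr_ge0 => i _; exact: cabs_ge0.
exists (B1 + L); first lra.
move=> y w nE wr; have yB : cabs y <= B1.
  rewrite le_max BP ?orbT // nE cabsM ler_wpM2r ?cabs_ge0 //.
  by have := cabs_sub w v 0; rewrite !subr0; lra.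
have dL := horner_le d B11 yB; split; first lra.
by apply: (le_trans dL); rewrite -/L; lra.
Qed.

Lemma cabs_root_disk x : cabs (root_disk x - v) = r * cabs x ^+ M.
Proof.
rewrite /root_disk addrAC subrr add0r cabsM cabs_real cabsX.
by rewrite gtr0_norm.
Qed.

Lemma root_disk_le x : cabs x <= 1 -> cabs (root_disk x - v) <= r.
Proof.
by move=> x1; rewrite cabs_root_disk ler_piMr ?(ltW r0) // exprn_ile1 ?cabs_ge0.
Qed.

Lemma root_disk_neq x : x != 0 -> root_disk x != v.
Proof.
move=> x0; rewrite -subr_eq0 -cabs_eq0 cabs_root_disk mulf_neq0 ?gt_eqF //.
by rewrite exprn_gt0 // cabs_gt0.
Qed.

Lemma cts_root_disk x : cts root_disk x.
Proof.
apply: ctsD; first exact: cts_cst.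
by apply: ctsM; [exact: cts_cst | apply: ctsX; exact: cts_id].
Qed.

(** Over a small disk every point of the fiber is close to a root of [n - v *: d]; these roots are
    finitely many, so [local_center] yields a common radius. *)
Lemma liftable_small : exists2 e : R, 0 < e <= 1 & liftable e.
Proof.
have sn := size_n_gt1.
have [c rc] : exists c, root (n - v *: d) c.
  by apply/closed_rootP; rewrite size_fiber gtn_eqF.
have [rs qE _] := poly_factor (n - v *: d).
have [|z zrs|e e0 eP] := @seq_uniform _ _ rs (fun c e => root (n - v *: d) c ->
  forall e', 0 < e' <= e -> e' <= 1 ->
    forall x y, x != 0 -> cabs x <= e' -> n.[y] = root_disk x * d.[y] ->
    cabs (y - c) < e -> exists2 h, lift_on e' h & h x = y).
- move=> t0 e e' H /andP[e'0 e'e] t0A f /andP[f0 fe'] f1 x y x0 xf nE ye.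
  apply: (H t0A f) => //; last exact: lt_le_trans e'e.
  by rewrite f0 (le_trans fe').
- have [rz|rz] := pselect (root (n - v *: d) z); last by exists 1.
  have [k [m [q [fE qz k0 m1 ME]]]] := orders rz.
  by have [e e0 eP] := local_center fE qz k0 (ltnW m1) ME; exists e.
have [B B0 BP] := fiber_bounded.
pose dl := cabs (lead_coef (n - v *: d)) * e ^+ (size (n - v *: d)).-1.
have dl0 : 0 < dl.
  by rewrite mulr_gt0 ?exprn_gt0 // cabs_gt0 lead_coef_fiber lead_coef_eq0
    -size_poly_gt0 (ltn_trans _ sn).
pose e' := Num.min 1 (Num.min e (dl / (2 * r * B))).
have e'0 : 0 < e' by rewrite !lt_min ltr01 e0 divr_gt0 // !mulr_gt0.
have e'1 : e' <= 1 by rewrite ge_min lexx.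
have e'e : e' <= e by rewrite !ge_min lexx orbT.
have e'd : e' * (2 * r * B) <= dl.
  by rewrite -ler_pdivlMr ?mulr_gt0 // !ge_min lexx !orbT.
exists e'; first by rewrite e'0.
move=> x y x0 xe' nE.
have x1 : cabs x <= 1 := le_trans xe' e'1.
have [_ dB] := BP _ _ nE (root_disk_le x1).
have M0 : (0 < M)%N.
  have [k [m [q [_ _ k0 m1 ->]]]] := orders rc.
  by rewrite muln_gt0 k0 (ltnW m1).
have qy : cabs (n - v *: d).[y] < dl.
  rewrite hornerD hornerN hornerZ nE -mulrBl cabsM cabs_root_disk.
  have xM : cabs x ^+ M <= e'.
    apply: le_trans xe'; rewrite -[leRHS]expr1.
    by apply: ler_wiXn2l => //; exact: cabs_ge0.
  have := cabs_ge0 d.[y]; have : 0 <= cabs x ^+ M by rewrite exprn_ge0 ?cabs_ge0.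
  move=> h1 h2; apply: (@le_lt_trans _ _ (r * e' * B)).
    by apply: ler_pM => //; [rewrite mulr_ge0 ?(ltW r0) | rewrite ler_pM2l].
  have : 0 < r * e' * B by rewrite !mulr_gt0.
  nra.
have [|z zr yz] := near_root_of_small _ e0 qy; first by rewrite size_fiber.
apply: (eP z _ _ e') => //; last by rewrite e'0.
move: zr; rewrite {1}qE rootE hornerZ mulf_eq0 lead_coef_eq0.
rewrite -size_poly_eq0 size_fiber (gtn_eqF (ltnW sn)) /=.
by rewrite -rootE root_prod_XsubC.
Qed.

(** The points over the annulus [r * e ^+ M <= cabs (w - v) <= r], written without division. For
    [0 < e] it is compact and free of critical points. *)
Definition annulus_fiber (e : R) : set C := [set y |
  r * e ^+ M * cabs d.[y] <= cabs (n - v *: d).[y] <= r * cabs d.[y]].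

Lemma annulus_fiberP e y x : n.[y] = root_disk x * d.[y] -> 0 <= e -> e <= cabs x <= 1 ->
  annulus_fiber e y.
Proof.
move=> nE e0 /andP[ex x1]; rewrite /annulus_fiber /=.
rewrite hornerD hornerN hornerZ nE -mulrBl cabsM.
rewrite !ler_wpM2r ?cabs_ge0 ?root_disk_le // cabs_root_disk ler_wpM2l ?(ltW r0) //.
by apply: lerXn2r; rewrite ?nnegrE ?cabs_ge0.
Qed.

Lemma annulus_fiber_value e y : 0 < e -> annulus_fiber e y ->
  exists w, [/\ n.[y] = w * d.[y], w != v & cabs (w - v) <= r].
Proof.
move=> e0; rewrite /annulus_fiber /= hornerD hornerN hornerZ => /andP[a1 a2].
have dy : d.[y] != 0.
  apply/eqP => dy; move: a2; rewrite dy mulr0 subr0 cabs0 mulr0 => ny.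
  have := nd0 dy; rewrite -cabs_eq0.
  by rewrite eq_le ny cabs_ge0.
have dy0 : 0 < cabs d.[y] by rewrite cabs_gt0.
exists (n.[y] / d.[y]); split; first by rewrite divfK.
  apply: contraTneq a1 => <-; rewrite divfK // subrr cabs0 -ltNge.
  by rewrite !mulr_gt0 // exprn_gt0.
have -> : n.[y] / d.[y] - v = (n.[y] - v * d.[y]) / d.[y] by field.
by rewrite cabsM cabsV ler_pdivrMr.
Qed.

Lemma annulus_fiber_compact e : 0 < e -> compact (annulus_fiber e).
Proof.
move=> e0; have [B _ BP] := fiber_bounded.
apply: (@compact_closed_bounded _ _ B); last first.
  by move=> y /(annulus_fiber_value e0)[w [nE _ wv]]; have [] := BP _ _ nE wv.
have cp (p : {poly C}) : continuous (fun y => cabs p.[y] : R).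
  move=> y; apply: (@continuous_comp _ _ _ (horner p) (@cabs R)).
    by apply/ctsP/cts_horner; exact: cts_id.
  exact: cabs_continuous.
have -> : annulus_fiber e =
    [set y | 0 <= 1 * cabs (n - v *: d).[y] - r * e ^+ M * cabs d.[y]] `&`
    [set y | 0 <= r * cabs d.[y] - 1 * cabs (n - v *: d).[y]].
  apply/seteqP; split=> y /=; rewrite /annulus_fiber /= !mul1r !subr_ge0; first by move=> /andP[].
  by move=> [-> ->].
apply: closedI; apply: closed_ge0 => y.
  exact: (@continuous_lincomb R _ (fun y => cabs (n - v *: d).[y])
    (fun y => cabs d.[y]) 1 (r * e ^+ M) y (cp _ y) (cp _ y)).
exact: (@continuous_lincomb R _ (fun y => cabs d.[y])
  (fun y => cabs (n - v *: d).[y]) r 1 y (cp _ y) (cp _ y)).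
Qed.

(** The last hypothesis says, without division, that [x] and [x'] have the same image. The
    difference of its sides is [(x - x') * F (x, x')], and [F (y, y)] is the wronskian. The extra
    center [y'] makes the radius locally uniform, as [compact_uniform] requires. *)
Lemma wronskian_inj y : (wronskian n d).[y] != 0 ->
  \forall e \near 0^'+, forall y' x x', cabs (y' - y) < e -> cabs (x - y') < e ->
    cabs (x' - y') < e -> n.[x] * d.[x'] = n.[x'] * d.[x] -> x = x'.
Proof.
move=> Wy; pose F (u : C * C) := dd n u.1 u.2 * d.[u.2] - n.[u.2] * dd d u.1 u.2.
have c1 : cts (fun u : C * C => u.1) (y, y) by apply/ctsP; exact: cvg_fst.
have c2 : cts (fun u : C * C => u.2) (y, y) by apply/ctsP; exact: cvg_snd.
have cF : cts F (y, y).
  by apply: ctsB; apply: ctsM; do ?[exact: cts_dd | exact: cts_horner].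
have Fy : F (y, y) != 0 by move: Wy; rewrite /F /= !dd_diag /wronskian hornerD hornerN !hornerM.
have [[B1 B2] [/= n1 n2] sub] := cts_neq0 cF Fy.
have [e1 e10 P1] := (iffLR (nbhs_cabsP _ _)) n1.
have [e2 e20 P2] := (iffLR (nbhs_cabsP _ _)) n2.
have h0 : 0 < Num.min e1 e2 / 2 by rewrite divr_gt0 // lt_min e10.
near=> e => y' x x' y'e xe x'e E.
have ee : e <= Num.min e1 e2 / 2 by near: e; exact: nbhs_right_le.
have ee1 : e <= e1 / 2 by apply: le_trans ee _; rewrite ler_pM2r // ge_min lexx.
have ee2 : e <= e2 / 2 by apply: le_trans ee _; rewrite ler_pM2r // ge_min lexx orbT.
have Fn : F (x, x') != 0.
  apply: (sub (x, x')); split => /=.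
    by apply: P1; have := cabs_sub x y' y; lra.
  by apply: P2; have := cabs_sub x' y' y; lra.
have : (x - x') * F (x, x') = 0.
  rewrite /F /= mulrBr mulrA -ddE mulrCA -ddE.
  have -> : (n.[x] - n.[x']) * d.[x'] - n.[x'] * (d.[x] - d.[x'])
    = n.[x] * d.[x'] - n.[x'] * d.[x] by ring.
  by rewrite E subrr.
by move/eqP; rewrite mulf_eq0 (negPf Fn) orbF subr_eq0 => /eqP.
Unshelve. all: by end_near. Qed.

Lemma annulus_fiber_inj e : 0 < e -> exists2 eta : R, 0 < eta &
  forall y, annulus_fiber e y -> forall x x', cabs (x - y) < eta ->
    cabs (x' - y) < eta -> n.[x] * d.[x'] = n.[x'] * d.[x] -> x = x'.
Proof.
move=> e0; apply: compact_uniform; first exact: annulus_fiber_compact.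
  move=> y e1 e2 H /andP[_ e12] x x' xe xe'.
  by apply: H; [exact: lt_le_trans e12 | exact: lt_le_trans e12].
move=> y /(annulus_fiber_value e0)[w [nE wv wr]].
have H := wronskian_inj (noncrit nE wv wr).
have H2 : \forall e \near (0:R)^'+, 0 < e /\ forall y' x x', cabs (y' - y) < e ->
   cabs (x - y') < e -> cabs (x' - y') < e -> n.[x] * d.[x'] = n.[x'] * d.[x] -> x = x'.
  by near=> a; split; near: a => //; exact: nbhs_right_gt.
case: (@filter_ex _ _ (at_right_proper_filter (0:R)) _ H2) => a [a0 aP].
exists a => //; apply/nbhs_cabsP; exists a => // y' y'a x x'; exact: aP.
Unshelve. all: by end_near. Qed.

Lemma near_fiber y w (e : R) : 0 < e ->
  cabs (n.[y] - w * d.[y]) < cabs (lead_coef n) * e ^+ (size n).-1 ->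
  exists2 z, n.[z] = w * d.[z] & cabs (z - y) < e.
Proof.
move=> e0 H; have sn := size_n_gt1.
have [|||z zr yz] := @near_root_of_small _ (n - w *: d) e y.
- by rewrite size_fiber.
- exact: e0.
- by rewrite hornerD hornerN hornerZ size_fiber lead_coef_fiber.
exists z; last by rewrite cabsB.
by move/rootP: zr; rewrite hornerD hornerN hornerZ => /eqP; rewrite subr_eq0 => /eqP.
Qed.

Lemma lift_on_clamp e h : 0 < e -> lift_on e h -> forall x,
  n.[h (clamp e x)] = root_disk (clamp e x) * d.[h (clamp e x)].
Proof. by move=> e0 [_ hP] x; apply: hP; exact: clamp_le. Qed.

(** Continuation from radius [a] to radius [b], in the role of the monodromy theorem. The new value
    at [z] is the point over [root_disk (clamp b z)] within [eta] of the old lift at [clamp a z]: it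
    exists because the parameter moves by at most [dl], and near the rim it is unique because [eta]
    is an injectivity radius. As [dl] depends on [e] but not on [a], finitely many steps will do. *)
Lemma liftable_step e : 0 < e -> e <= 1 -> exists2 dl : R, 0 < dl &
  forall a b, e <= a -> a <= b -> b <= 1 -> b - a <= dl -> liftable a -> liftable b.
Proof.
move=> e0 e1; have e20 : 0 < e / 2 by lra.
(* Continuity at points with [e <= cabs z] also needs uniqueness at their neighbors, hence the
   radius [e / 2]. *)
have [eta eta0 inj] := annulus_fiber_inj e20.
have [B B0 BP] := fiber_bounded.
have lc0 : 0 < cabs (lead_coef n).
  by rewrite cabs_gt0 lead_coef_eq0 -size_poly_gt0 (ltn_trans _ size_n_gt1).
pose mu := cabs (lead_coef n) * eta ^+ (size n).-1.
have mu0 : 0 < mu by rewrite mulr_gt0 ?exprn_gt0.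
(* Moving the parameter by [dl] changes [n - w *: d] on the fiber by at most [mu / 2], below the
   threshold [mu] of [near_fiber]; the added 1 keeps the denominator nonzero whatever [M] is. *)
pose dl := mu / (2 * r * (M%:R + 1) * B).
have M10 : 0 < M%:R + 1 :> R by rewrite ltr_wpDl.
have dl0 : 0 < dl by rewrite divr_gt0 // !mulr_gt0.
exists dl => // a b ea ab b1 bad La x y x0 xb nE.
have a0 : 0 < a by exact: lt_le_trans ea.
have b0 : 0 < b by exact: lt_le_trans ab.
have a1 : a <= 1 by exact: le_trans b1.
(* Moving the base point by at most dl changes the fibre by less than [eta]. *)
have move u u' z : cabs u <= 1 -> cabs u' <= 1 -> cabs (u' - u) <= dl ->
    n.[z] = root_disk u * d.[z] ->
    exists2 z', n.[z'] = root_disk u' * d.[z'] & cabs (z' - z) < eta.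
  move=> u1 u'1 uu' nz; apply: near_fiber => //.
  rewrite nz -mulrBl cabsM /root_disk.
  have -> : v + r%:C%C * u ^+ M - (v + r%:C%C * u' ^+ M) =
    r%:C%C * (u ^+ M - u' ^+ M) by ring.
  rewrite cabsM cabs_real gtr0_norm //.
  have [_ dB] := BP _ _ nz (root_disk_le u1).
  have uM : cabs (u ^+ M - u' ^+ M) <= (M%:R + 1) * dl.
    apply: (le_trans (cabs_subXX M u1 u'1)); rewrite cabsB.
    apply: ler_pM => //; first exact: cabs_ge0.
    by rewrite ler_wpDr.
  have := cabs_ge0 d.[z]; have := cabs_ge0 (u ^+ M - u' ^+ M) => h1 h2.
  apply: (@le_lt_trans _ _ (r * ((M%:R + 1) * dl) * B)).
    by apply: ler_pM => //; [rewrite mulr_ge0 ?(ltW r0) | rewrite ler_pM2l].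
  have -> : r * ((M%:R + 1) * dl) * B = mu / 2.
    by rewrite /dl; field; rewrite !gt_eqF.
  by rewrite -/mu; lra.
have clab z : cabs (clamp b z - clamp a z) <= dl.
  by apply: le_trans bad; exact: cabs_clampB.
have cl1 c z : 0 < c -> c <= 1 -> cabs (clamp c z) <= 1.
  by move=> c0 c1; apply: le_trans c1; exact: clamp_le.
have cla0 z : z != 0 -> clamp a z != 0.
  by move=> z0; rewrite -cabs_eq0 cabs_clamp // gt_eqF // lt_min a0 cabs_gt0.
(* First push [y] back to the radius [a], then lift on the smaller disk. *)
have [y1 n1 y1y] : exists2 y1, n.[y1] = root_disk (clamp a x) * d.[y1] &
    (cabs x <= a -> y1 = y) /\ cabs (y - y1) < eta.
  have [xa|ax] := leP (cabs x) a.
    by exists y; rewrite ?clamp_id // subrr cabs0.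
  have [|||y1 n1 y1y] := @move x (clamp a x) y _ _ _ nE.
  - exact: le_trans b1.
  - exact: cl1.
  - by have := clab x; rewrite (clamp_id b0 xb) cabsB.
  by exists y1 => //; split=> //; rewrite cabsB.
have [h Lh hx] := La (clamp a x) y1 (cla0 _ x0) (clamp_le _ a0) n1.
have hP := lift_on_clamp a0 Lh; have [ch _] := Lh.
have good z : e / 2 <= cabs z -> annulus_fiber (e / 2) (h (clamp a z)).
  move=> ez; apply: annulus_fiberP (hP z) (ltW e20) _.
  by rewrite cl1 // andbT cabs_clamp // le_min ez andbT; lra.
have /choice[g gP] : forall z, exists y',
    [/\ n.[y'] = root_disk (clamp b z) * d.[y'], cabs (y' - h (clamp a z)) < eta &
      cabs z <= a -> y' = h z].
  move=> z; have [za|az] := leP (cabs z) a.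
    exists (h z); rewrite !clamp_id ?(le_trans za) // subrr cabs0; split=> //.
    by have := hP z; rewrite clamp_id.
  have [|||y' n' y'h] := @move (clamp a z) (clamp b z) (h (clamp a z)) _ _ _ (hP z).
  - exact: cl1.
  - exact: cl1.
  - exact: clab.
  by exists y'; split.
have gU z y' : e / 2 <= cabs z -> n.[y'] = root_disk (clamp b z) * d.[y'] ->
    cabs (y' - h (clamp a z)) < eta -> y' = g z.
  move=> ez n' y'h; have [ng gh _] := gP z.
  by apply: (inj _ (good z ez)) => //; rewrite n' ng; ring.
exists g; last first.
  have [ng gh ga] := gP x; have [xa|ax] := leP (cabs x) a.
    rewrite ga //; move: hx; rewrite clamp_id // => ->.
    by case: y1y => ->.
  symmetry; apply: gU; first lra.
    by rewrite clamp_id.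
  by rewrite hx; case: y1y.
split=> [z|z zb]; last by have [] := gP z; rewrite clamp_id.
have [za|az] := ltP (cabs z) a.
  apply: (@cts_near _ _ h); last exact: ch.
  have : \forall t \near z, cabs t < a by apply: cts_lt za; exact: cts_id.
  by move/nbhsS; apply; move=> t ta; have [_ _ ->] := gP t; rewrite // ltW.
move=> e' e'0; have [ng gh _] := gP z.
have cha : cts (fun t => h (clamp a t)) z.
  by apply: (@cts_comp _ _ _ (clamp a) h); [apply/ctsP; exact: clamp_cts | exact: ch].
(* Half of the slack left below [eta]: one half absorbs the move of the old lift from [z] to [t],
   the other the move from [g z] to the nearby fiber point. *)
pose k := Num.min e' ((eta - cabs (g z - h (clamp a z))) / 2).
have k0 : 0 < k by rewrite lt_min e'0 divr_gt0 // subr_gt0.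
have nu0 : 0 < cabs (lead_coef n) * k ^+ (size n).-1 by rewrite mulr_gt0 ?exprn_gt0.
have cb : cts (fun t => n.[g z] - root_disk (clamp b t) * d.[g z]) z.
  apply: ctsB; first exact: cts_cst.
  apply: ctsM; last exact: cts_cst.
  apply: (@cts_comp _ _ _ (clamp b) root_disk); [apply/ctsP; exact: clamp_cts|].
  exact: cts_root_disk.
near=> t.
have tz : e / 2 <= cabs t.
  have tz : cabs (t - z) < e / 2 by near: t; exact: near_cabs.
  by have := cabs_sub z t 0; rewrite !subr0 (cabsB z t); lra.
have ht : cabs (h (clamp a t) - h (clamp a z)) < k by near: t; exact: cha.
have [|y' n' y'g] := @near_fiber (g z) (root_disk (clamp b t)) k k0.
  by near: t; apply: cts_lt cb _; rewrite ng subrr cabs0.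
have kk : k <= (eta - cabs (g z - h (clamp a z))) / 2 by rewrite ge_min lexx orbT.
rewrite -(@gU t y') //; first by apply: lt_le_trans y'g _; rewrite ge_min lexx.
have := cabs_sub y' (g z) (h (clamp a t)); have := cabs_sub (g z) (h (clamp a z)) (h (clamp a t)).
rewrite (cabsB (h (clamp a z))); lra.
Unshelve. all: by end_near. Qed.

Lemma liftable1 : liftable 1.
Proof.
have [e /andP[e0 e1] Le] := liftable_small.
have [dl dl0 step] := liftable_step e0 e1.
have H k : liftable (Num.min 1 (e + dl *+ k)).
  elim: k => [|k IH]; first by rewrite mulr0n addr0 min_r.
  have p0 : 0 <= dl *+ k by rewrite mulrn_wge0 // ltW.
  rewrite mulrS; apply: step IH.
  - by rewrite le_min e1 lerDl.
  - by have [?|?] := leP 1 (e + dl *+ k); have [?|?] := leP 1 (e + (dl + dl *+ k)); lra.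
  - by rewrite ge_min lexx.
  by have [?|?] := leP 1 (e + dl *+ k); have [?|?] := leP 1 (e + (dl + dl *+ k)); lra.
have dV : 0 <= dl^-1 by rewrite invr_ge0 ltW.
have := H (Num.bound dl^-1); rewrite min_l //.
have := archi_boundP dV; rewrite -(ltr_pM2l dl0) divff ?gt_eqF // mulr_natr.
lra.
Qed.

End Lifting.

(** * Smooth curves carried by holomorphic disks *)

Section Smooth.
Variable R : realType.
Local Notation C := R[i].
Local Notation real := (fun r : R => r%:C%C : C).
Local Notation hol := (dif (@id C)).
Implicit Types (n d p : {poly C}) (O : set R) (y f : R -> C) (A : set C).

(** Implicit differentiation of [n(h) = f * d(h)], with the divided differences of [n] and [d]
    gathered in [G], a continuous function equal to the wronskian at [a]. The coordinate [i] covers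
    complex and real variables. *)
Lemma lift_dif n d (T : topologicalType) (i f h : T -> C) a D :
  cts i a -> cts h a -> dif i f a D ->
  (\forall t \near a, n.[h t] = f t * d.[h t]) ->
  (wronskian n d).[h a] != 0 ->
  dif i h a (D * d.[h a] ^+ 2 / (wronskian n d).[h a]).
Proof.
move=> ci ch fD nE W0.
pose G t := dd n (h t) (h a) * d.[h a] - n.[h a] * dd d (h t) (h a).
have Ga : G a = (wronskian n d).[h a].
  by rewrite /G !dd_diag /wronskian hornerD hornerN !hornerM.
have cG : cts G a.
  have ca : cts (fun=> h a) a by exact: cts_cst.
  apply: ctsB; apply: ctsM; [exact: cts_dd | exact: cts_cst | exact: cts_cst | exact: cts_dd].
have G0 : G a != 0 by rewrite Ga.
case: fD => u [cu ua fE]; exists (fun t => u t * (d.[h t] * d.[h a]) / G t); split.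
- apply: ctsM; last exact: ctsV.
  by apply: ctsM => //; apply: ctsM; [exact: cts_horner | exact: cts_cst].
- by rewrite ua Ga expr2.
have GN := cts_neq0 cG G0; have nEa := nbhs_singleton nE.
near=> t.
have Gt : G t != 0 by near: t.
apply: (mulIf Gt); rewrite mulrA (divfK Gt).
have -> : (h t - h a) * G t = n.[h t] * d.[h a] - n.[h a] * d.[h t].
  rewrite /G mulrBr mulrA -ddE mulrCA -ddE; ring.
have -> : n.[h t] = f t * d.[h t] by near: t.
rewrite nEa mulrA.
have -> : (i t - i a) * u t = f t - f a by apply/esym; near: t.
by ring.
Unshelve. all: by end_near. Qed.

(** For the center of a lifted disk, where the wronskian may vanish and [lift_dif] fails. *)
Lemma hol_of_quadratic (f : C -> C) a (K : R) :
  (\forall t \near a, cabs (f t - f a) <= K * cabs (t - a) ^+ 2) -> hol f a 0.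
Proof.
move=> fK; exists (fun t => (f t - f a) / (t - a)); split.
- move=> e e0; have e1 : 0 < e / (`|K| + 1).
    by rewrite divr_gt0 // ltr_wpDl.
  near=> t; rewrite subrr mul0r subr0.
  have [->|ta] := eqVneq t a; first by rewrite subrr mul0r cabs0.
  have ta0 : 0 < cabs (t - a) by rewrite cabs_gt0 subr_eq0.
  rewrite cabsM cabsV ltr_pdivrMr //.
  have H : cabs (f t - f a) <= K * cabs (t - a) ^+ 2 by near: t.
  have te : cabs (t - a) < e / (`|K| + 1) by near: t; exact: near_cabs.
  move: te; rewrite ltr_pdivlMr ?ltr_wpDl // => te.
  have KK := ler_norm K; apply: (le_lt_trans H).
  rewrite expr2 mulrA ltr_pM2r //; nra.
- by rewrite subrr mul0r.
near=> t; have [->|ta] := eqVneq t a; first by rewrite !subrr mul0r.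
by rewrite mulrC divfK // subr_eq0.
Unshelve. all: by end_near. Qed.

(** Class C^k, with the successive derivatives as witnesses; closure under algebraic operations is
    then a plain induction on [k]. *)
Fixpoint Cn O (k : nat) (y : R -> C) : Prop :=
  if k is k'.+1 then
    exists2 y', (forall t, O t -> dif real y t (y' t)) & Cn O k' y'
  else forall t, O t -> cts y t.

Lemma Cn_S O k y : Cn O k.+1 y -> Cn O k y.
Proof.
elim: k y => [|k IH] y [y' yD Cy'].
  by move=> t Ot; apply: dif_cts (yD t Ot); exact: cts_real.
by exists y' => //; exact: IH.
Qed.

Lemma Cn_ext O k y f : open O -> (forall t, O t -> y t = f t) -> Cn O k y -> Cn O k f.
Proof.
move=> oO yf; have near_yf t : O t -> \forall s \near t, y s = f s.
  by move=> Ot; have := open_nbhs_nbhs (conj oO Ot); move/nbhsS; apply.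
case: k => [|k].
  by move=> Cy t Ot; apply: cts_near (near_yf t Ot) (Cy t Ot).
move=> [y' yD Cy']; exists y' => // t Ot.
exact: dif_near (near_yf t Ot) (yD t Ot).
Qed.

Lemma Cn_cst O k c : Cn O k (fun=> c).
Proof.
elim: k c => [|k IH] c; first by move=> t _; exact: cts_cst.
by exists (fun=> 0) => // t _; exact: dif_cst.
Qed.

Lemma Cn_real O k : Cn O k real.
Proof.
case: k => [|k]; first by move=> t _; exact: cts_real.
by exists (fun=> 1); [move=> t _; exact: dif_id | exact: Cn_cst].
Qed.

Lemma CnD O k y f : Cn O k y -> Cn O k f -> Cn O k (fun t => y t + f t).
Proof.
elim: k y f => [|k IH] y f.
  by move=> Cy Cf t Ot; apply: ctsD; [exact: Cy | exact: Cf].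
move=> [y' yD Cy'] [f' fD Cf']; exists (fun t => y' t + f' t); last exact: IH.
by move=> t Ot; apply: difD; [exact: yD | exact: fD].
Qed.

Lemma CnM O k y f : Cn O k y -> Cn O k f -> Cn O k (fun t => y t * f t).
Proof.
elim: k y f => [|k IH] y f.
  by move=> Cy Cf t Ot; apply: ctsM; [exact: Cy | exact: Cf].
move=> Cy Cf; have Cy1 := Cn_S Cy; have Cf1 := Cn_S Cf.
case: Cy Cf => [y' yD Cy'] [f' fD Cf']; exists (fun t => y' t * f t + y t * f' t).
  by move=> t Ot; apply: difM; [exact: cts_real | exact: yD | exact: fD].
by apply: CnD; exact: IH.
Qed.

Lemma CnX O k y m : Cn O k y -> Cn O k (fun t => y t ^+ m).
Proof.
move=> Cy; elim: m => [|m IH]; first exact: Cn_cst.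
rewrite (_ : (fun t => _) = (fun t => y t * y t ^+ m)); first exact: CnM.
by apply/funext => t; rewrite exprS.
Qed.

Lemma CnV O k y : (forall t, O t -> y t != 0) -> Cn O k y -> Cn O k (fun t => (y t)^-1).
Proof.
move=> y0; elim: k => [|k IH].
  by move=> Cy t Ot; apply: ctsV; [exact: y0 | exact: Cy].
move=> Cy; have Cy1 := Cn_S Cy; case: Cy => [y' yD Cy'].
exists (fun t => - y' t * ((y t)^-1 ^+ 2)).
  move=> t Ot; rewrite exprVn; apply: difV; [exact: cts_real | exact: y0 | exact: yD].
apply: CnM; last by apply: CnX; exact: IH.
rewrite (_ : (fun t => _) = (fun t => (- 1) * y' t)).
  by apply: CnM => //; exact: Cn_cst.
by apply/funext => t; rewrite mulN1r.
Qed.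

Lemma Cn_horner O k p y : Cn O k y -> Cn O k (fun t => p.[y t]).
Proof.
move=> Cy; elim/poly_ind: p => [|p c IH].
  rewrite (_ : (fun t => _) = (fun=> 0)); first exact: Cn_cst.
  by apply/funext => t; rewrite horner0.
rewrite (_ : (fun t => _) = (fun t => p.[y t] * y t + c)).
  by apply: CnD; [exact: CnM | exact: Cn_cst].
by apply/funext => t; rewrite hornerMXaddC.
Qed.

(** Bootstrapping: the derivative of [y] is a rational expression in [y] and the derivative of [f],
    so each class known for [y] gives the next one. *)
Lemma Cn_lift O k n d y f : open O ->
  (forall t, O t -> cts y t) -> (forall t, O t -> n.[y t] = f t * d.[y t]) ->
  (forall t, O t -> (wronskian n d).[y t] != 0) -> Cn O k f -> Cn O k y.
Proof.
move=> oO cy nE W0; elim: k => [//|k IH] Cf.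
have Cy := IH (Cn_S Cf); case: Cf => [f' fD Cf'].
exists (fun t => f' t * d.[y t] ^+ 2 / (wronskian n d).[y t]).
  move=> t Ot; apply: lift_dif; [exact: cts_real | exact: cy | exact: fD | | exact: W0].
  by have := open_nbhs_nbhs (conj oO Ot); move/nbhsS; apply.
apply: CnM; last by apply: CnV => //; exact: Cn_horner.
by apply: CnM => //; apply: CnX; exact: Cn_horner.
Qed.

(* Bounds the Kobayashi metric of [A] at [z] in the direction [w] by [2]. *)
Definition disk_through A (z w : C) : Prop := exists phi : C -> C,
  [/\ forall x, cabs x < 1 -> A (phi x) /\ exists D, hol phi x D, phi 0 = z &
      exists2 D, hol phi 0 D & 2 * D = w].

(** The open set [O] around the unit interval provides smoothness up to the endpoints. By the disk
    condition, a piece costs Kobayashi length at most 2. *)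
Definition piece A (z z' : C) : Prop := exists y O,
  [/\ open O, (forall t, 0 <= t <= 1 -> O t), (forall k, Cn O k y), y 0 = z /\ y 1 = z' &
      forall t, 0 <= t <= 1 -> exists2 D, dif real y t D & disk_through A (y t) D].

Definition seg (a b : C) (t : R) : C := a + t%:C%C * (b - a).

Lemma dif_seg a b t : dif real (seg a b) t (b - a).
Proof.
apply: (@dif_eq _ _ _ _ _ (0 + (1 * (b - a) + t%:C%C * 0))).
  by rewrite add0r mul1r mulr0 addr0.
apply: difD; first exact: dif_cst.
by apply: difM; [exact: cts_real | exact: dif_id | exact: dif_cst].
Qed.

Lemma cts_seg a b t : cts (seg a b) t.
Proof. by apply: dif_cts (dif_seg a b t); exact: cts_real. Qed.

Lemma Cn_seg O k a b : Cn O k (seg a b).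
Proof.
by apply: CnD; [|apply: CnM]; [exact: Cn_cst | exact: Cn_real | exact: Cn_cst].
Qed.

Lemma seg0 a b : seg a b 0 = a. Proof. by rewrite /seg mul0r addr0. Qed.
Lemma seg1 a b : seg a b 1 = b. Proof. by rewrite /seg mul1r addrC subrK. Qed.

Lemma hol_affine (a b x : C) : hol (fun x => a + b * x) x b.
Proof.
apply: (@dif_eq _ _ _ _ _ (0 + (0 * x + b * 1))); first by rewrite mul0r !add0r mulr1.
apply: difD; first exact: dif_cst.
by apply: difM; [exact: cts_id | exact: dif_cst | exact: dif_id].
Qed.

(** The disks are affine, of radius [cabs (b - a) / 2] around each point of the segment; [A] has to
    contain them all. *)
Lemma piece_segment A a b :
  (forall (t : R) (x : C), 0 <= t <= 1 -> cabs x < 1 -> A (seg a b t + (b - a) / 2 * x)) ->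
  piece A a b.
Proof.
move=> AP; exists (seg a b), setT; split => //.
- exact: openT.
- by move=> k; exact: Cn_seg.
- by rewrite seg0 seg1.
move=> t t01; exists (b - a); first exact: dif_seg.
exists (fun x => seg a b t + (b - a) / 2 * x); split.
- by move=> x x1; split; [exact: AP | exists ((b - a) / 2); exact: hol_affine].
- by rewrite mulr0 addr0.
by exists ((b - a) / 2); [exact: hol_affine | rewrite mulrC divfK // pnatr_eq0].
Qed.

Lemma cabs_seg a b t (e : R) : 0 <= t <= 1 -> cabs a <= e -> cabs b <= e ->
  cabs (seg a b t) <= e.
Proof.
move=> /andP[t0 t1] ae be.
have -> : seg a b t = (1 - t)%:C%C * a + t%:C%C * b.
  by rewrite /seg rmorphB rmorph1; ring.
apply: (le_trans (cabsD _ _)); rewrite !cabsM !cabs_real !ger0_norm ?subr_ge0 //.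
nra.
Qed.

Lemma openset_cts (T : topologicalType) (g : T -> C) (P : set C) :
  (forall t, cts g t) -> open P -> open (g @^-1` P).
Proof. by move=> cg oP; apply: open_comp => // t _; apply/ctsP. Qed.

Lemma open_disk (c : C) (e : R) : open [set x | cabs (x - c) < e].
Proof.
rewrite openE => x /= xe; rewrite /interior.
have := @cts_lt _ _ (fun x => x - c) x e; apply => //.
by apply: ctsB; [exact: cts_id | exact: cts_cst].
Qed.

Lemma open_neq0 : open [set x : C | x != 0].
Proof.
rewrite openE => x /= x0; rewrite /interior.
by have := @cts_neq0 _ _ id x (@cts_id _ x) x0.
Qed.

Section LiftPiece.
Variables (n d : {poly C}) (v : C) (r : R) (M : nat).
Hypothesis size_dn : (size d < size n)%N.
Hypothesis d_neq0 : d != 0.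
Hypothesis nd0 : forall x, d.[x] = 0 -> n.[x] != 0.
Hypothesis r0 : 0 < r.
Hypothesis orders : forall c, root (n - v *: d) c -> exists k m q,
  [/\ n - v *: d = ('X - c%:P) ^+ k * q, q.[c] != 0, (0 < k)%N, (1 < m)%N & M = (k * m)%N].
Hypothesis noncrit : forall y w : C, n.[y] = w * d.[y] -> w != v -> cabs (w - v) <= r ->
  (wronskian n d).[y] != 0.

Lemma M_gt0 : (0 < M)%N.
Proof.
have [c rc] : exists c, root (n - v *: d) c.
  by apply/closed_rootP; rewrite size_fiber // gtn_eqF //; exact: size_n_gt1 size_dn d_neq0.
have [k [m [q [_ _ k0 m1 ->]]]] := orders rc.
by rewrite muln_gt0 k0 (ltnW m1).
Qed.

Lemma lift_crit (h : C -> C) (x : C) : lift_on n d v r M 1 h -> x != 0 -> cabs x <= 1 ->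
  (wronskian n d).[h x] != 0.
Proof.
move=> [_ hP] x0 x1; apply: noncrit (hP x x1) _ _.
  exact: root_disk_neq.
exact: root_disk_le.
Qed.

Lemma hol_root_disk (x : C) : exists D, hol (root_disk v r M) x D.
Proof.
pose p : {poly C} := v%:P + r%:C%C *: 'X^M.
exists p^`().[x]; apply: dif_near (hol_horner p x).
by apply: nbhsW => t; rewrite /p hornerD hornerC hornerZ hornerXn.
Qed.

Lemma cabs_le_norm1 (x : C) : cabs x < 1 -> \forall t \near x, cabs t <= 1.
Proof.
move=> x1; have := cts_lt (@cts_id _ x) x1; move/nbhsS; apply.
by move=> t /ltW.
Qed.

(** Off 0 the image is not critical and [lift_dif] applies. At 0, comparing the order [k] of the
    fiber at [c] with [M = k * m] gives [cabs (h t - c) <= K * cabs t ^+ m], which is quadratic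
    because [1 < m]. *)
Lemma lift_hol (h : C -> C) (x : C) : lift_on n d v r M 1 h -> cabs x < 1 -> exists D, hol h x D.
Proof.
move=> Lh x1; have [ch hP] := Lh.
have [->|x0] := eqVneq x 0; last first.
  have [D hD] := hol_root_disk x.
  exists (D * d.[h x] ^+ 2 / (wronskian n d).[h x]); apply: lift_dif hD _ _.
  - exact: cts_id.
  - exact: ch.
  - by have := cabs_le_norm1 x1; move/nbhsS; apply; move=> t; exact: hP.
  - by apply: lift_crit => //; exact: ltW.
exists 0; pose c := h 0.
have h0 : n.[c] = v * d.[c].
  rewrite hP ?cabs0 // /root_disk expr0n (gtn_eqF M_gt0) /=.
  by rewrite mulr0 addr0.
have rc : root (n - v *: d) c.
  by apply/rootP; rewrite hornerD hornerN hornerZ h0 subrr.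
have [k [m [q [fE qc k0 m1 ME]]]] := orders rc.
have qc0 : 0 < cabs q.[c] by rewrite cabs_gt0.
have cq : cts (fun t => q.[h t]) 0 by apply: cts_horner; exact: ch.
have cd : cts (fun t => d.[h t]) 0 by apply: cts_horner; exact: ch.
pose B := cabs d.[c] + 1.
have B0 : 0 < B by have := cabs_ge0 d.[c]; rewrite /B; lra.
(* The bound [1 <= K] gives [K <= K ^+ k], so that a [k]-th root can be taken without real
   powers. *)
pose K := Num.max 1 (r * B / (cabs q.[c] / 2)).
have K1 : 1 <= K by rewrite le_max lexx.
have q20 : 0 < cabs q.[c] / 2 by lra.
apply: (@hol_of_quadratic _ _ K); near=> t.
have t1 : cabs t < 1 by near: t; apply: cts_lt; [exact: cts_id | rewrite cabs0].
have qt : cabs q.[c] / 2 <= cabs q.[h t].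
  have : cabs (q.[h t] - q.[c]) < cabs q.[c] / 2 by near: t; exact: cq.
  by have := cabs_sub q.[c] q.[h t] 0; rewrite !subr0 (cabsB q.[c]); lra.
have dt : cabs d.[h t] <= B.
  by apply: ltW; near: t; apply: cts_lt => //; rewrite /B; rewrite -/c; lra.
have uE : (h t - c) ^+ k * q.[h t] = r%:C%C * t ^+ M * d.[h t].
  have := congr1 (horner^~ (h t)) fE.
  rewrite hornerM horner_exp hornerXsubC hornerD hornerN hornerZ.
  by rewrite (hP t (ltW t1)) /root_disk => <-; ring.
have {}uE := congr1 (@cabs R) uE.
rewrite !cabsM !cabsX cabs_real gtr0_norm // in uE.
have uk : cabs (h t - c) ^+ k <= (K * cabs t ^+ m) ^+ k.
  rewrite exprMn -exprM mulnC -ME.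
  have l1 : cabs (h t - c) ^+ k * (cabs q.[c] / 2) <= r * B * cabs t ^+ M.
    apply: (@le_trans _ _ (cabs (h t - c) ^+ k * cabs q.[h t])).
      by rewrite ler_wpM2l // exprn_ge0 // cabs_ge0.
    rewrite uE -mulrA (mulrC (cabs t ^+ M)) mulrA.
    rewrite ler_wpM2r ?exprn_ge0 ?cabs_ge0 // ler_pM2l //.
  have l2 : cabs (h t - c) ^+ k <= r * B / (cabs q.[c] / 2) * cabs t ^+ M.
    by rewrite mulrAC ler_pdivlMr.
  apply: (le_trans l2); rewrite ler_wpM2r ?exprn_ge0 ?cabs_ge0 //.
  apply: (@le_trans _ _ K); first by rewrite /K le_max lexx orbT.
  rewrite -[leLHS]expr1; apply: ler_weXn2l => //.
rewrite subr0; apply: (@le_trans _ _ (K * cabs t ^+ m)).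
  rewrite -(@ler_pXn2r _ k) // nnegrE ?cabs_ge0 //.
  by rewrite mulr_ge0 ?exprn_ge0 ?cabs_ge0 // (le_trans _ K1).
rewrite ler_wpM2l ?(le_trans _ K1) //.
by apply: ler_wiXn2l; [exact: cabs_ge0 | exact: ltW | ].
Unshelve. all: by end_near. Qed.

(** Inside the half disk, the affine disk of radius [cabs (b - a) / 2 <= 1 / 2] around a point of
    the segment stays in the unit disk, and [h] carries it into [A]. Avoiding 0 keeps the curve off
    the possible critical point, so that [Cn_lift] makes it smooth. *)
Lemma piece_lift A h a b : lift_on n d v r M 1 h -> (forall x, cabs x < 1 -> A (h x)) ->
  cabs a <= 1 / 2 -> cabs b <= 1 / 2 -> (forall t, 0 <= t <= 1 -> seg a b t != 0) ->
  piece A (h a) (h b).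
Proof.
move=> Lh Ah a2 b2 ab0; have [ch hP] := Lh.
pose O : set R := seg a b @^-1` ([set x : C | x != 0] `&` [set x | cabs (x - 0) < 1]).
have oO : open O.
  apply: openset_cts; first exact: cts_seg.
  by apply: openI; [exact: open_neq0 | exact: open_disk].
have O01 t : 0 <= t <= 1 -> O t.
  move=> t01; split; first exact: ab0.
  by rewrite /= subr0; apply: (le_lt_trans (cabs_seg t01 a2 b2)); lra.
have chs t : cts (h \o seg a b) t.
  by apply: (@cts_comp _ _ _ (seg a b) h); [apply/ctsP; exact: cts_seg | exact: ch].
exists (h \o seg a b), O; split => //.
- move=> k; apply: (@Cn_lift _ _ n d _ (root_disk v r M \o seg a b)) => //.
  + by move=> t [_ /=]; rewrite subr0 => /ltW/hP.
  + by move=> t [t0 /=]; rewrite subr0 => /ltW t1; exact: lift_crit.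
  + apply: CnD; first exact: Cn_cst.
    by apply: CnM; [exact: Cn_cst | apply: CnX; exact: Cn_seg].
- by rewrite /= seg0 seg1.
move=> t t01; have st := cabs_seg t01 a2 b2.
have st1 : cabs (seg a b t) < 1 by apply: (le_lt_trans st); lra.
have [D hD] := lift_hol Lh st1.
exists ((b - a) * D).
  by apply: dif_comp; [exact: cts_real | exact: dif_seg | exact: hD].
have ab1 : cabs ((b - a) / 2) <= 1 / 2.
  rewrite cabsM cabsV -[2]/(2%:R) -(rmorph_nat (real_complex R)) cabs_real ger0_norm //.
  rewrite ler_pM2r ?invr_gt0 //.
  by have := cabs_sub b 0 a; rewrite subr0 sub0r cabsN; lra.
exists (fun x => h (seg a b t + (b - a) / 2 * x)); split.
- move=> x x1.
  have sx : cabs (seg a b t + (b - a) / 2 * x) < 1.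
    apply: (le_lt_trans (cabsD _ _)); rewrite cabsM.
    have := cabs_ge0 x; have := cabs_ge0 ((b - a) / 2); nra.
  split; first exact: Ah.
  have [E hE] := lift_hol Lh sx; exists ((b - a) / 2 * E).
  apply: (@dif_comp _ _ _ (fun x => seg a b t + (b - a) / 2 * x) h).
  + exact: cts_id.
  + exact: hol_affine.
  + exact: hE.
- by rewrite mulr0 addr0.
exists ((b - a) / 2 * D); last by rewrite mulrA (mulrC 2) divfK ?pnatr_eq0.
apply: (@dif_comp _ _ _ (fun x => seg a b t + (b - a) / 2 * x) h).
- exact: cts_id.
- exact: hol_affine.
- by rewrite mulr0 addr0.
Qed.

End LiftPiece.
End Smooth.

(** * Coordinates of the sphere and the Kobayashi distance *)

Section Coordinates.
Variable R : realType.
Local Notation C := R[i].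
Local Notation real := (fun r : R => r%:C%C : C).
Local Notation hol := (dif (@id C)).
Implicit Types (s b : P1 R) (O : set R) (y : R -> C) (x : C).

(* A global coordinate of the sphere minus [s]; for finite [s] it is [1 / (z - s)]. *)
Definition pcoord s x : P1 R :=
  if s is Some a then (if x == 0 then None else Some (a + x^-1)) else Some x.

Definition pcoord_inv s (z : P1 R) : C :=
  match s, z with
  | None, Some x => x
  | Some a, Some x => (x - a)^-1
  | _, None => 0
  end.

Lemma pcoordK s : cancel (pcoord s) (pcoord_inv s).
Proof.
case: s => [a|//] x /=; have [->|x0] //= := eqVneq x 0.
by rewrite addrAC subrr add0r invrK.
Qed.

Lemma pcoord_inj s : injective (pcoord s).
Proof. exact: can_inj (@pcoordK s). Qed.

Lemma pcoord_invK s z : z <> s -> pcoord s (pcoord_inv s z) = z.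
Proof.
case: s z => [a|] [x|] //= zs; last by rewrite eqxx.
have xa : x - a != 0 by rewrite subr_eq0; apply/eqP => xa; apply: zs; rewrite xa.
by rewrite invr_eq0 (negPf xa) invrK addrC subrK.
Qed.

Lemma pcoord_neq s x : pcoord s x <> s.
Proof.
case: s => [a|//] /=; have [_|x0] //= := eqVneq x 0.
move=> [] /eqP; rewrite -subr_eq0 addrAC subrr add0r invr_eq0.
exact/negP.
Qed.

Lemma compact_cabs_bounded (K : set C) : compact K -> exists2 B : R, 0 < B &
  forall x, K x -> cabs x <= B.
Proof.
move=> cK; have [||e e0 eP] := @compact_uniform _ K (fun x e => cabs x <= e^-1) cK.
- move=> x e e' xe /andP[e'0 ee']; apply: le_trans xe _.
  by rewrite lef_pV2 ?posrE //; exact: lt_le_trans ee'.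
- move=> x _; exists (cabs x + 1)^-1; first by rewrite invr_gt0 ltr_wpDl // cabs_ge0.
  rewrite invrK; have := @cts_lt _ _ id x (cabs x + 1) (@cts_id _ x).
  move=> /(_ _)/nbhsS; apply; last by move=> t /ltW.
  by rewrite ltrDl.
by exists e^-1; rewrite ?invr_gt0.
Qed.

Lemma pcoord_cts s x : {for x, continuous (pcoord s)}.
Proof.
case: s => [a|]; last exact: one_point_compactification_some_continuous.
have [->|x0] := eqVneq x 0; last first.
  have H : {for x, continuous (fun x : C => Some (a + x^-1) : P1 R)}.
    apply: (@continuous_comp _ _ _ (fun x : C => a + x^-1) (Some : C -> P1 R)).
      apply/ctsP; apply: ctsD; first exact: cts_cst.
      by apply: ctsV => //; exact: cts_id.
    exact: one_point_compactification_some_continuous.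
  move=> P /=; rewrite {1}/pcoord (negPf x0) => /H {}H.
  have n0 := cts_neq0 (@cts_id _ x) x0.
  have := nbhsI H n0; move/nbhsS; apply; move=> t [/= Pt t0].
  by rewrite /pcoord (negPf t0).
move=> P /=; rewrite {1}/pcoord eqxx => -[K [cK _] KP].
have [B B0 BP] := compact_cabs_bounded cK.
(* For [cabs y^-1 > B + cabs a + 1], the point [a + y^-1] leaves the ball of radius [B] containing
   [K]. *)
apply/nbhs_cabsP; exists (B + cabs a + 1)^-1.
  by rewrite invr_gt0; have := cabs_ge0 a; lra.
move=> y; rewrite subr0 /= => yB; apply: KP; rewrite /pcoord.
have [_|y0] := eqVneq y 0; first by right.
left; exists (a + y^-1) => // Ky; have := BP _ Ky.
have y0' : 0 < cabs y by rewrite cabs_gt0.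
have c0 : 0 < B + cabs a + 1 by have := cabs_ge0 a; lra.
have : B + cabs a + 1 < cabs y^-1.
  by rewrite cabsV -[ltLHS]invrK ltf_pV2 ?posrE ?invr_gt0.
have := cabs_sub y^-1 (a + y^-1) 0; rewrite !subr0.
by rewrite (_ : y^-1 - (a + y^-1) = - a) ?cabsN; [lra | ring].
Qed.

Lemma closed_disk (c : C) (e : R) : closed [set x | cabs (x - c) <= e].
Proof.
have -> : [set x | cabs (x - c) <= e] = ~` [set x | e < cabs (x - c)].
  by apply/seteqP; split=> x /=; rewrite leNgt => /negP.
apply: open_closedC; rewrite openE => x /= ex; rewrite /interior.
have e0 : 0 < cabs (x - c) - e by rewrite subr_gt0.
have := near_cabs x e0; move/nbhsS; apply; move=> y /= yx.
by have := cabs_sub x y c; rewrite (cabsB x y); lra.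
Qed.

Lemma pcoord_open s (U : set C) : open U -> open (pcoord s @` U).
Proof.
case: s => [a|]; last exact: one_point_compactification_open_some.
move=> oU; rewrite openE => _ [x Ux <-]; rewrite /interior /pcoord.
have [x0|x0] := eqVneq x 0.
  have /nbhs_cabsP[e e0 eP] : nbhs x U by exact: open_nbhs_nbhs.
  pose K : set C := [set z | cabs (z - a) <= e^-1].
  have clK : closed K by exact: closed_disk.
  exists K.
    split=> //; apply: (@compact_closed_bounded _ _ (e^-1 + cabs a)) => // z; rewrite /K /=.
    by have := cabs_sub z a 0; rewrite !subr0; lra.
  move=> z [[w nK <-]|->]; last by exists x; rewrite // x0 eqxx.
  have wa : e^-1 < cabs (w - a) by rewrite ltNge; apply/negP.
  have wa0 : w - a != 0.
    by rewrite -cabs_gt0; apply: lt_trans wa; rewrite invr_gt0.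
  exists (w - a)^-1; last by rewrite invr_eq0 (negPf wa0) invrK addrC subrK.
  apply: eP; rewrite x0 subr0 cabsV -[ltRHS]invrK ltf_pV2 // posrE ?invr_gt0 //.
  by rewrite cabs_gt0.
have xa : a + x^-1 - a != 0 by rewrite addrAC subrr add0r invr_eq0.
have cs : cts (fun z : C => z - a) (a + x^-1).
  by apply: ctsB; [exact: cts_id | exact: cts_cst].
have ci : cts (fun z : C => (z - a)^-1) (a + x^-1) by exact: ctsV.
have nU : nbhs ((a + x^-1 - a)^-1) U.
  by rewrite addrAC subrr add0r invrK; exact: open_nbhs_nbhs.
have n1 := near_comp (iffLR (ctsP _ _) ci) nU.
have := nbhsI n1 (cts_neq0 cs xa); move/nbhsS => H.
apply: H; move=> z /= [Uz za]; exists (z - a)^-1 => //.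
by rewrite invr_eq0 (negPf za) invrK addrC subrK.
Qed.

Lemma Cn_scale O k y (c : C) : Cn O k y -> Cn O k (fun t => c * y t).
Proof. by move=> Cy; apply: CnM => //; exact: Cn_cst. Qed.

(** The transition map from [pcoord s] to the preferred chart. Its only delicate case is [x = 0]
    with [s] finite, where it is [x' / (a * x' + 1)]. *)
Lemma chart_coord s x : exists V c, [/\ open V, V x,
  forall x', V x' -> chart (pcoord s x) (pcoord s x') = c x',
  exists D, hol c x D &
  forall O k y, (forall t, O t -> V (y t)) -> Cn O k y -> Cn O k (c \o y)].
Proof.
case: s => [a|]; last first.
  exists setT, id; split=> //; first exact: openT.
  by exists 1; exact: dif_id.
have [->|x0] := eqVneq x 0; last first.
  exists [set x' | x' != 0], (fun x' => a + x'^-1); split.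
  - exact: open_neq0.
  - exact: x0.
  - by move=> x' /negPf x'0; rewrite /pcoord (negPf x0) x'0.
  - exists (0 + (- 1 / x ^+ 2)); apply: difD; first exact: dif_cst.
    by apply: difV; [exact: cts_id | exact: x0 | exact: dif_id].
  - move=> O k y yV Cy; apply: CnD; first exact: Cn_cst.
    by apply: CnV.
pose V : set C := (fun x' => a * x' + 1) @^-1` [set x | x != 0].
have cV x' : cts (fun x' => a * x' + 1) x'.
  by apply: ctsD; [apply: ctsM|]; [exact: cts_cst | exact: cts_id | exact: cts_cst].
exists V, (fun x' => x' * (a * x' + 1)^-1); split.
- by apply: openset_cts => //; exact: open_neq0.
- by rewrite /V /= mulr0 add0r oner_neq0.
- move=> x' Vx'; rewrite /pcoord eqxx /chart.
  have [->|x'0] := eqVneq x' 0; first by rewrite mul0r.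
  have -> : a + x'^-1 = (a * x' + 1) / x' by field.
  by rewrite invfM invrK mulrC.
- eexists; apply: difM; [exact: cts_id | exact: dif_id |].
  apply: difV; [exact: cts_id | by rewrite mulr0 add0r oner_neq0 |].
  apply: difD; last exact: dif_cst.
  by apply: difM; [exact: cts_id | exact: dif_cst | exact: dif_id].
move=> O k y yV Cy; apply: CnM => //; apply: CnV; first by move=> t /yV.
by apply: CnD; [exact: Cn_scale | exact: Cn_cst].
Qed.

Lemma dif_chart_coord (T : topologicalType) (i f : T -> C) s a D c V :
  cts i a -> open V -> V (f a) ->
  (forall x', V x' -> chart (pcoord s (f a)) (pcoord s x') = c x') ->
  forall E, hol c (f a) E -> dif i f a D ->
  dif i (chart (pcoord s (f a)) \o (pcoord s \o f)) a (D * E).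
Proof.
move=> ci oV Vfa VE E cE fD; have cf := dif_cts ci fD.
apply: dif_near (dif_comp ci fD cE).
have := near_comp (iffLR (ctsP _ _) cf) (open_nbhs_nbhs (conj oV Vfa)).
by move/nbhsS; apply; move=> t Vt /=; rewrite VE.
Qed.

Lemma continuous_coord (T : topologicalType) (f : T -> C) s a :
  cts f a -> {for a, continuous (pcoord s \o f)}.
Proof.
by move=> /ctsP cf; apply: (continuous_comp cf); exact: pcoord_cts.
Qed.

(** The disk is only known to lie in [A]; its radii join each of its points to the center, which
    places it in the component [U]. The factor [k] is a change of speed, and [E] turns coordinates
    into chart components. *)
Lemma metric_le (U : set (P1 R)) s (A : set C) z w (k : R) E :
  (forall x, A x -> connected_component (pcoord s @` A) (pcoord s z) (pcoord s x) ->
    U (pcoord s x)) ->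
  0 < k -> disk_through A z w ->
  hol (chart (pcoord s z) \o pcoord s) z E ->
  (kobayashi_metric U (pcoord s z) (k%:C%C * (w * E))%R <= (2 * k)%:E)%E.
Proof.
move=> AU k0 [phi [phiA phi0 [D phiD wE]]] zE.
have [V [c [oV Vz VE [E' cE'] _]]] := chart_coord s z.
have zE' : hol (chart (pcoord s z) \o pcoord s) z E'.
  apply: dif_near cE'; have := open_nbhs_nbhs (conj oV Vz).
  by move/nbhsS; apply; move=> x /VE.
rewrite (hol_uniq zE zE') {E zE zE'}.
apply: ereal_inf_lbound; exists (2 * k) => //; split; first by rewrite mulr_gt0.
exists (pcoord s \o phi); split; last 1 first.
- rewrite /hderive /= phi0.
  have := dif_chart_coord (s := s) (c := c) (V := V) (@cts_id _ 0) oV.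
  move=> /(_ phi D); rewrite phi0 => /(_ Vz VE _ cE' phiD)/hol_derive[_ ->].
  have -> : (2 * k)%:C%C = 2 * k%:C%C :> C by rewrite rmorphM rmorph_nat.
  by rewrite -wE; ring.
- move=> x x1'; have x1 : cabs x < 1.
    by move: x1'; rewrite /unit_disk /= cabsE -[1]/(1%:C%C) ltcR.
  have [Ax [D' hD']] := phiA x x1.
  have cphi : cts phi x by apply: dif_cts hD'; exact: cts_id.
  split.
    split; first exact: continuous_coord.
    have [V' [c' [oV' Vz' VE' [F cF] _]]] := chart_coord s (phi x).
    have := dif_chart_coord (@cts_id _ x) oV' Vz' VE' cF hD'.
    by move/hol_derive => [].
  apply: AU => //.
  pose g (t : R) := pcoord s (phi (t%:C%C * x)).
  have t1 t : t \in `[0, 1]%R -> cabs (t%:C%C * x) < 1.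
    rewrite in_itv /= => /andP[t0 t1]; rewrite cabsM cabs_real ger0_norm //.
    by have := cabs_ge0 x; nra.
  apply: (@connected_component_max _ _ (g @` `[0, 1]%classic)).
  - by exists 0; rewrite /= ?in_itv /= ?lexx ?ler01 // /g mul0r phi0.
  - move=> _ [t t01 <-]; exists (phi (t%:C%C * x)) => //.
    by have [] := phiA _ (t1 t t01).
  - apply: connected_continuous_connected; first exact: segment_connected.
    apply: continuous_in_subspaceT => t; rewrite inE /= => t01.
    apply: continuous_coord.
    apply: (@cts_comp _ _ _ (fun t : R => t%:C%C * x) phi).
      by apply/ctsP; apply: ctsM; [exact: cts_real | exact: cts_cst].
    have [_ [D2 hD2]] := phiA _ (t1 t t01).
    by apply: dif_cts hD2; exact: cts_id.
  - by exists 1; rewrite /= ?in_itv /= ?lexx ?ler01 // /g mul1r.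
- by rewrite /= phi0.
Qed.

Lemma dif_real_uniq y t D E : dif real y t D -> dif real y t E -> D = E.
Proof.
move=> /dif_real_derive[_ r1 _ i1] /dif_real_derive[_ r2 _ i2].
by case: D r1 i1 => a b; case: E r2 i2 => a' b' /= -> -> /= -> ->.
Qed.

(** Transfers smoothness from the witnesses of [Cn] to the iterated derivatives [derive1n], real and
    imaginary parts separately. *)
Lemma Cn_derivable O y (u : R -> R) (f : R[i] -> R) :
  (f = @complex.Re R \/ f = @complex.Im R) -> open O ->
  (forall k, Cn O k y) -> (forall t, O t -> u t = f (y t)) ->
  forall n t, O t -> derivable (derive1n n u) t 1.
Proof.
move=> fE oO Cy uE n; elim: n u y Cy uE => [|n IH] u y Cy uE t Ot.
  have [y' yD _] := Cy 1%N.
  have near_u : \forall s \near t, f (y s) = u s.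
    by have := open_nbhs_nbhs (conj oO Ot); move/nbhsS; apply; move=> s /uE.
  have fd : derivable (f \o y) t 1.
    by have [d1 _ d2 _] := dif_real_derive (yD t Ot); case: fE => ->.
  exact: near_eq_derivable near_u fd.
rewrite derive1Sn.
have [y' yD _] := Cy 1%N.
have Cy' k : Cn O k y'.
  have [y'' y''D Cy''] := Cy k.+1.
  apply: Cn_ext Cy'' => // s Os.
  exact: dif_real_uniq (y''D s Os) (yD s Os).
apply: (IH _ y') => // s Os.
have near_u : \forall r \near s, f (y r) = u r.
  by have := open_nbhs_nbhs (conj oO Os); move/nbhsS; apply; move=> r /uE.
rewrite derive1E -(near_eq_derive _ near_u) -derive1E.
by have [_ d1 _ d2] := dif_real_derive (yD s Os); case: fE => ->.
Qed.

End Coordinates.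

(** * Chains of pieces and their Kobayashi length *)

Section Distance.
Import HBNNSimple.
Variable R : realType.
Local Notation C := R[i].
Local Notation real := (fun r : R => r%:C%C : C).
Local Notation hol := (dif (@id C)).
Local Notation mu := (@lebesgue_measure R).
Implicit Types (s : P1 R) (O : set R) (y : R -> C) (A : set C).

(* No measurability of F: the integral of a nonnegative function is a supremum
   over the simple functions below it. *)
Lemma integral_le_cst (F : R -> \bar R) (Z : set R) (k : R) :
  0 <= k -> countable Z -> (forall t, 0 <= F t)%E ->
  (forall t, 0 <= t <= 1 -> ~ Z t -> (F t <= k%:E)%E) ->
  (\int[mu]_(t in `[0%R, 1%R]%classic) F t <= k%:E)%E.
Proof.
move=> k0 cZ F0 Fk; rewrite ge0_integralE //.
apply: ge_ereal_sup => _ [h /= hF <-].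
rewrite -integralT_nnsfun.
pose D : set R := `[0%R, 1%R]%classic.
have mD : measurable D by exact: measurable_itv.
apply: (@le_trans _ _ (\int[mu]_t ((cst k%:E) \_ D) t)%E); last first.
  have muD : mu D = 1%E.
    by rewrite /D lebesgue_measure_itv /= lte_fin ltr01 oppr0 adde0.
  have -> : (\int[mu]_t ((cst k%:E) \_ D) t = k%:E * mu D)%E.
    by rewrite -integral_mkcond integral_cst.
  by rewrite muD mule1.
apply: ae_ge0_le_integral => //.
- by move=> t _; rewrite lee_fin; exact: fun_ge0.
- by apply/measurable_EFinP; exact: measurable_funP.
- by move=> t _; rewrite patchE; case: ifP => // _; rewrite lee_fin.
- by apply/measurable_restrict => //; exact: measurable_cst.
exists Z; split.
- apply: countable_measurable => // t; exact: measurable_set1.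
- exact: countable_lebesgue_measure0.
move=> t /= H; apply: contrapT => Zt; apply: H => _.
have := hF t; rewrite !patchE; case: ifPn => [|_]; last by [].
rewrite inE /= in_itv /= => t01 hFt; apply: (le_trans hFt).
exact: Fk.
Qed.

Definition good_curve A y O : Prop := [/\ open O, forall t, 0 <= t <= 1 -> O t,
  forall k, Cn O k y &
  forall t, 0 <= t <= 1 -> exists2 D, dif real y t D & disk_through A (y t) D].

Fixpoint reach A (m : nat) (z z' : C) : Prop :=
  if m is m'.+1 then exists2 z1, reach A m' z z1 & piece A z1 z' else z = z'.

Lemma reach_add A k m z z1 z' : reach A k z z1 -> reach A m z1 z' -> reach A (k + m) z z'.
Proof.
elim: m z' => [|m IH] z' zz1 /=; first by rewrite addn0 => <-.
by move=> [z2 z12 z2z']; rewrite addnS; exists z2 => //; exact: IH.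
Qed.

Lemma piece_refl A z : A z -> piece A z z.
Proof.
move=> Az; apply: piece_segment => t x _ _.
by rewrite /seg subrr mulr0 mul0r mul0r !addr0.
Qed.

Lemma reach_refl A m z : A z -> reach A m z z.
Proof. by move=> Az; elim: m => [//|m IH] /=; exists z => //; exact: piece_refl. Qed.

Lemma reach_le A k m z z' : A z -> (k <= m)%N -> reach A k z z' -> reach A m z z'.
Proof.
by move=> Az km zz'; rewrite -(subnK km); apply: reach_add zz'; exact: reach_refl.
Qed.

(** Each piece keeps its unit of time, so the curve lives on [[0, m]]; it is rescaled to [[0, 1]] by
    [aff] afterwards. *)
Lemma reach_curve A m z z' : reach A m z z' -> exists g : R -> C,
  [/\ g 0 = z, g m%:R = z' & forall i, (i < m)%N -> exists y O, good_curve A y O /\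
    forall t, i%:R <= t <= i.+1%:R -> g t = y (t - i%:R)].
Proof.
elim: m z' => [|m IH] z' /=; first by move=> ->; exists (fun=> z').
move=> [z1 /IH[g [g0 gm gi]] [y [ O [oO O01 Cy [y0 y1] yD]]]].
exists (fun t => if t <= m%:R then g t else y (t - m%:R)); split.
- by rewrite ler0n.
- by rewrite ler_nat ltnn -natrB // subSn // subnn.
move=> i; rewrite ltnS leq_eqVlt => /orP[/eqP ->|im].
  exists y, O; split; first by split.
  move=> t /andP[mt tm]; case: ifP => // tm'.
  by rewrite (@le_anti _ _ t m%:R) ?tm' // subrr gm y0.
have [y' [ O' [gy' gE]]] := gi i im; exists y', O'; split => // t /andP[it ti].
by rewrite (le_trans ti) ?ler_nat // gE // it ti.
Qed.

Definition aff (m : nat) (i : nat) (t : R) : R := m%:R * t - i%:R.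

Lemma aff_continuous m i : continuous (aff m i).
Proof.
move=> t; apply: (@cvgB _ R^o); last exact: cvg_cst.
by apply: (@cvgM R); [exact: cvg_cst | exact: cvg_id].
Qed.

Lemma dif_aff m i y t D : dif real y (aff m i t) D ->
  dif real (y \o aff m i) t (m%:R%:C%C * D).
Proof.
move=> [g [cg gD yE]]; exists (fun t => m%:R%:C%C * g (aff m i t)); split.
- apply: ctsM; first exact: cts_cst.
  by apply: (@cts_comp _ _ _ (aff m i) g) => //; exact: aff_continuous.
- by rewrite gD.
have := near_comp (@aff_continuous m i t) yE; move/nbhsS; apply; move=> u /= ->.
rewrite mulrA; congr (_ * _); rewrite -!rmorphB -rmorphM; congr (_%:C%C).
by rewrite /aff; ring.
Qed.

Lemma Cn_aff m i O k y : Cn O k y -> Cn (aff m i @^-1` O) k (y \o aff m i).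
Proof.
elim: k y => [|k IH] y.
  move=> Cy t Ot; apply: (@cts_comp _ _ _ (aff m i) y); last exact: Cy.
  exact: aff_continuous.
move=> [y' yD Cy']; exists (fun t => m%:R%:C%C * (y' \o aff m i) t).
  by move=> t Ot; apply: dif_aff; exact: yD.
by apply: Cn_scale; exact: IH.
Qed.

Lemma Cn_sub O O' k y : O' `<=` O -> Cn O k y -> Cn O' k y.
Proof.
move=> sO; elim: k y => [|k IH] y; first by move=> Cy t /sO; exact: Cy.
by move=> [y' yD Cy']; exists y'; [move=> t /sO; exact: yD | exact: IH].
Qed.

Lemma smooth_coord s O y t : open O -> O t -> (forall k, Cn O k y) ->
  smooth_at (pcoord s \o y) t.
Proof.
move=> oO Ot Cy; have cy : cts y t by exact: (Cy 0%N).
split; first exact: continuous_coord.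
have [V [c [oV Vz VE _ Vc]]] := chart_coord s (y t).
pose W : set R := O `&` y @^-1` V.
have oW : open W.
  rewrite openE => u [Ou Vu]; rewrite /interior.
  have n1 := open_nbhs_nbhs (conj oO Ou).
  have cu : cts y u by exact: (Cy 0%N).
  have n2 := near_comp (iffLR (ctsP _ _) cu) (open_nbhs_nbhs (conj oV Vu)).
  by have := nbhsI n1 n2; move/nbhsS; apply.
have CW k : Cn W k (c \o y).
  apply: Vc; first by move=> u [].
  by apply: Cn_sub (Cy k); move=> u [].
have := open_nbhs_nbhs (conj oW (conj Ot Vz)).
move/nbhsS; apply; move=> u Wu n; split.
  apply: (@Cn_derivable _ W (c \o y) _ (@complex.Re R)) => //; first by left.
  by move=> r [_ Vr] /=; rewrite VE.
apply: (@Cn_derivable _ W (c \o y) _ (@complex.Im R)) => //; first by right.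
by move=> r [_ Vr] /=; rewrite VE.
Qed.

Section Length.
Variables (Af : set (P1 R)) (s : P1 R) (z : C) (m : nat) (g : R -> C).
Let A : set C := pcoord s @^-1` Af.
Let U := connected_component Af (pcoord s z).
Hypothesis m0 : (0 < m)%N.
Hypothesis g0 : g 0 = z.
Hypothesis gi : forall i, (i < m)%N -> exists y O, good_curve A y O /\
    forall t, i%:R <= t <= i.+1%:R -> g t = y (t - i%:R).

Let G (t : R) : P1 R := pcoord s (g (m%:R * t)).

Let mR : 0 < m%:R :> R. Proof. by rewrite ltr0n. Qed.

Lemma locate (t : R) : 0 <= t <= 1 -> exists2 i : nat, (i < m)%N &
  i%:R <= m%:R * t <= i.+1%:R.
Proof.
move=> /andP[t0 t1].
have H k : m%:R * t <= k%:R -> (0 < k)%N ->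
    exists2 i : nat, (i < k)%N & i%:R <= m%:R * t <= i.+1%:R.
  elim: k => [//|k IH] tk _; have [kt|tk'] := leP k%:R (m%:R * t).
    by exists k => //; rewrite kt.
  case: k IH tk tk' => [|k] IH tk tk'.
    by move: tk'; rewrite ltNge mulr_ge0 // ltW.
  have [i ik it] := IH (ltW tk') isT; exists i => //; exact: ltnW.
by apply: H => //; rewrite ger_pMr.
Qed.

Lemma piece_G i t : (i < m)%N -> i%:R <= m%:R * t <= i.+1%:R ->
  0 <= aff m i t <= 1.
Proof.
by move=> im /andP[a b]; rewrite /aff subr_ge0 a lerBlDr -[1]/(1%:R) -natrD add1n.
Qed.

Lemma curve_in t : 0 <= t <= 1 -> Af (G t).
Proof.
move=> t01; have [i im it] := locate t01.
have [y [ O [[oO O01 Cy yD] gE]]] := gi im.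
rewrite /G gE //; have [D _ [phi [phiA phi0 _]]] := yD _ (piece_G im it).
by have [] := phiA 0; rewrite ?cabs0 // phi0.
Qed.

Lemma curve_continuous : {within `[0, 1]%classic, continuous G}.
Proof.
have H k : (k < m)%N -> {within `[k%:R / m%:R, k.+1%:R / m%:R]%classic, continuous G}.
  move=> km; have [y [ O [[oO O01 Cy yD] gE]]] := gi km.
  apply: (@subspace_eq_continuous _ _ _ (pcoord s \o (y \o aff m k))).
    move=> t; rewrite inE /= in_itv /= ler_pdivrMr // ler_pdivlMr // => tk.
    change (pcoord s (y (aff m k t)) = pcoord s (g (m%:R * t))).
    by rewrite gE // mulrC.
  apply: continuous_in_subspaceT => t.
  rewrite inE /= in_itv /= ler_pdivrMr // ler_pdivlMr // mulrC => tk.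
  apply: continuous_coord; apply: (@cts_comp _ _ _ (aff m k) y); first exact: aff_continuous.
  by apply: (Cy 0%N); apply: O01; exact: piece_G.
have K k : (k < m)%N -> {within `[0, k.+1%:R / m%:R]%classic, continuous G}.
  elim: k => [|k IH] km; first by have := H 0%N km; rewrite mul0r.
  have -> : `[0, k.+2%:R / m%:R]%classic =
      `[0, k.+1%:R / m%:R]%classic `|` `[k.+1%:R / m%:R, k.+2%:R / m%:R]%classic :> set R.
    have l1 : 0 <= k.+1%:R / m%:R :> R by rewrite divr_ge0.
    have l2 : k.+1%:R / m%:R <= k.+2%:R / m%:R :> R by rewrite ler_pM2r ?invr_gt0 // ler_nat.
    apply/seteqP; split=> t /=; rewrite !in_itv /=.
      by move=> /andP[-> ->] /=; rewrite andbT; apply/orP; exact: le_total.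
    move=> [/andP[-> tk]|/andP[kt ->]]; first exact: le_trans l2.
    by rewrite andbT; exact: le_trans kt.
  apply: withinU_continuous; [exact: itv_closed | exact: itv_closed | | exact: H].
  by apply: IH; exact: ltnW.
have := K m.-1; rewrite prednK // divff ?gt_eqF //; by apply.
Qed.

Lemma curve_path t : 0 <= t <= 1 -> U (G t).
Proof.
move=> t01; apply: (@connected_component_max _ _ (G @` `[0, 1]%classic)).
- by exists 0; rewrite /= ?in_itv /= ?lexx ?ler01 // /G mulr0 g0.
- by move=> _ [u u01 <-]; apply: curve_in; rewrite /= in_itv in u01.
- apply: connected_continuous_connected; first exact: segment_connected.
  exact: curve_continuous.
- by exists t; rewrite /= ?in_itv.
Qed.

Lemma curve_smooth : piecewise_smooth G.
Proof.
pose q (i : nat) : R := i%:R / m%:R.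
have qlt i : q i < q i.+1 by rewrite /q ltr_pM2r ?invr_gt0 // ltr_nat.
exists [seq q i | i <- iota 1 m]; split.
  split.
    have H k a : path <%O (q a) [seq q i | i <- iota a.+1 k].
      by elim: k a => [//|k IH] a /=; rewrite qlt IH.
    by have := H m 0%N; rewrite /q mul0r.
  rewrite -nth_last size_map size_iota (nth_map 0%N) ?size_iota ?ltn_predL //.
  rewrite nth_iota ?ltn_predL // add1n prednK // /q divff ?eqxx //.
  by rewrite gt_eqF.
move=> i; rewrite size_map size_iota => im.
have -> : nth 0 (0 :: [seq q i | i <- iota 1 m]) i = q i.
  case: i im => [|i] im /=; first by rewrite /q mul0r.
  by rewrite (nth_map 0%N) ?size_iota ?(ltnW im) // nth_iota ?(ltnW im) // add1n.
rewrite (nth_map 0%N) ?size_iota // nth_iota // add1n.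
have [y [ O [[oO O01 Cy yD] gE]]] := gi im.
exists (pcoord s \o (y \o aff m i)) => t.
rewrite in_itv /= /q ler_pdivrMr // ler_pdivlMr // mulrC => ti; split.
  by rewrite /G gE.
apply: (@smooth_coord s (aff m i @^-1` O)).
- by apply: open_comp => // u _; exact: aff_continuous.
- by apply: O01; exact: piece_G.
- by move=> k; exact: Cn_aff.
Qed.

Lemma velocityE (h : R -> P1 R) t D : dif real (chart (h t) \o h) t D -> velocity h t = D.
Proof.
move=> /dif_real_derive[_ r _ i]; rewrite /velocity r i.
by case: (D).
Qed.

Lemma metric_ge0 (V : set (P1 R)) a xi : (0 <= kobayashi_metric V a xi)%E.
Proof. by apply: le_ereal_inf_tmp => _ [l [l0 _] <-]; rewrite lee_fin ltW. Qed.

(** Rescaling multiplies the velocity by [m], so the metric is at most [2 * m] at all times other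
    than the breakpoints. *)
Lemma curve_length : (kobayashi_length U G <= (2 * m%:R)%:E)%E.
Proof.
(* All multiples of [1 / m], a countable set containing the breakpoints. *)
apply: (@integral_le_cst _ ((fun i : nat => i%:R / m%:R) @` setT)).
- by rewrite mulr_ge0 ?ltW.
- by apply: card_image_le.
- by move=> t; exact: metric_ge0.
move=> t t01 Zt; have [i im it] := locate t01.
have [y [ O [[oO O01 Cy yD] gE]]] := gi im.
have {}it : i%:R < m%:R * t < i.+1%:R.
  move: it => /andP[]; rewrite !le_eqVlt => /orP[/eqP e|-> /orP[/eqP e|->//]].
    by exfalso; apply: Zt; exists i => //; rewrite e mulrC mulKf ?gt_eqF.
  by exfalso; apply: Zt; exists i.+1 => //; rewrite -e mulrC mulKf ?gt_eqF.
have it' : i%:R <= m%:R * t <= i.+1%:R by case/andP: it => a b; rewrite !ltW.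
have Gt : G t = pcoord s (y (aff m i t)) by rewrite /G gE.
have nG : \forall u \near t, (pcoord s \o (y \o aff m i)) u = G u.
  have ca : continuous (fun u : R => m%:R * u).
    by move=> u; apply: (@cvgM R); [exact: cvg_cst | exact: cvg_id].
  have ni : nbhs (m%:R * t) [set u | i%:R < u < i.+1%:R].
    exact: near_in_itvoo.
  have := near_comp (ca t) ni; move/nbhsS; apply; move=> u /= /andP[a b].
  by rewrite /G gE // !ltW.
have [D yt dk] := yD _ (piece_G im it').
have [V [c [oV Vz VE [E cE] _]]] := chart_coord s (y (aff m i t)).
have chE : hol (chart (pcoord s (y (aff m i t))) \o pcoord s) (y (aff m i t)) E.
  apply: dif_near cE; have := open_nbhs_nbhs (conj oV Vz).
  by move/nbhsS; apply; move=> x /VE.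
have vE : velocity G t = m%:R%:C%C * (D * E).
  rewrite mulrA; apply: velocityE.
  apply: (@dif_near _ _ _ (chart (pcoord s (y (aff m i t))) \o (pcoord s \o (y \o aff m i)))).
    by move/nbhsS: nG; apply; move=> u /= ->; rewrite Gt.
  by apply: (dif_chart_coord (@cts_real _ t) oV Vz VE cE); exact: dif_aff.
rewrite vE Gt; apply: (metric_le (A := A)) => //.
move=> x Ax xc; have Ut := curve_path t01; rewrite Gt in Ut.
apply: connected_component_trans Ut _.
case: xc => B [Bz BA Bc] Bx; exists B => //; split => //.
by move=> w /BA[u Au <-].
Qed.

Lemma curve_dist : U (pcoord s (g m%:R)) /\
  (kobayashi_dist U (pcoord s z) (pcoord s (g m%:R)) <= (2 * m%:R)%:E)%E.
Proof.
have G1 : G 1 = pcoord s (g m%:R) by rewrite /G mulr1.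
have G0 : G 0 = pcoord s z by rewrite /G mulr0 g0.
split; first by rewrite -G1; apply: curve_path; rewrite lexx ler01.
apply: (le_trans _ curve_length); apply: ereal_inf_lbound; exists G => //; split => //.
  split; first exact: curve_continuous.
  by move=> t; rewrite in_itv /=; exact: curve_path.
exact: curve_smooth.
Qed.

End Length.

Lemma reach_dist (Af : set (P1 R)) s z z' m : (0 < m)%N ->
  reach (pcoord s @^-1` Af) m z z' ->
  connected_component Af (pcoord s z) (pcoord s z') /\
  (kobayashi_dist (connected_component Af (pcoord s z)) (pcoord s z) (pcoord s z')
     <= (2 * m%:R)%:E)%E.
Proof.
move=> m0 /reach_curve[g [g0 <- gi]]; exact: curve_dist.
Qed.

End Distance.

Lemma continuous_cst_at (T S : topologicalType) (k : S) (a : T) :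
  {for a, continuous (fun=> k)}.
Proof. exact: cvg_cst. Qed.

(** * Iterates and local degrees *)

Section Homogenize.
Variable R : realType.
Local Notation C := R[i].
Local Notation hol := (dif (@id C)).
Implicit Types (a b p q : {poly C}) (x y : C) (G H : C -> C).

Definition homog (D : nat) p a b : {poly C} :=
  \sum_(i < D.+1) p`_i *: (a ^+ i * b ^+ (D - i)).

Lemma homogE D p a b x : (size p <= D.+1)%N -> b.[x] != 0 ->
  (homog D p a b).[x] = b.[x] ^+ D * p.[a.[x] / b.[x]].
Proof.
move=> sp b0; rewrite (horner_coef_wide _ sp) horner_sum mulr_sumr.
apply: eq_bigr => i _; rewrite hornerZ hornerM !horner_exp expr_div_n.
have iD : (i <= D)%N by rewrite -ltnS.
have -> : b.[x] ^+ D = b.[x] ^+ (D - i) * b.[x] ^+ i by rewrite -exprD subnK.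
have bi : b.[x] ^+ i != 0 by rewrite expf_neq0.
by field.
Qed.

Lemma homog_pole D p a b x : b.[x] = 0 -> (homog D p a b).[x] = p`_D * a.[x] ^+ D.
Proof.
move=> b0; rewrite horner_sum big_ord_recr /= hornerZ hornerM !horner_exp subnn expr0 mulr1.
rewrite big1 ?add0r // => i _; rewrite hornerZ hornerM !horner_exp b0.
by rewrite expr0n subn_eq0 leqNgt ltn_ord /= !mulr0.
Qed.

Lemma size_homog_lt D p a b : (0 < D)%N -> (size b < size a)%N -> b != 0 ->
  (size (\sum_(i < D) p`_i *: (a ^+ i * b ^+ (D - i)))%R < size (a ^+ D)%R)%N.
Proof.
move=> D0 ba b0.
have a0 : a != 0 by rewrite -size_poly_gt0 (leq_ltn_trans _ ba).
have aD : (0 < size (a ^+ D)%R)%N by rewrite size_poly_gt0 expf_neq0.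
rewrite -(prednK aD) ltnS; apply: (leq_trans (size_sum _ _ _)).
apply/bigmax_leqP => i _; apply: (leq_trans (size_scale_leq _ _)).
have ai : a ^+ i != 0 by rewrite expf_neq0.
have bi : b ^+ (D - i) != 0 by rewrite expf_neq0.
rewrite size_mul //.
have s1 := size_exp a i; have s2 := size_exp b (D - i); have s3 := size_exp a D.
rewrite s3.
have p1 : (0 < size (a ^+ i)%R)%N by rewrite size_poly_gt0.
have p2 : (0 < size (b ^+ (D - i))%R)%N by rewrite size_poly_gt0.
have -> : (size (a ^+ i)%R + size (b ^+ (D - i))%R).-1 =
    ((size a).-1 * i + (size b).-1 * (D - i)).+1.
  by rewrite -s1 -s2 -{1}(prednK p1) -{1}(prednK p2) addSn addnS.
have iD : (i < D)%N by [].
have lt : ((size b).-1 < (size a).-1)%N.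
  by rewrite -ltnS !prednK // ?size_poly_gt0 // (leq_ltn_trans _ ba).
have -> : ((size a).-1 * D = (size a).-1 * i + (size a).-1 * (D - i))%N.
  by rewrite -mulnDr subnKC // ltnW.
by rewrite ltn_add2l ltn_pmul2r // subn_gt0.
Qed.

(** The local degree of [G] at [y], defined by a factorization so that no power series is needed. *)
Definition ord_at G y (k : nat) : Prop := exists g : C -> C,
  [/\ cts g y, g y != 0 & \forall x \near y, G x - G y = (x - y) ^+ k * g x].

Lemma ord_near G H y k : (\forall x \near y, G x = H x) -> ord_at G y k -> ord_at H y k.
Proof.
move=> GH [g [cg gy GE]]; exists g; split=> //.
have GHy := nbhs_singleton GH; have := nbhsI GH GE; move/nbhsS; apply.
by move=> x [<-]; rewrite GHy.
Qed.

Lemma ord_comp G H y k l : cts G y -> ord_at G y k -> ord_at H (G y) l ->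
  ord_at (H \o G) y (k * l).
Proof.
move=> cG [g [cg gy GE]] [h [ch hy HE]].
exists (fun x => g x ^+ l * h (G x)); split.
- apply: ctsM; first exact: ctsX.
  by apply: (@cts_comp _ _ _ G h) => //; exact/ctsP.
- by rewrite mulf_neq0 ?expf_neq0.
have := nbhsI GE (near_comp (iffLR (ctsP _ _) cG) HE); move/nbhsS; apply.
by move=> x [e1 /= ->]; rewrite e1 exprMn -exprM mulrA.
Qed.

(** If [k < l], cancelling [(x - y) ^+ k] between the two factorizations forces [g y = 0]. *)
Lemma ord_uniq G y k l : ord_at G y k -> ord_at G y l -> k = l.
Proof.
wlog kl : k l / (k < l)%N.
  move=> H Gk Gl; have [kl|lk|//] := ltngtP k l; first exact: H.
  by apply/esym; exact: H.
move=> [g [cg gy GE]] [h [ch hy HE]]; exfalso; move/eqP: gy; apply.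
pose w x := g x - (x - y) ^+ (l - k) * h x.
have wy : w y = g y by rewrite /w subrr expr0n subn_eq0 leqNgt kl mul0r subr0.
rewrite -wy; apply: (@cts_dnbhs _ w).
  move=> e e0; have := nbhsI GE HE; move/nbhsS; apply; move=> x [e1 e2] xy.
  have xk : (x - y) ^+ k != 0 by rewrite expf_neq0 // subr_eq0.
  suff -> : w x = 0 by rewrite subrr cabs0.
  apply: (mulfI xk); rewrite mulr0 /w mulrBr -e1 mulrA -exprD subnKC ?(ltnW kl) //.
  by rewrite -e2 subrr.
apply: ctsB => //; apply: ctsM => //; apply: ctsX.
by apply: ctsB; [exact: cts_id | exact: cts_cst].
Qed.

Lemma cts_ratio a b x : b.[x] != 0 -> cts (fun x => a.[x] / b.[x]) x.
Proof.
move=> b0; apply: ctsM; first by apply: cts_horner; exact: cts_id.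
by apply: ctsV => //; apply: cts_horner; exact: cts_id.
Qed.

Lemma hol_ratio a b x : b.[x] != 0 ->
  hol (fun x => a.[x] / b.[x]) x ((wronskian a b).[x] / b.[x] ^+ 2).
Proof.
move=> b0; apply: dif_eq (difM _ (hol_horner a x) (difV _ b0 (hol_horner b x))).
- by rewrite /wronskian hornerD hornerN !hornerM; field.
- exact: cts_id.
- exact: cts_id.
Qed.

Lemma ord_ratio a b x k q (v : C) : b.[x] != 0 -> a.[x] / b.[x] = v ->
  a - v *: b = ('X - x%:P) ^+ k * q -> q.[x] != 0 ->
  ord_at (fun x => a.[x] / b.[x]) x k.
Proof.
move=> b0 xv E q0; exists (fun y => q.[y] / b.[y]); split.
- exact: cts_ratio.
- by rewrite mulf_neq0 ?invr_neq0.
have := @cts_neq0 _ _ (horner b) x (cts_horner b (@cts_id _ x)) b0.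
move/nbhsS; apply; move=> y by0; rewrite xv.
have := congr1 (horner^~ y) E.
rewrite hornerM horner_exp hornerXsubC hornerD hornerN hornerZ mulrA => <-.
by field.
Qed.

Lemma ratio_order a b x : (size b < size a)%N -> b.[x] != 0 ->
  exists k q, [/\ a - (a.[x] / b.[x]) *: b = ('X - x%:P) ^+ k * q, q.[x] != 0,
    (0 < k < size a)%N & (wronskian a b).[x] != 0 -> k = 1%N].
Proof.
move=> ba b0; set v := a.[x] / b.[x]; set Q := a - v *: b.
have sQ : size Q = size a by exact: size_fiber.
have Q0 : Q != 0 by rewrite -size_poly_gt0 sQ (leq_ltn_trans _ ba).
have [k [q qx QE]] := multiplicity_XsubC Q x.
rewrite Q0 /= in qx; rewrite mulrC in QE.
have q0 : q != 0 by apply: contraNneq qx => ->; rewrite root0.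
have Qx : Q.[x] = 0 by rewrite /Q hornerD hornerN hornerZ divfK // subrr.
have k0 : (0 < k)%N.
  rewrite lt0n; apply/eqP => k0; move: Qx; rewrite QE k0 expr0 mul1r => /eqP.
  by rewrite -rootE (negPf qx).
exists k, q; split => //.
  rewrite k0 -sQ QE size_mul ?expf_neq0 ?polyXsubC_eq0 // size_exp_XsubC addSn /=.
  have : (0 < size q)%N by rewrite size_poly_gt0.
  by move=> sq; rewrite -{1}(addn0 k) ltn_add2l.
move=> W0; apply/eqP; rewrite eqn_leq k0 andbT leqNgt; apply/negP => k2.
have [l kE] : exists l, k = l.+2 by case: k k2 {QE k0} => [|[|l]] // _; exists l.
move/eqP: W0; apply.
(* Subtracting the constant value does not change the wronskian, and a root of [Q] of order at least
   2 makes it vanish. *)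
have : (Q^`() * b - Q * b^`()).[x] = (wronskian a b).[x].
  by rewrite /Q /wronskian derivB derivZ !hornerE; ring.
move=> <-; rewrite hornerD hornerN !hornerM Qx mul0r subr0.
suff -> : Q^`().[x] = 0 by rewrite mul0r.
rewrite QE kE derivM deriv_exp derivXsubC mul1r hornerD !hornerM hornerMn.
by rewrite !horner_exp hornerXsubC subrr !exprS !mul0r mul0rn mul0r addr0.
Qed.

End Homogenize.

(** Relative to [S], the set where [P] holds is both open and closed. *)
Lemma locally_constant_connected (T : topologicalType) (S : set T) (P : T -> Prop) :
  connected S ->
  (forall t, S t -> \forall u \near t, S u -> (P u <-> P t)) ->
  forall t u, S t -> S u -> P t -> P u.
Proof.
move=> cS loc t u St Su Pt.
have BS : S `&` [set x | P x] = S.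
  apply: cS; first by exists t.
  - exists (interior [set x | S x -> P x]); first exact: open_interior.
    apply/seteqP; split=> x [Sx Px]; split=> //.
      by have := loc x Sx; move/nbhsS; apply; move=> y H /H [_]; apply.
    exact: (interior_subset Px).
  - exists (~` (interior [set x | S x -> ~ P x])).
      by apply: open_closedC; exact: open_interior.
    apply/seteqP; split=> x [Sx Px]; split=> //.
      by move=> /interior_subset /(_ Sx).
    apply: contrapT => nPx; apply: Px.
    by have := loc x Sx; move/nbhsS; apply; move=> y H /H [h _] /h.
have : (S `&` [set x | P x]) u by rewrite BS.
by case.
Qed.

(** * The basin in an affine coordinate *)

Section Dynamics.
Variable R : realType.
Local Notation C := R[i].
Local Notation hol := (dif (@id C)).
Variables (n d : {poly C}) (f : P1 R -> P1 R) (s : P1 R) (p : C).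
Hypothesis size_dn : (size d < size n)%N.
Hypothesis d_neq0 : d != 0.
Hypothesis nd0 : forall x, d.[x] = 0 -> n.[x] != 0.
Hypothesis fs : f s = s.
Hypothesis fE : forall x, f (pcoord s x) = if d.[x] == 0 then s else pcoord s (n.[x] / d.[x]).
Hypothesis np : n.[p] = p * d.[p].
Hypothesis attr : cabs ((wronskian n d).[p] / d.[p] ^+ 2) < 1.

Let D := (size n).-1.
Let F (x : C) : C := n.[x] / d.[x].
Let A : set C := pcoord s @^-1` basin f (pcoord s p).

Lemma D_gt0 : (0 < D)%N.
Proof. by rewrite /D -subn1 subn_gt0 (size_n_gt1 size_dn d_neq0). Qed.

Lemma size_nD : size n = D.+1.
Proof. by rewrite /D prednK // (leq_ltn_trans _ size_dn). Qed.

Lemma d_D : d`_D = 0.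
Proof. by apply: nth_default; rewrite -ltnS -size_nD. Qed.

Lemma n_D : n`_D != 0.
Proof. by rewrite -[n`_D]/(lead_coef n) lead_coef_eq0 -size_poly_gt0 size_nD. Qed.

(** Numerator and denominator of the iterates. They never acquire a common zero ([ab_pole]), so no
    reduction of fractions is needed. *)
Fixpoint iterate (N : nat) : {poly C} * {poly C} :=
  if N is N'.+1 then
    let: (a, b) := iterate N' in (homog D n a b, homog D d a b)
  else ('X, 1).

Let a N := (iterate N).1.
Let b N := (iterate N).2.

Lemma aS N : a N.+1 = homog D n (a N) (b N).
Proof. by rewrite /a /b /=; case: (iterate N). Qed.

Lemma bS N : b N.+1 = homog D d (a N) (b N).
Proof. by rewrite /a /b /=; case: (iterate N). Qed.

Definition orb N x : C := (a N).[x] / (b N).[x].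

Lemma aS_at N x : (b N).[x] != 0 -> (a N.+1).[x] = (b N).[x] ^+ D * n.[orb N x].
Proof. by move=> b0; rewrite aS homogE // size_nD. Qed.

Lemma bS_at N x : (b N).[x] != 0 -> (b N.+1).[x] = (b N).[x] ^+ D * d.[orb N x].
Proof. by move=> b0; rewrite bS homogE // -size_nD ltnW. Qed.

Lemma ab_pole N x : (b N).[x] = 0 -> (a N).[x] != 0.
Proof.
elim: N x => [|N IH] x; first by rewrite /b /a /= hornerC => /eqP; rewrite oner_eq0.
have [bN|bN] := eqVneq (b N).[x] 0.
  by move=> _; rewrite aS homog_pole // mulf_neq0 ?n_D // expf_neq0 // IH.
rewrite aS_at // bS_at // => /eqP; rewrite mulf_eq0 expf_eq0 (negPf bN) andbF /=.
by move=> /eqP/nd0 n0; rewrite mulf_neq0 // expf_neq0.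
Qed.

Lemma orbS N x : (b N).[x] != 0 -> orb N.+1 x = F (orb N x).
Proof.
move=> bN; rewrite /orb aS_at // bS_at // /F -/(orb N x).
have bD : (b N).[x] ^+ D != 0 by rewrite expf_neq0.
by rewrite invfM mulrACA divff // mul1r.
Qed.

Lemma ab_size N : (b N != 0) /\ (size (b N) < size (a N))%N.
Proof.
elim: N => [|N [bN sN]].
  by rewrite /a /b /= size_polyX size_poly1 oner_neq0.
have aN0 : a N != 0 by rewrite -size_poly_gt0 (leq_ltn_trans _ sN).
have sa : (size (a N.+1) = size (a N ^+ D)%R)%N.
  rewrite aS /homog big_ord_recr /= subnn expr0 mulr1 addrC size_polyDl.
    by rewrite size_scale // n_D.
  by rewrite size_scale ?n_D // size_homog_lt // D_gt0.
have sb : (size (b N.+1) < size (a N.+1))%N.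
  rewrite sa bS /homog big_ord_recr /= d_D scale0r addr0.
  by rewrite size_homog_lt // D_gt0.
(* If [b N.+1] vanished, any root of [a N.+1], which is not constant, would be a common zero. *)
split=> //; apply/eqP => b0.
have : (1 < size (a N.+1))%N.
  have := size_exp (a N) D; rewrite sa => e.
  have : (0 < (size (a N ^+ D)%R).-1)%N.
    rewrite e muln_gt0 D_gt0 andbT; move: sN.
    by rewrite -{1}(prednK (_ : 0 < size (b N))%N) ?size_poly_gt0 //; case: (size (a N)) => [|[|]].
  by case: (size (a N ^+ D)%R) => [|[|]].
move=> s1; have [x /rootP ax] : exists x, root (a N.+1) x.
  by apply/closed_rootP; rewrite gtn_eqF.
by have := @ab_pole N.+1 x; rewrite b0 horner0 ax => /(_ erefl)/eqP.
Qed.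

Lemma iter_pcoord N x :
  iter N f (pcoord s x) = if (b N).[x] == 0 then s else pcoord s (orb N x).
Proof.
elim: N => [|N IH].
  by rewrite /orb /a /b /= hornerC oner_eq0 hornerX divr1.
rewrite iterS IH; have [bN|bN] := eqVneq (b N).[x] 0.
  by rewrite fs bS homog_pole // d_D mul0r eqxx.
rewrite fE bS_at // mulf_eq0 expf_eq0 (negPf bN) andbF /=.
by case: ifP => // _; rewrite orbS.
Qed.

Lemma cvg_tail (u : nat -> P1 R) (z : P1 R) (N : nat) :
  (fun k => u (k + N)%N) @ \oo --> z -> u @ \oo --> z.
Proof.
move=> H P /H [M _ MP]; exists (M + N)%N => // k /= Mk.
have -> : k = ((k - N) + N)%N by rewrite subnK // (leq_trans _ Mk) // leq_addl.
by apply: MP; rewrite /= leq_subRL ?(leq_trans _ Mk) ?leq_addl // addnC.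
Qed.

Lemma cvg_head (u : nat -> P1 R) (z : P1 R) (N : nat) :
  u @ \oo --> z -> (fun k => u (k + N)%N) @ \oo --> z.
Proof.
move=> H P /H [M _ MP]; exists M => // k /= Mk.
by apply: MP; rewrite /= (leq_trans Mk) // leq_addr.
Qed.

Lemma nbhs_pcoord x (e : R) : 0 < e ->
  nbhs (pcoord s x) (pcoord s @` [set y | cabs (y - x) < e]).
Proof.
move=> e0; apply: open_nbhs_nbhs; split; first by apply: pcoord_open; exact: open_disk.
by exists x; rewrite //= subrr cabs0.
Qed.

Lemma A_eventually x (e : R) : A x -> 0 < e -> exists N, forall k, (N <= k)%N ->
  (b k).[x] != 0 /\ cabs (orb k x - p) < e.
Proof.
move=> Ax e0; have [N _ NP] := Ax _ (nbhs_pcoord p e0); exists N => k /NP /=.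
rewrite iter_pcoord => -[y yp]; case: ifP => [_ ys|b0 /pcoord_inj <-].
  by have := @pcoord_neq _ s y; rewrite ys.
by split.
Qed.

(** A pole of an iterate is sent to [s], which is fixed, so its orbit cannot approach [p]. *)
Lemma A_pole x N : A x -> (b N).[x] != 0.
Proof.
move=> Ax; have [M MP] := A_eventually Ax ltr01.
apply/eqP => bN.
have H k : (b (N + k)).[x] = 0.
  elim: k => [|k IH]; first by rewrite addn0.
  by rewrite addnS bS homog_pole // d_D mul0r.
by have [] := MP (N + M)%N (leq_addl _ _); rewrite H eqxx.
Qed.

Lemma A_iter x N : A x -> iter N f (pcoord s x) = pcoord s (orb N x).
Proof. by move=> Ax; rewrite iter_pcoord (negPf (A_pole _ Ax)). Qed.

Lemma A_orb x N : A x -> A (orb N x).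
Proof.
move=> Ax; rewrite /A /= /basin /= -A_iter //.
have := cvg_head N Ax.
by under [X in X @ \oo --> _ -> _]eq_fun do rewrite iterD.
Qed.

Lemma A_of_orb x N : (b N).[x] != 0 -> A (orb N x) -> A x.
Proof.
move=> bN Ao; apply: (@cvg_tail _ _ N).
under eq_fun do rewrite iterD iter_pcoord (negPf bN).
exact: Ao.
Qed.

Lemma orb_add x i j : A x -> orb i (orb j x) = orb (i + j) x.
Proof.
move=> Ax; apply: (@pcoord_inj _ s).
rewrite -(A_iter _ (A_orb _ Ax)) -(A_iter _ Ax) -(A_iter _ Ax).
by rewrite iterD.
Qed.

Lemma cts_orb N x : (b N).[x] != 0 -> cts (orb N) x.
Proof. exact: cts_ratio. Qed.

Lemma dp0 : d.[p] != 0.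
Proof. by apply/eqP => d0; have := nd0 d0; rewrite np d0 mulr0 eqxx. Qed.

Lemma Fp : F p = p.
Proof. by rewrite /F np mulfK // dp0. Qed.

Lemma contraction : exists r l : R, [/\ 0 < r, 0 <= l < 1 &
  forall x, cabs (x - p) < r -> d.[x] != 0 /\ cabs (F x - p) <= l * cabs (x - p)].
Proof.
have [g [cg gp gE]] := hol_ratio n dp0.
pose K := cabs ((wronskian n d).[p] / d.[p] ^+ 2); pose l := (K + 1) / 2.
have Kl : K < l by rewrite /l; move: attr; rewrite -/K; lra.
have gl : cabs (g p) < l by rewrite gp.
have dn := @cts_neq0 _ _ (horner d) p (cts_horner d (@cts_id _ p)) dp0.
have /nbhs_cabsP[r r0 rP] := nbhsI (nbhsI (cts_lt cg gl) gE) dn.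
exists r, l; split => //.
  by move: attr; rewrite -/K /l => ?; have := cabs_ge0 ((wronskian n d).[p] / d.[p] ^+ 2);
    rewrite -/K => ?; apply/andP; split; lra.
move=> x /rP[[gx E] dx]; split=> //; rewrite -{1}Fp E cabsM mulrC.
by rewrite ler_wpM2r ?cabs_ge0 // ltW.
Qed.

Lemma A_disk : exists2 r : R, 0 < r & forall x, cabs (x - p) < r ->
  [/\ A x, d.[x] != 0 & cabs (F x - p) <= cabs (x - p)].
Proof.
have [r [l [r0 /andP[l0 l1] rP]]] := contraction.
exists r => // x xr.
have H k : (b k).[x] != 0 /\ cabs (orb k x - p) <= l ^+ k * cabs (x - p).
  elim: k => [|k [bk IH]].
    by rewrite expr0 mul1r /orb /a /b /= hornerC oner_neq0 hornerX divr1.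
  have ok : cabs (orb k x - p) < r.
    apply: (le_lt_trans IH); apply: le_lt_trans xr.
    by rewrite ler_piMl ?cabs_ge0 // exprn_ile1 // ltW.
  have [dk Fk] := rP _ ok; split.
    by rewrite bS_at // mulf_neq0 // expf_neq0.
  rewrite orbS //; apply: (le_trans Fk); rewrite exprS -mulrA.
  by rewrite ler_wpM2l.
have [dx Fx] := rP x xr; split => //; last first.
  by apply: (le_trans Fx); rewrite ler_piMl ?cabs_ge0 // ltW.
move=> P /(@pcoord_cts _ s p) /nbhs_cabsP[e e0 eP].
have lk : (fun k => l ^+ k) @ \oo --> (0 : R) by apply: cvg_expr; rewrite ger0_norm.
have e1 : 0 < e / (cabs (x - p) + 1).
  by rewrite divr_gt0 // ltr_wpDl // cabs_ge0.
have [N _ NP] := lk _ (nbhsx_ballx (0:R) _ e1).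
exists N => // k /= Nk; rewrite iter_pcoord; have [bk ok] := H k.
rewrite (negPf bk); apply: eP; apply: (le_lt_trans ok).
have := NP k Nk; rewrite /= /ball /= sub0r normrN ger0_norm ?exprn_ge0 //.
rewrite ltr_pdivlMr ?ltr_wpDl ?cabs_ge0 //.
have : 0 <= l ^+ k by rewrite exprn_ge0.
by have := cabs_ge0 (x - p); nra.
Qed.

Lemma p_in_A : A p.
Proof. by have [r r0 rP] := A_disk; have [] := rP p; rewrite ?subrr ?cabs0. Qed.

Lemma A_nbhs x : A x -> exists2 r : R, 0 < r & forall y, cabs (y - x) < r -> A y.
Proof.
move=> Ax; have [r r0 rP] := A_disk.
have [N /(_ N (leqnn N))[bN oN]] := A_eventually Ax r0.
have co : cts (fun y => orb N y - p) x.
  by apply: ctsB; [exact: cts_orb | exact: cts_cst].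
have nb := @cts_neq0 _ _ (horner (b N)) x (cts_horner _ (@cts_id _ x)) bN.
have /nbhs_cabsP[e e0 eP] := nbhsI nb (cts_lt co oN).
exists e => // y /eP[by0 oy]; apply: (@A_of_orb y N) => //.
by have [] := rP _ oy.
Qed.

(** At a root [c] of [n] of order [l.+1] the wronskian vanishes to order exactly [l], in
    characteristic 0. *)
Lemma wronskian_neq0 : wronskian n d != 0.
Proof.
have [c rc] : exists c, root n c.
  by apply/closed_rootP; rewrite gtn_eqF //; exact: size_n_gt1 size_dn d_neq0.
have n0 : n != 0 by rewrite -size_poly_gt0 size_nD.
have [k [q qc nE]] := multiplicity_XsubC n c.
rewrite n0 /= in qc.
have nc : n.[c] = 0 by apply/rootP.
have [l kE] : exists l, k = l.+1.
  case: k nE => [|l] nE; last by exists l.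
  by move: qc; rewrite -[q]mulr1 -[1](expr0 ('X - c%:P)) -nE rc.
apply/eqP => W0; have dc : d.[c] != 0.
  by apply/eqP => dc; have := nd0 dc; rewrite nc eqxx.
pose T := l.+1%:R *: (q * d) + ('X - c%:P) * (q^`() * d - q * d^`()).
have WE : wronskian n d = ('X - c%:P) ^+ l * T.
  rewrite /wronskian nE kE derivM deriv_exp derivXsubC mul1r /= /T.
  rewrite -mulr_natl exprS scaler_nat; ring.
move: W0; rewrite WE => /eqP; rewrite mulf_eq0 expf_eq0 polyXsubC_eq0 andbF /=.
move=> /eqP/(congr1 (horner^~ c)); rewrite /T hornerD hornerZ !hornerM hornerXsubC subrr.
rewrite mul0r addr0 horner0 => /eqP; rewrite !mulf_eq0 (negPf dc) pnatr_eq0 /=.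
by rewrite -rootE (negPf qc).
Qed.

(* [D] bounds each local degree, and an orbit ending at a point [v <> p] of the basin
   meets each critical point at most once, since [v] would otherwise be periodic. *)
Definition crit_bound : nat := D ^ (size (wronskian n d)).-1.

Lemma orb_order v x N : A v -> v <> p -> (b N).[x] != 0 -> orb N x = v ->
  exists k q, [/\ a N - v *: b N = ('X - x%:P) ^+ k * q, q.[x] != 0 &
    (0 < k <= crit_bound)%N].
Proof.
move=> Av vp bN ov.
have Ax : A x by apply: A_of_orb bN _; rewrite ov.
have [k [q [kE qx /andP[k0 _] _]]] := ratio_order (ab_size N).2 bN.
rewrite -/(orb N x) ov in kE.
exists k, q; split => //; rewrite k0 /=.
have ok : ord_at (orb N) x k by exact: ord_ratio ov kE qx.
have pole j : (b j).[x] != 0 by exact: A_pole.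
have dj j : d.[orb j x] != 0.
  by have := pole j.+1; rewrite bS_at // mulf_eq0 negb_or => /andP[].
have /choice[kk kkP] : forall j, exists k', ord_at F (orb j x) k' /\
    [/\ (0 < k' < size n)%N & (wronskian n d).[orb j x] != 0 -> k' = 1%N].
  move=> j; have [k' [q' [E' qx' k'0 k'W]]] := ratio_order size_dn (dj j).
  by exists k'; split => //; exact: ord_ratio E' qx'.
(* Local degrees multiply along the orbit. *)
have ordN m : ord_at (orb m) x (\prod_(j < m) kk j).
  elim: m => [|m IH].
    rewrite big_ord0; exists (fun=> 1); split; [exact: cts_cst | exact: oner_neq0 |].
    apply: nbhsW => t; rewrite /orb /a /b /= !hornerC !hornerX !divr1.
    by rewrite expr1 mulr1.
  rewrite big_ord_recr /=.
  have nb := @cts_neq0 _ _ (horner (b m)) x (cts_horner _ (@cts_id _ x)) (pole m).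
  apply: (@ord_near _ (F \o orb m)).
    by move/nbhsS: nb; apply; move=> t bt; rewrite orbS.
  by apply: ord_comp IH _; [exact: cts_orb | case: (kkP m)].
(* The multiplicity of the root [x] and the product of local degrees are both orders of [orb N] at
   [x]. *)
have -> : k = (\prod_(j < N) kk j)%N by exact: ord_uniq ok (ordN N).
have [rs WE rsS] := poly_factor (wronskian n d).
have inrs y : (wronskian n d).[y] = 0 -> y \in rs.
  move/eqP; rewrite {1}WE hornerZ mulf_eq0 lead_coef_eq0 (negPf wronskian_neq0) /=.
  by rewrite -rootE root_prod_XsubC.
have inj i j : (i < N)%N -> (j < N)%N -> orb i x = orb j x -> i = j.
  wlog ij : i j / (i < j)%N.
    move=> H iN jN e; have [ij|ji|//] := ltngtP i j; first exact: H.
    by apply/esym; apply: H.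
  (* A repeated point [y] is periodic and attracted by [p], hence equal to [p]; then [v], which lies
     on its orbit, is [p] too. *)
  move=> iN jN e; exfalso; pose y := orb i x; pose t := (j - i)%N.
  have Ay : A y by exact: A_orb.
  have yt : orb t y = y by rewrite /y orb_add // /t subnK ?(ltnW ij) // e.
  have ytm m : orb (m * t) y = y.
    elim: m => [|m IH]; first by rewrite /orb /a /b /= hornerX hornerC divr1.
    by rewrite mulSn -orb_add // IH.
  have yp : y = p.
    apply/eqP; rewrite -subr_eq0 -cabs_eq0; apply/eqP/le_anti; rewrite cabs_ge0 andbT.
    apply/ler_addgt0Pl => e0 e00; rewrite addr0.
    have [M MP] := A_eventually Ay e00.
    have [|_] := MP (M * t)%N; last by rewrite ytm => /ltW.
    by rewrite -{1}(muln1 M) leq_mul2l subn_gt0 ij orbT.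
  have op m : orb m p = p.
    elim: m => [|m IH]; first by rewrite /orb /a /b /= hornerX hornerC divr1.
    by rewrite orbS ?IH ?Fp //; exact: A_pole p_in_A.
  by apply: vp; rewrite -ov -(subnK (ltnW iN)) -orb_add // -/y yp op.
pose L := [seq orb j x | j <- iota 0 N & (wronskian n d).[orb j x] == 0].
have uL : uniq L.
  rewrite map_inj_in_uniq ?filter_uniq ?iota_uniq // => i j.
  by rewrite !mem_filter !mem_iota !add0n => /andP[_ /andP[_ iN]] /andP[_ /andP[_ jN]]; exact: inj.
have sL : (size L <= (size (wronskian n d)).-1)%N.
  rewrite -rsS; apply: uniq_leq_size uL _ => y /mapP[j].
  by rewrite mem_filter => /andP[/eqP wj _] ->; exact: inrs.
apply: (@leq_trans (D ^ size L)); last first.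
  by rewrite /crit_bound leq_pexp2l ?D_gt0.
rewrite size_map size_filter -sum1_count -(big_mkord xpredT kk) /index_iota subn0.
pose P j : bool := (wronskian n d).[orb j x] == 0.
have -> : (D ^ (\sum_(j <- iota 0 N | P j) 1) = \prod_(j <- iota 0 N) (if P j then D else 1))%N.
  elim: (iota 0 N) => [|j l IH]; first by rewrite !big_nil.
  rewrite !big_cons; case: ifP => _; last by rewrite mul1n.
  by rewrite expnD expn1 IH.
apply: leq_prod => j _; have [_ [/andP[_ kn] kW]] := kkP j.
rewrite /P; case: ifPn => [_|/kW -> //].
by rewrite -ltnS -size_nD.
Qed.

Lemma orb_crit x N : A x -> (wronskian (a N) (b N)).[x] = 0 ->
  exists2 j, (j < N)%N & (wronskian n d).[orb j x] = 0.
Proof.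
move=> Ax; elim: N => [|N IH].
  rewrite /a /b /wronskian /= derivX derivC mulr1 mulr0 subr0 hornerC => /eqP.
  by rewrite oner_eq0.
have pole j : (b j).[x] != 0 by exact: A_pole.
have dN : d.[orb N x] != 0.
  by have := pole N.+1; rewrite bS_at // mulf_eq0 negb_or => /andP[].
move=> W0; have h1 := hol_ratio (a N.+1) (pole N.+1).
have h2 : hol (F \o orb N) x _ :=
  dif_comp (@cts_id _ x) (hol_ratio (a N) (pole N)) (hol_ratio n dN).
have nb := @cts_neq0 _ _ (horner (b N)) x (cts_horner _ (@cts_id _ x)) (pole N).
have h3 : hol (orb N.+1) x ((wronskian (a N) (b N)).[x] / (b N).[x] ^+ 2 *
    ((wronskian n d).[orb N x] / d.[orb N x] ^+ 2)).
  apply: dif_near h2.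
  by move/nbhsS: nb; apply; move=> t bt; rewrite orbS.
have := hol_uniq h1 h3; rewrite W0 mul0r => /esym/eqP.
rewrite !mulf_eq0 !invr_eq0 !expf_eq0 /= (negPf (pole N)) (negPf dN) !orbF.
move=> /orP[/eqP/IH[j jN jW]|/eqP W]; last by exists N.
by exists j => //; exact: ltnW.
Qed.

Lemma seq_separated (u : nat -> C) v (K : R) N : 0 < K ->
  (forall k, (N <= k)%N -> K <= cabs (u k - v)) ->
  exists2 r : R, 0 < r & forall k, u k = v \/ r < cabs (u k - v).
Proof.
move=> K0 uK.
have [|k kN|r r0 rP] := @seq_uniform R nat (iota 0 N)
    (fun k r => u k = v \/ r < cabs (u k - v)).
- by move=> k e e' [|h] => [|/andP[_ ee']]; [left | right; exact: le_lt_trans h].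
- have [->|uv] := eqVneq (u k) v; first by exists 1; [|left].
  have c0 : 0 < cabs (u k - v) by rewrite cabs_gt0 subr_eq0.
  by exists (cabs (u k - v) / 2); [lra | right; lra].
exists (Num.min r (K / 2)); first by rewrite lt_min r0 divr_gt0.
move=> k; have [kN|Nk] := ltnP k N.
  have [|->|rk] := rP k; [by rewrite mem_iota | by left |].
  by right; apply: le_lt_trans rk; rewrite ge_min lexx.
right; apply: (@le_lt_trans _ _ (K / 2)); first by rewrite ge_min lexx orbT.
by have := uK k Nk; lra.
Qed.

(** Each critical orbit in the basin tends to [p], so only finitely many of its points come near
    [v]. The orbit may still pass through [v] itself, hence the alternative. *)
Lemma postcritical_gap v : A v -> v <> p -> exists2 r : R, 0 < r &
  forall c k, A c -> (wronskian n d).[c] = 0 -> orb k c = v \/ r < cabs (orb k c - v).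
Proof.
move=> Av vp; have [rs WE _] := poly_factor (wronskian n d).
have inrs y : (wronskian n d).[y] = 0 -> y \in rs.
  move/eqP; rewrite {1}WE hornerZ mulf_eq0 lead_coef_eq0 (negPf wronskian_neq0) /=.
  by rewrite -rootE root_prod_XsubC.
have [|c crs|r r0 rP] := @seq_uniform R C rs (fun c r => A c ->
    forall k, orb k c = v \/ r < cabs (orb k c - v)).
- move=> c e e' H /andP[_ ee'] Ac k; have [|h] := H Ac k; first by left.
  by right; exact: le_lt_trans h.
- have [Ac|nA] := pselect (A c); last by exists 1.
  have vp0 : 0 < cabs (v - p) / 2.
    by rewrite divr_gt0 // cabs_gt0 subr_eq0; exact/eqP.
  have [N NP] := A_eventually Ac vp0.
  have [|r r0 rP] := @seq_separated (orb^~ c) v _ N vp0.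
    move=> k /NP[_ kp]; have := cabs_sub v (orb k c) p; rewrite (cabsB v (orb k c)); lra.
  by exists r.
by exists r => // c k Ac /inrs crs; exact: rP.
Qed.

(** The uniformity lies in the order of quantifiers: one [m] for all iterates [N] and all points [z]
    over [x]. *)
Definition uniformly_near (m : nat) x y : Prop := forall N z, (b N).[z] != 0 ->
  orb N z = x -> exists z', [/\ (b N).[z'] != 0, orb N z' = y & reach A m z z'].

Lemma uniformly_near_trans k m x y z :
  uniformly_near k x y -> uniformly_near m y z -> uniformly_near (k + m) x z.
Proof.
move=> xy yz N w bw ow; have [w1 [b1 o1 r1]] := xy N w bw ow.
have [w2 [b2 o2 r2]] := yz N w1 b1 o1; exists w2; split => //.
exact: reach_add r1 r2.
Qed.

Lemma short_piece z (e : R) z' z'' : (forall y, cabs (y - z) < e -> A y) ->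
  cabs (z' - z) < e / 2 -> cabs (z'' - z) < e / 2 -> piece A z' z''.
Proof.
move=> zA z'e z''e; apply: piece_segment => t x /andP[t0 t1] x1; apply: zA.
have -> : seg z' z'' t + (z'' - z') / 2 * x - z =
  seg (z' - z) (z'' - z) t + (z'' - z') / 2 * x by rewrite /seg; ring.
apply: (le_lt_trans (cabsD _ _)).
have z3 : cabs ((z'' - z') / 2 * x) < e / 2.
  rewrite cabsM cabsM cabsV -[2]/(2%:R) -(rmorph_nat (real_complex R)) cabs_real ger0_norm //.
  have := cabs_sub z'' z z'; rewrite (cabsB z z') => h1.
  have := cabs_ge0 x; have := cabs_ge0 (z'' - z'); nra.
have e2 : cabs (seg (z' - z) (z'' - z) t) <= e / 2.
  by apply: cabs_seg; [apply/andP | exact: ltW | exact: ltW].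
lra.
Qed.

(** Lets a path avoid the center of a disk at the price of one more segment. *)
Lemma detour (x y : C) : x != 0 -> y != 0 -> exists w, [/\ w != 0, cabs w = cabs x,
  forall t, 0 <= t <= 1 -> seg x w t != 0 & forall t, 0 <= t <= 1 -> seg w y t != 0].
Proof.
move=> x0 y0.
have [xy|nxy] := pselect (forall t, 0 <= t <= 1 -> seg x y t != 0).
  by exists x; split => // t _; rewrite /seg subrr mulr0 addr0.
have [t0 [t01 sxy]] : exists t, 0 <= t <= 1 /\ seg x y t = 0.
  apply: contrapT => H; apply: nxy => t t01; apply/eqP => sx.
  by apply: H; exists t.
have [e|t00] := eqVneq t0 0; first by move: sxy; rewrite e seg0 => xx; rewrite xx eqxx in x0.
have tc : t0%:C%C != 0 :> C by rewrite -cabs_eq0 cabs_real normr_eq0.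
pose k : R := (1 - t0) / t0.
have k0 : 0 <= k by case/andP: t01 => ? ?; rewrite divr_ge0 // subr_ge0.
have yE : y = - k%:C%C * x.
  apply: (mulfI tc); rewrite /k rmorphM fmorphV rmorphB rmorph1.
  have -> : t0%:C%C * (- ((1 - t0%:C%C) / t0%:C%C) * x) = - (1 - t0%:C%C) * x by field.
  apply/eqP; rewrite -subr_eq0 -sxy /seg; apply/eqP; ring.
clearbody k.
have k1 : 0 < k.
  rewrite lt_def k0 andbT; apply: contraNneq y0 => kk.
  by rewrite yE kk rmorph0 oppr0 mul0r.
have i0 : 'i%C != 0 :> C by rewrite -cabs_eq0 cabs_i oner_eq0.
have nz (u w : R) : (u != 0) || (w != 0) -> (u%:C%C + w%:C%C * 'i%C : C) != 0.
  move=> uw; apply/eqP => /eqP; rewrite eq_complex /= => /andP[]; simpc => /eqP u0 /eqP w0.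
  by move: uw; rewrite u0 w0 eqxx.
(* If the straight segment meets 0, [y] is a negative multiple of [x]; a quarter turn of [x] is then
   visible from both without crossing 0. *)
exists ('i%C * x); split.
- by rewrite mulf_neq0.
- by rewrite cabsM cabs_i mul1r.
- move=> t t01'; have -> : seg x ('i%C * x) t = ((1 - t)%:C%C + t%:C%C * 'i%C) * x.
    by rewrite /seg rmorphB rmorph1; ring.
  rewrite mulf_neq0 // nz //; have [e|_] := eqVneq t 0; last by rewrite orbT.
  by rewrite e subr0 oner_eq0.
move=> t t01'; rewrite yE.
have -> : seg ('i%C * x) (- k%:C%C * x) t = ((- (t * k))%:C%C + (1 - t)%:C%C * 'i%C) * x.
  by rewrite /seg rmorphN rmorphM rmorphB rmorph1 /=; ring.
rewrite mulf_neq0 // nz //; have [e|] := eqVneq (1 - t) 0; last by rewrite orbT.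
by rewrite orbF oppr_eq0 mulf_eq0 gt_eqF ?orbF ?gt_eqF //; lra.
Qed.

Lemma nonroot_near (q : {poly C}) z (e : R) : q != 0 -> 0 < e ->
  exists2 y, q.[y] != 0 & cabs (y - z) < e.
Proof.
move=> q0 e0; apply: contrapT => H.
have qz y : cabs (y - z) < e -> q.[y] = 0.
  by move=> ye; apply: contrapT => /eqP qy; apply: H; exists y.
pose u (k : nat) : C := z + (e / (k%:R + 2))%:C%C.
have k2 (k : nat) : 0 < k%:R + 2 :> R by rewrite ltr_wpDl.
have uq k : q.[u k] = 0.
  apply: qz; rewrite /u addrAC subrr add0r cabs_real gtr0_norm ?divr_gt0 //.
  by rewrite ltr_pdivrMr // ltr_pMr //; have : 0 <= k%:R :> R by []; lra.
have := max_poly_roots q0 (rs := [seq u k | k <- iota 0 (size q)]).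
rewrite size_map size_iota ltnn => FF; suff : false by [].
apply: FF; first by apply/allP => _ /mapP[k _ ->]; apply/rootP.
rewrite map_inj_uniq ?iota_uniq // => i j /addrI/complexI.
move=> /(mulfI (lt0r_neq0 e0))/invr_inj/addIr/eqP.
by rewrite eqr_nat => /eqP.
Qed.

(** An [M]-th root. The radius [r * (1 / 2) ^+ M] is that of the image of the half disk, where
    [piece_lift] operates. *)
Lemma disk_coordinate (v x : C) (r : R) M : (0 < M)%N -> 0 < r -> x != v ->
  cabs (x - v) <= r * (1 / 2) ^+ M ->
  exists z, [/\ z != 0, cabs z <= 1 / 2 & root_disk v r M z = x].
Proof.
move=> M0 r0 xv xr.
have rC : r%:C%C != 0 :> C by rewrite -cabs_eq0 cabs_real normr_eq0 gt_eqF.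
pose c := (x - v) / r%:C%C; pose P : {poly C} := 'X^M - c%:P.
have [z] : exists z, root P z by apply/closed_rootP; rewrite size_XnsubC // eqSS -lt0n.
move/rootP; rewrite /P hornerD hornerN hornerXn hornerC => /eqP.
rewrite subr_eq0 => /eqP zM; exists z; split.
- apply: contraNneq xv => z0; move: zM; rewrite z0 expr0n (gtn_eqF M0) /c => /esym/eqP.
  by rewrite mulf_eq0 invr_eq0 (negPf rC) orbF subr_eq0.
- rewrite -(@ler_pXn2r _ M) // ?nnegrE ?cabs_ge0 ?divr_ge0 // -cabsX zM /c.
  by rewrite cabsM cabsV cabs_real gtr0_norm // ler_pdivrMr // mulrC.
- by rewrite /root_disk zM /c mulrC divfK // addrC subrK.
Qed.

(** Count of the four pieces: one to leave the fiber of [v], two for a path in the lifted disk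
    avoiding its center, and one to end over [v] when [y = v]. *)
Lemma local_uniform v : A v -> v <> p -> exists2 e : R, 0 < e &
  forall x y, cabs (x - v) < e -> cabs (y - v) < e -> uniformly_near 4 x y.
Proof.
move=> Av vp; have [r1 r10 r1P] := A_nbhs Av.
have [r2 r20 r2P] := postcritical_gap Av vp.
pose r := Num.min r1 r2 / 2.
have r0 : 0 < r by rewrite divr_gt0 // lt_min r10.
have rr1 : r < r1.
  by have : Num.min r1 r2 <= r1; [rewrite ge_min lexx | rewrite /r => ?; lra].
have rr2 : r < r2.
  by have : Num.min r1 r2 <= r2; [rewrite ge_min lexx orbT | rewrite /r => ?; lra].
(* The factorial is a multiple of every local degree up to [crit_bound]; the factor 2 makes the
   quotient at least 2. *)
pose M := (2 * crit_bound`!)%N.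
have M0 : (0 < M)%N by rewrite muln_gt0 fact_gt0.
pose e := r * (1 / 2) ^+ M.
have e0 : 0 < e by rewrite mulr_gt0 // exprn_gt0 // divr_gt0.
exists e => // x y xe ye N z bz oz.
have [bN sN] := ab_size N.
have pole := @ab_pole N.
have orders c : root (a N - v *: b N) c -> exists k m q,
  [/\ a N - v *: b N = ('X - c%:P) ^+ k * q, q.[c] != 0, (0 < k)%N, (1 < m)%N & M = (k * m)%N].
  move=> /rootP; rewrite hornerD hornerN hornerZ => /eqP; rewrite subr_eq0 => /eqP ac.
  have bc : (b N).[c] != 0 by exact: fiber_pole ac.
  have oc : orb N c = v by rewrite /orb ac mulfK.
  have [k [q [E qc kb]]] := orb_order Av vp bc oc.
  have /dvdnP[m mE] := dvdn_fact kb.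
  exists k, (2 * m)%N, q; split => //; first by case/andP: kb.
    by have := fact_gt0 crit_bound; rewrite mE; case: (m) => [|m'] //; rewrite mulnS.
  by rewrite /M mE; ring.
have noncrit u w : (a N).[u] = w * (b N).[u] -> w != v -> cabs (w - v) <= r ->
    (wronskian (a N) (b N)).[u] != 0.
  move=> au wv wr; apply/eqP => W0.
  have bu : (b N).[u] != 0 by exact: fiber_pole au.
  have ou : orb N u = w by rewrite /orb au mulfK.
  have Au : A u by apply: A_of_orb bu _; rewrite ou; apply: r1P; exact: le_lt_trans rr1.
  (* A critical point of [orb N] over [w] puts a critical point of [F] on the orbit, and its later
     image [w] lies within [r] of [v] without being [v], against the gap. *)
  have [j jN Wj] := orb_crit Au W0.
  have [ov|] := r2P (orb j u) (N - j)%N (A_orb j Au) Wj.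
    by move: ov; rewrite orb_add // subnK ?(ltnW jN) // ou => /eqP; rewrite (negPf wv).
  by rewrite orb_add // subnK ?(ltnW jN) // ou ltNge (le_trans wr) // ltW.
have Lift := liftable1 sN bN pole r0 orders noncrit.
have Az : A z by apply: A_of_orb bz _; rewrite oz; apply: r1P; apply: lt_trans xe _;
  rewrite /e; apply: le_lt_trans rr1; rewrite ler_piMr ?(ltW r0) // exprn_ile1 ?divr_ge0 //; lra.
(* Move off the fibre of [v], over which a value does not determine the lift. *)
have [z1 [zz1 bz1 oz1 oz1v]] : exists z1, [/\ piece A z z1, (b N).[z1] != 0,
    cabs (orb N z1 - v) < e & orb N z1 != v].
  have [rz rz0 rzP] := A_nbhs Az.
  have co : cts (fun t => orb N t - v) z.
    by apply: ctsB; [exact: cts_orb | exact: cts_cst].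
  have nb := @cts_neq0 _ _ (horner (b N)) z (cts_horner _ (@cts_id _ z)) bz.
  have oze : cabs (orb N z - v) < e by rewrite oz.
  have /nbhs_cabsP[e1 e10 e1P] := nbhsI nb (cts_lt co oze).
  have q0 : a N - v *: b N != 0.
    by rewrite -size_poly_gt0 size_fiber // (leq_ltn_trans _ sN).
  have m0 : 0 < Num.min e1 (rz / 2) by rewrite lt_min e10 divr_gt0.
  have [z1 qz1 zz1] := nonroot_near z q0 m0.
  have [|b1 o1] := e1P z1; first by apply: lt_le_trans zz1 _; rewrite ge_min lexx.
  exists z1; split => //.
    apply: (short_piece rzP); first by rewrite subrr cabs0 divr_gt0.
    by apply: lt_le_trans zz1 _; rewrite ge_min lexx orbT.
  apply: contraNneq qz1 => ov.
  by rewrite hornerD hornerN hornerZ -ov divfK // subrr.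
have [u1 [u10 u12 u1E]] := disk_coordinate M0 r0 oz1v (ltW oz1).
have a1 : (a N).[z1] = root_disk v r M u1 * (b N).[z1] by rewrite u1E /orb divfK.
have u11 : cabs u1 <= 1 by lra.
have [h Lh hz] := Lift u1 z1 u10 u11 a1.
have [ch hP] := Lh.
have hb u : cabs u <= 1 -> (b N).[h u] != 0 by move=> /hP; exact: fiber_pole.
have ho u : cabs u <= 1 -> orb N (h u) = root_disk v r M u.
  by move=> uu; rewrite /orb hP // mulfK // hb.
have hA u : cabs u < 1 -> A (h u).
  move=> /ltW uu; apply: A_of_orb (hb u uu) _; rewrite ho //; apply: r1P.
  by apply: le_lt_trans rr1; exact: root_disk_le.
have to_point u2 : u2 != 0 -> cabs u2 <= 1 / 2 -> reach A 3 z (h u2).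
  move=> u20 u22; have [w [w0 wE w1 w2]] := detour u10 u20.
  have hw : cabs w <= 1 / 2 by rewrite wE.
  exists (h w); last by apply: piece_lift Lh hA hw u22 w2.
  exists z1; first by exists z.
  by rewrite -hz; apply: piece_lift Lh hA u12 hw w1.
(* The path in the disk must avoid its center, so [h 0], the point over [v], is approached in the
   disk and then joined by a short segment. *)
have [yv|yv] := eqVneq y v; last first.
  have [u2 [u20 u22 u2E]] := disk_coordinate M0 r0 yv (ltW ye).
  have u21 : cabs u2 <= 1 by lra.
  exists (h u2); split; [exact: hb | by rewrite ho |].
  by apply: reach_le (to_point u2 u20 u22).
have c01 : cabs (0 : C) < 1 by rewrite cabs0.
exists (h 0); split; first exact: hb (ltW c01).
  by rewrite ho ?(ltW c01) // /root_disk expr0n (gtn_eqF M0) mulr0 addr0.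
have [rz rz0 rzP] := A_nbhs (hA 0 c01).
have rz2 : 0 < rz / 2 by rewrite divr_gt0.
have /nbhs_cabsP[e1 e10 e1P] := ch 0 _ rz2.
pose u2 : C := (Num.min (1 / 2) (e1 / 2))%:C%C.
have m0 : 0 < Num.min (1 / 2) (e1 / 2) by rewrite lt_min !divr_gt0.
have u2E : cabs u2 = Num.min (1 / 2) (e1 / 2) by rewrite cabs_real gtr0_norm.
exists (h u2).
  apply: to_point; first by rewrite -cabs_gt0 u2E.
  by rewrite u2E ge_min lexx.
apply: (short_piece rzP); last by rewrite subrr cabs0.
apply: e1P; rewrite subr0 u2E; apply: (@le_lt_trans _ _ (e1 / 2)); last lra.
by rewrite ge_min lexx orbT.
Qed.

(** * Reaching a prescribed point of the component of [p] with a uniform bound *)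

Section Target.
Variable q : C.
Hypothesis qp : q <> p.
Hypothesis q_comp : connected_component (basin f (pcoord s p)) (pcoord s p) (pcoord s q).

Definition leads x : Prop := exists m, uniformly_near m x q.

Lemma leads_q : leads q.
Proof. by exists 0%N => N z bz oz; exists z. Qed.

(** [local_uniform] is symmetric in its two points, so leading to [q] is locally constant away from
    [p]. *)
Lemma leads_local x : A x -> x <> p -> exists2 e : R, 0 < e &
  forall y, cabs (y - x) < e -> y <> p /\ (leads y <-> leads x).
Proof.
move=> Ax xp; have [e e0 eP] := local_uniform Ax xp.
have xp0 : 0 < cabs (x - p) by rewrite cabs_gt0 subr_eq0; exact/eqP.
have xx : cabs (x - x) < e by rewrite subrr cabs0.
exists (Num.min e (cabs (x - p))); first by rewrite lt_min e0.
move=> y; rewrite lt_min => /andP[ye yp]; split.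
  by move=> yE; move: yp; rewrite yE cabsB ltxx.
split=> -[m mP]; exists (4 + m)%N.
  exact: uniformly_near_trans (eP _ _ xx ye) mP.
exact: uniformly_near_trans (eP _ _ ye xx) mP.
Qed.

Lemma leads_seg x y : (forall t, 0 <= t <= 1 -> A (seg x y t) /\ seg x y t <> p) ->
  leads x -> leads y.
Proof.
move=> xyA; rewrite -{1}(seg0 x y) -{2}(seg1 x y).
apply: (@locally_constant_connected R `[0, 1]%classic (fun t => leads (seg x y t)) _ _ 0 1).
- exact: segment_connected.
- move=> t; rewrite /= in_itv /= => /xyA[At tp].
  have [e e0 eP] := leads_local At tp.
  have := @cts_seg _ x y t e e0; move/nbhsS; apply; move=> u /eP[_ H] _; exact: H.
- by rewrite /= in_itv /= lexx ler01.
- by rewrite /= in_itv /= lexx ler01.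
Qed.

Lemma leads_punctured (r : R) : 0 < r -> (forall x, cabs (x - p) < r -> A x) ->
  forall x y, x <> p -> y <> p -> cabs (x - p) < r -> cabs (y - p) < r -> leads x -> leads y.
Proof.
move=> r0 rA x y xp yp xr yr.
have x0 : x - p != 0 by rewrite subr_eq0; exact/eqP.
have y0 : y - p != 0 by rewrite subr_eq0; exact/eqP.
have [w [w0 wE w1 w2]] := detour x0 y0.
have inside u v t : cabs u < r -> cabs v < r -> 0 <= t <= 1 -> seg u v t != 0 ->
    A (seg (p + u) (p + v) t) /\ seg (p + u) (p + v) t <> p.
  move=> ur vr t01 st.
  have E : seg (p + u) (p + v) t - p = seg u v t by rewrite /seg; ring.
  split; last by move=> e; move: st; rewrite -E e subrr eqxx.
  apply: rA; rewrite E; apply: (@le_lt_trans _ _ (Num.max (cabs u) (cabs v))).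
    by apply: cabs_seg => //; rewrite le_max lexx ?orbT.
  by rewrite gt_max ur.
have wr : cabs w < r by rewrite wE.
move=> Lx; have Lw : leads (p + w).
  apply: leads_seg Lx => t t01; have := inside (x - p) w t xr wr t01 (w1 t t01).
  by rewrite (addrC p (x - p)) subrK.
apply: leads_seg Lw => t t01; have := inside w (y - p) t wr yr t01 (w2 t t01).
by rewrite (addrC p (y - p)) subrK.
Qed.

Lemma leads_near_p : exists2 r : R, 0 < r &
  forall x, x <> p -> cabs (x - p) < r -> leads x.
Proof.
have [r r0 rP] := A_disk.
have rA x : cabs (x - p) < r -> A x by case/rP.
exists r => //; suff [x [xp xr Lx]] : exists x, [/\ x <> p, cabs (x - p) < r & leads x].
  by move=> y yp yr; exact: leads_punctured r0 rA x y xp yp xr yr Lx.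
(* Otherwise leading to [q] would be locally constant on the whole component, false around [p] and
   yet true at [q]. *)
apply: contrapT => H.
pose P z := exists x, [/\ z = pcoord s x, x <> p & leads x].
pose S := connected_component (basin f (pcoord s p)) (pcoord s p).
have Sp : S (pcoord s p) by apply: connected_component_refl; exact: p_in_A.
suff : P (pcoord s p) by move=> [x [/pcoord_inj <-]].
apply: (@locally_constant_connected _ S P _ _ (pcoord s q)) => //.
- exact: component_connected.
- move=> z Sz; have Az := connected_component_sub Sz.
  have zs : z <> s.
    move=> zs; have : A p := p_in_A.
    have [N _ NP] := Az _ (nbhs_pcoord p ltr01).
    have iterz k : iter k f z = s by elim: k => [//|k /= ->].
    by have [y _ ys] := NP N (leqnn N); have := @pcoord_neq _ s y; rewrite ys iterz.
  have zE := pcoord_invK zs; move: zE Az Sz; set x := pcoord_inv s z => <- Ax _.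
  have [xp|xp] := pselect (x = p).
    rewrite xp; have := nbhs_pcoord p r0; move/nbhsS; apply.
    move=> _ [y yr <-] _; split=> [[u [/pcoord_inj <- yp Ly]]|[u [/pcoord_inj <-]]] //.
    by exfalso; apply: H; exists y.
  have [e e0 eP] := leads_local Ax xp.
  have := nbhs_pcoord x e0; move/nbhsS; apply.
  move=> _ [y /eP[yp yx] <-] _; split=> -[u [/pcoord_inj <- _ Lu]].
    by exists x; split => //; exact/yx.
  by exists y; split => //; exact/yx.
- by exists q; split => //; exact: leads_q.
Qed.

(** Here the time [N'] of arrival at [q] is free, unlike in [uniformly_near]: points of [K] need a
    further iterate. *)
Definition reaches (m : nat) x : Prop := forall N z, (b N).[z] != 0 -> orb N z = x ->
  exists N' z', [/\ (b N').[z'] != 0, orb N' z' = q & reach A m z z'].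

Lemma b1 x : (b 1).[x] = d.[x].
Proof.
rewrite bS_at /orb /a /b /= ?hornerC ?hornerX ?oner_neq0 //.
by rewrite expr1n mul1r divr1.
Qed.

Lemma orb0 x : orb 0 x = x.
Proof. by rewrite /orb /a /b /= hornerC hornerX divr1. Qed.

Lemma b0_neq0 x : (b 0).[x] != 0.
Proof. by rewrite /b /= hornerC oner_neq0. Qed.

Lemma A_of_F x : d.[x] != 0 -> A (F x) -> A x.
Proof.
move=> dx AF; apply: (@A_of_orb x 1); first by rewrite b1.
by rewrite orbS ?b0_neq0 // orb0.
Qed.

Lemma Fp_poly_neq0 : n - p *: d != 0.
Proof. by rewrite -size_poly_gt0 size_fiber // size_nD. Qed.

(** The map may send [x] to [p], which does not lead to [q]. A nearby [y] with [F y <> p] is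
    therefore reached first, over time [N]; at time [N.+1] it lies over a point that leads to
    [q]. *)
Lemma reaches_local x r : (forall y, y <> p -> cabs (y - p) < r -> leads y) ->
  A x -> x <> p -> d.[x] != 0 -> cabs (F x - p) < r ->
  exists2 e : R, 0 < e & exists m, forall y, cabs (y - x) < e -> reaches m y.
Proof.
move=> rL Ax xp dx Fx; have [e e0 eP] := local_uniform Ax xp.
have cF : cts (fun y => F y - p) x.
  by apply: ctsB; [exact: cts_ratio | exact: cts_cst].
have nd := @cts_neq0 _ _ (horner d) x (cts_horner d (@cts_id _ x)) dx.
have [rx rx0 rxA] := A_nbhs Ax.
have /nbhs_cabsP[e1 e10 e1P] := nbhsI nd (cts_lt cF Fx).
have m0 : 0 < Num.min rx (Num.min e e1) by rewrite !lt_min rx0 e0.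
have [y Qy] := nonroot_near x Fp_poly_neq0 m0.
rewrite !lt_min => /andP[yrx /andP[ye ye1]].
have [dy Fy] := e1P y ye1.
have Fyp : F y <> p.
  move=> Fyp; move/eqP: Qy; apply.
  by rewrite hornerD hornerN hornerZ -Fyp /F divfK // subrr.
have [m mP] := rL _ Fyp Fy.
exists e => //; exists (4 + m)%N => x' x'e N z bz oz.
have [z1 [bz1 oz1 rz1]] := eP x' y x'e ye N z bz oz.
have Ay : A y by exact: rxA.
have Az1 : A z1 by apply: A_of_orb bz1 _; rewrite oz1.
have oz1' : orb N.+1 z1 = F y by rewrite orbS // oz1.
have [z2 [bz2 oz2 rz2]] := mP N.+1 z1 (A_pole _ Az1) oz1'.
by exists N.+1, z2; split => //; exact: reach_add rz1 rz2.
Qed.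

Lemma reaches_le k m x : A x -> (k <= m)%N -> reaches k x -> reaches m x.
Proof.
move=> Ax km H N z bz oz; have [N' [z' [bz' oz' rz']]] := H N z bz oz.
exists N', z'; split => //; apply: reach_le km rz'.
by apply: A_of_orb bz _; rewrite oz.
Qed.

Lemma all_reach : exists2 m : nat, (0 < m)%N & forall z, A z -> exists N' z',
  [/\ (b N').[z'] != 0, orb N' z' = q & reach A m z z'].
Proof.
have [r1 r10 r1P] := leads_near_p; have [r2 r20 r2P] := A_disk.
(* Two points within [e / 4] of [p] are joined by one [short_piece] in the disk of radius [e], which
   asks for distances below [e / 2]. *)
pose e := Num.min r1 r2; pose r := e / 4.
have e0 : 0 < e by rewrite lt_min r10.
have r0 : 0 < r by rewrite divr_gt0.
have re : r < e by rewrite /r; lra.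
have rr1 : r < r1 by apply: lt_le_trans re _; rewrite ge_min lexx.
have rr2 : r < r2 by apply: lt_le_trans re _; rewrite ge_min lexx orbT.
(* Every orbit in the basin that starts outside the disk of radius [r] meets [K]. *)
pose K : set C := [set x | 0 <= 1 * cabs (x - p) - 1 * r] `&`
  [set x | 0 <= r * cabs d.[x] - 1 * cabs (n - p *: d).[x]].
have KP x : K x -> [/\ A x, x <> p, d.[x] != 0 & cabs (F x - p) <= r].
  rewrite /K /= !mul1r !subr_ge0 => -[rx nx].
  have dx : d.[x] != 0.
    apply/eqP => dx; move: nx; rewrite hornerD hornerN hornerZ dx mulr0 subr0 cabs0 mulr0.
    by move=> n0; have := nd0 dx; rewrite -cabs_gt0 ltNge n0.
  have Fx : cabs (F x - p) <= r.
    have -> : F x - p = (n - p *: d).[x] / d.[x].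
      by rewrite hornerD hornerN hornerZ /F; field.
    by rewrite cabsM cabsV ler_pdivrMr // cabs_gt0.
  split => //.
    by apply: A_of_F => //; case: (r2P (F x)) => //; exact: le_lt_trans rr2.
  by move=> xp; move: rx; rewrite xp subrr cabs0 leNgt r0.
have cp (P : {poly C}) x : {for x, continuous (fun y => cabs P.[y] : R)}.
  apply: (@continuous_comp _ _ _ (horner P) (@cabs R)).
    by apply/ctsP/cts_horner; exact: cts_id.
  exact: cabs_continuous.
have cK : compact K.
  have [B BP] := bounded_of_poly_le (cabs p + r) size_dn.
  apply: (@compact_closed_bounded _ _ B).
    apply: closedI; apply: closed_ge0 => x.
      apply: (@continuous_lincomb R C (fun y => cabs (y - p)) (fun=> r) 1 1 x);
        last exact: continuous_cst_at.
      apply: (@continuous_comp _ _ _ (fun y : C => y - p) (@cabs R)).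
        by apply/ctsP; apply: ctsB; [exact: cts_id | exact: cts_cst].
      exact: cabs_continuous.
    exact: (@continuous_lincomb R C (fun y => cabs d.[y]) (fun y => cabs (n - p *: d).[y]) r 1 x
      (cp _ x) (cp _ x)).
  move=> x [_]; rewrite /= mul1r subr_ge0 => nx; apply: BP.
  have -> : n.[x] = (n - p *: d).[x] + p * d.[x] by rewrite hornerD hornerN hornerZ subrK.
  by apply: (le_trans (cabsD _ _)); rewrite cabsM; lra.
(* The bound [m] is encoded as [m%:R <= t^-1], so that a uniform positive [t] bounds it over [K]. *)
have [||t t0 tP] := @compact_uniform R K (fun x t =>
    exists2 m : nat, m%:R <= t^-1 & reaches m x) cK.
- move=> y t t' [m mt my] /andP[t'0 t't]; exists m => //; apply: (le_trans mt).
  by rewrite lef_pV2 ?posrE //; exact: lt_le_trans t't.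
- move=> x /KP[Ax xp dx Fx].
  have [e1 e10 [m mP]] := reaches_local r1P Ax xp dx (le_lt_trans Fx rr1).
  exists (m%:R + 1)^-1; first by rewrite invr_gt0 ltr_wpDl.
  apply/nbhs_cabsP; exists e1 => // y /mP my; exists m => //.
  by rewrite invrK lerDl.
have tV : 0 <= t^-1 by rewrite invr_ge0 ltW.
pose m := Num.bound t^-1.
have Km x : K x -> reaches m x.
  move=> Kx; have [Ax _ _ _] := KP x Kx; have [k kt kx] := tP x Kx.
  apply: reaches_le kx => //; rewrite -(ler_nat R); apply: (le_trans kt).
  by apply: ltW; exact: archi_boundP.
exists (1 + m)%N => // z Az.
(* A point close to [p] is first joined to a point [y] of the circle of radius [r], which is in [K]
   because [F] does not increase the distance to [p]. *)
have [zr|rz] := ltP (cabs (z - p)) r.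
  pose y : C := p + r%:C%C.
  have yp : cabs (y - p) = r by rewrite /y addrAC subrr add0r cabs_real gtr0_norm.
  have Ky : K y.
    rewrite /K /= !mul1r !subr_ge0 yp; split => //.
    have [|_ dy Fy] := r2P y; first by rewrite yp.
    have -> : (n - p *: d).[y] = (F y - p) * d.[y].
      by rewrite hornerD hornerN hornerZ /F mulrBl divfK.
    by rewrite cabsM ler_wpM2r ?cabs_ge0 // (le_trans Fy) // yp.
  have [N' [z' [bz' oz' rz']]] := Km y Ky 0%N y (b0_neq0 y) (orb0 y).
  exists N', z'; split => //; apply: reach_add rz' => /=; exists z => //.
  apply: (@short_piece p e) => //.
  - by move=> u ue; case: (r2P u) => //; apply: lt_le_trans ue _; rewrite ge_min lexx orbT.
  - by apply: lt_trans zr _; rewrite /r; lra.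
  - by rewrite yp /r; lra.
have [N /(_ N (leqnn N))[_ oN]] := A_eventually Az r0.
have ex : exists k, cabs (orb k z - p) < r by exists N.
(* At the first entrance into the disk of radius [r], the preceding point is in [K]. *)
case: (ex_minnP ex) => k ok kmin.
case: k ok kmin => [|k] ok kmin; first by move: ok; rewrite orb0 ltNge rz.
have bk : (b k).[z] != 0 by exact: A_pole.
have rk : r <= cabs (orb k z - p).
  by rewrite leNgt; apply/negP => /kmin; rewrite ltnn.
have Kk : K (orb k z).
  rewrite /K /= !mul1r !subr_ge0; split => //.
  have dk : d.[orb k z] != 0.
    by have := A_pole k.+1 Az; rewrite bS_at // mulf_eq0 negb_or => /andP[].
  move: ok; rewrite orbS // => ok.
  have -> : (n - p *: d).[orb k z] = (F (orb k z) - p) * d.[orb k z].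
    by rewrite hornerD hornerN hornerZ /F mulrBl divfK.
  by rewrite cabsM ler_wpM2r ?cabs_ge0 // ltW.
have [N' [z' [bz' oz' rz']]] := Km _ Kk k z bk erefl.
exists N', z'; split => //; apply: reach_le rz' => //.
Qed.

Lemma backward_orbit_cobounded : exists C0 : R, forall z, A z -> exists2 z',
  backward_orbit f (pcoord s q) (pcoord s z') &
  connected_component (basin f (pcoord s p)) (pcoord s z) (pcoord s z') /\
  (kobayashi_dist (connected_component (basin f (pcoord s p)) (pcoord s z))
     (pcoord s z) (pcoord s z') <= C0%:E)%E.
Proof.
have [m m0 mP] := all_reach; exists (2 * m%:R) => z Az.
have [N [z' [bz' oz' rz']]] := mP z Az; exists z'; last exact: reach_dist.
by exists N => //=; rewrite iter_pcoord (negPf bz') oz'.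
Qed.

End Target.
End Dynamics.

(** * Rational maps of the sphere *)

Section Rational.
Variable R : realType.
Local Notation C := R[i].
Local Notation hol := (dif (@id C)).
Implicit Types (P : {poly C}) (x y : C).

Lemma size_coef_affine_exp (a : C) i :
  (size ((a *: 'X + 1) ^+ i)%R <= i.+1)%N /\ ((a *: 'X + 1) ^+ i)`_i = a ^+ i.
Proof.
elim: i => [|i [sz co]]; first by rewrite !expr0 size_poly1 coef1.
have E : (a *: 'X + 1) ^+ i.+1 = a *: ((a *: 'X + 1) ^+ i * 'X) + (a *: 'X + 1) ^+ i.
  by rewrite exprSr mulrDr mulr1 -scalerAr.
have sX : (size ((a *: 'X + 1) ^+ i * 'X)%R <= i.+2)%N.
  by apply: (leq_trans (size_polyMleq _ _)); rewrite size_polyX addn2.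
split.
  rewrite E (leq_trans (size_polyD _ _)) // geq_max (leq_trans (size_scale_leq _ _)) //=.
  exact: leqW.
by rewrite E coefD coefZ coefMX /= co nth_default // addr0 exprS.
Qed.

(** The substitution [z = a + x^-1] multiplied by [x ^+ D]; its top coefficient is the value at
    [z = a], that is at [x] infinite. *)
Lemma homog_shift D P (a : C) : (size P <= D.+1)%N ->
  (size (homog D P (a *: 'X + 1) 'X) <= D.+1)%N /\
  (homog D P (a *: 'X + 1) 'X)`_D = P.[a].
Proof.
move=> sP; split.
  apply: (leq_trans (size_sum _ _ _)); apply/bigmax_leqP => i _.
  apply: (leq_trans (size_scale_leq _ _)); apply: (leq_trans (size_polyMleq _ _)).
  rewrite size_polyXn addnS /=.
  have iD : (i <= D)%N by rewrite -ltnS.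
  apply: (@leq_trans (i.+1 + (D - i))); last by rewrite addSn subnKC.
  by rewrite leq_add2r; case: (size_coef_affine_exp a i).
rewrite coef_sum (horner_coef_wide _ sP); apply: eq_bigr => i _.
have iD : (i <= D)%N by rewrite -ltnS.
rewrite coefZ coefMXn ltnNge leq_subr /= subKn //.
by case: (size_coef_affine_exp a i) => _ ->.
Qed.

Lemma quot_scale (k x y : C) : k != 0 -> quot (k * x) (k * y) = quot x y.
Proof.
move=> k0; rewrite /quot mulf_eq0 (negPf k0) /=.
by case: ifP => // /negbT y0; rewrite -mulf_div divff // mul1r.
Qed.

Lemma mod_lt1 (z : C) : (`|z| < 1) = (cabs z < 1).
Proof. by rewrite cabsE -[1 in LHS]/(1%:C%C) ltcR. Qed.

Section Map.
Variables (f : ratfun R) (p : P1 R).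
Hypothesis fp : attracting_fixed_point f p.
Let num := rnum f.
Let den := rden f.
Let D := (maxn (size num) (size den)).-1.
Hypothesis D0 : (0 < D)%N.

Lemma num_size : (size num <= D.+1)%N.
Proof. by rewrite /D; apply: leq_trans (leqSpred _); exact: leq_maxl. Qed.

Lemma den_size : (size den <= D.+1)%N.
Proof. by rewrite /D; apply: leq_trans (leqSpred _); exact: leq_maxr. Qed.

Lemma no_common_root x : den.[x] = 0 -> num.[x] != 0.
Proof.
move=> /rootP dx; have := rcoprime f; rewrite coprimep_sym => /coprimep_root; exact.
Qed.

Lemma top_coef : den`_D = 0 -> num`_D != 0.
Proof.
move=> dD; have sd : (size den <= D)%N.
  rewrite leqNgt; apply/negP => Dd.
  have sdE : size den = D.+1 by apply/eqP; rewrite eqn_leq den_size.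
  have := rden_neq0 f; rewrite -/den -lead_coef_eq0 lead_coefE sdE /= dD.
  by rewrite eqxx.
have Dm : D.+1 = maxn (size num) (size den).
  by rewrite /D prednK // leq_max; apply/orP; right; rewrite size_poly_gt0 (rden_neq0 f).
have snE : size num = D.+1.
  apply/eqP; rewrite eqn_leq num_size /=; rewrite Dm geq_max leqnn /=.
  rewrite leqNgt; apply/negP => nd; move: Dm; rewrite (maxn_idPr (ltnW nd)) => dE.
  by move: sd; rewrite -dE ltnn.
by rewrite -[num`_D]/(num`_(D.+1).-1) -snE -lead_coefE lead_coef_eq0 -size_poly_gt0 snE.
Qed.

Lemma f_finite x : f (Some x) = quot num.[x] den.[x].
Proof. by []. Qed.

Lemma f_infty : f None = quot num`_D den`_D.
Proof. by []. Qed.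

Lemma fixed_finite x : f (Some x) = Some x <-> num.[x] = x * den.[x].
Proof.
rewrite f_finite /quot; have [dx|dx] := eqVneq den.[x] 0.
  by split=> // nx; have := no_common_root dx; rewrite nx dx mulr0 eqxx.
split=> [[] E|->]; last by rewrite mulfK.
by rewrite -{2}E divfK.
Qed.

Lemma fixed_infty : f None = None <-> den`_D = 0.
Proof.
rewrite f_infty /quot; case: eqVneq => [->|d0]; first by [].
by split=> // e; rewrite e eqxx in d0.
Qed.

Lemma den_fixed x : num.[x] = x * den.[x] -> den.[x] != 0.
Proof. by move=> nx; apply/eqP => dx; have := no_common_root dx; rewrite nx dx mulr0 eqxx. Qed.

Lemma multiplier_lt1 (g : C -> C) m :
  (\forall x \near chart p p, chart p (f (chart_inv p x)) = g x) ->
  hol g (chart p p) m -> cabs m < 1.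
Proof.
move=> ng gm; have [_] := fp; rewrite mod_lt1 /multiplier.
have h : hol (chart p \o f \o chart_inv p) (chart p p) m.
  by apply: dif_near gm; move/nbhsS: ng; apply; move=> x /= ->.
by have [_ ->] := hol_derive h.
Qed.

(* Were [p] the only fixed point, it would be a multiple one, of multiplier 1. *)
Lemma exists_other_fixed_point : exists2 s, f s = s & s <> p.
Proof.
pose q := num - 'X * den.
have qE x : q.[x] = num.[x] - x * den.[x] by rewrite /q hornerD hornerN hornerM hornerX.
have rq x : root q x -> f (Some x) = Some x.
  by move/rootP; rewrite qE => /eqP; rewrite subr_eq0 => /eqP/fixed_finite.
have [fpp _] := fp; case pE : p => [b|].
  have nb : num.[b] = b * den.[b] by apply/fixed_finite; rewrite -pE.
  have db := den_fixed nb.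
  have [q0|q0] := eqVneq q 0.
    have [x] : exists x, (den * ('X - b%:P)).[x] != 0.
      by apply: poly_nonroot; rewrite mulf_neq0 ?polyXsubC_eq0 // (rden_neq0 f).
    rewrite hornerM hornerXsubC mulf_eq0 negb_or => /andP[_ xb].
    exists (Some x); first by apply: rq; rewrite q0 root0.
    by move=> [] e; move: xb; rewrite e subrr eqxx.
  have [[x rx xb]|nx] := pselect (exists2 x, root q x & x <> b).
    by exists (Some x); [exact: rq | move=> []].
  exists None => //; apply/fixed_infty.
  have m1 : cabs ((wronskian num den).[b] / den.[b] ^+ 2) < 1.
    apply: (@multiplier_lt1 (fun x => num.[x] / den.[x])); rewrite pE; last exact: hol_ratio.
    have := @cts_neq0 _ _ (horner den) b (cts_horner den (@cts_id _ b)) db.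
    move/nbhsS; apply; move=> x dx.
    by rewrite (_ : chart_inv (Some b) x = Some x) // f_finite /quot (negPf dx).
  have qb' : q^`().[b] != 0.
    apply/eqP => qb; move: m1.
    have qb2 : num^`().[b] - b * den^`().[b] = den.[b].
      apply/eqP; rewrite -subr_eq0 -qb /q derivB derivM derivX mul1r.
      rewrite hornerD hornerN hornerD hornerM hornerX.
      by apply/eqP; ring.
    have -> : (wronskian num den).[b] / den.[b] ^+ 2 = 1.
      rewrite /wronskian hornerD hornerN !hornerM nb.
      have -> : num^`().[b] * den.[b] - b * den.[b] * den^`().[b] =
        (num^`().[b] - b * den^`().[b]) * den.[b] by ring.
      by rewrite qb2 expr2 divff // mulf_neq0.
    by rewrite cabs1 ltxx.
  (* As [b] is the only root of [q], and a simple one, [q] has degree at most 1; were infinity not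
     fixed, the degree would be [D.+1]. *)
  have sq : (size q <= 2)%N.
    rewrite leqNgt; apply/negP => sq; move/eqP: qb'; apply.
    have [rs E srs] := poly_factor q.
    have rsb z : z \in rs -> z = b.
      move=> zr; apply: contrapT => zb; apply: nx; exists z => //.
      by rewrite E root_factored.
    case: rs E srs rsb => [|z1 [|z2 rs]] E srs rsb.
    - by case: (size q) srs sq => [|[|[|]]].
    - by case: (size q) srs sq => [|[|[|]]].
    rewrite E !big_cons (rsb z1) ?inE ?eqxx // (rsb z2) ?inE ?eqxx ?orbT //.
    rewrite derivZ !derivM derivXsubC !hornerE subrr; ring.
  apply: contrapT => /eqP dD; move: sq.
  have sdE : size den = D.+1.
    apply/eqP; rewrite eqn_leq den_size ltnNge; apply/negP => dl.
    by move: dD; rewrite nth_default ?eqxx.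
  have sX : size ('X * den) = D.+2.
    by rewrite mulrC size_mulX ?sdE // (rden_neq0 f).
  rewrite /q addrC size_polyDl; first by rewrite size_polyN sX; case: (D) D0.
  by rewrite size_polyN sX ltnS num_size.
have dD : den`_D = 0 by apply/fixed_infty; rewrite -pE.
have [[x rx]|nx] := pselect (exists x, root q x); first by exists (Some x); [exact: rq|].
exfalso.
have sq : size q = 1%N by apply/eqP; apply: contrapT => /negP/closed_rootP.
pose k := q`_0.
have nE x : num.[x] = x * den.[x] + k.
  have : q.[x] = k by rewrite (size1_polyC (eq_leq sq)) hornerC.
  by rewrite qE => <-; rewrite addrC subrK.
pose N := homog D num 1 'X.
have N0 : N.[0] != 0.
  rewrite /N homog_pole ?hornerX // hornerC expr1n mulr1; exact: top_coef.
have Nx x : x != 0 -> N.[x] = x ^+ D * num.[x^-1].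
  by move=> x0; rewrite /N homogE ?num_size ?hornerX // hornerC mul1r.
have cN : cts (fun x => N.[x]) 0 by apply: cts_horner; exact: cts_id.
(* The map [1 / f (1 / x)] in the chart at infinity, rewritten with [num = 'X * den + k]; its
   derivative at 0 is visibly 1. *)
pose g x := x * (1 - k * x ^+ D / N.[x]).
have g1 : hol g 0 1.
  exists (fun x => 1 - k * x ^+ D / N.[x]); split.
  - apply: ctsB; first exact: cts_cst.
    apply: ctsM; last exact: ctsV.
    by apply: ctsM; [exact: cts_cst | apply: ctsX; exact: cts_id].
  - by rewrite expr0n (gtn_eqF D0) mulr0 mul0r subr0.
  - by apply: nbhsW => x; rewrite /g mul0r !subr0.
have := @multiplier_lt1 g 1; rewrite pE cabs1 ltxx => H; suff : false by [].
apply: H g1; rewrite [chart _ _]/(0 : C).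
have := cts_neq0 cN N0; move/nbhsS; apply; move=> x Nx0.
rewrite /g (_ : chart_inv None x = if (x : C) == 0 then None else Some (x : C)^-1) //.
have [->|x0] := eqVneq x 0; first by rewrite mul0r f_infty dD /quot eqxx.
rewrite f_finite /quot.
have nx0 : num.[x^-1] != 0.
  by apply: contraNneq Nx0 => n0; rewrite Nx // n0 mulr0.
have dE : den.[x^-1] = x * (num.[x^-1] - k) by rewrite nE addrK mulrA divff // mul1r.
have xD : x ^+ D != 0 by rewrite expf_neq0.
have R1 : x * (1 - k * x ^+ D / N.[x]) = den.[x^-1] / num.[x^-1].
  rewrite Nx // dE [k * _]mulrC -mulf_div divff // mul1r mulrBr mulr1 mulrBr mulrBl.
  by rewrite mulfK // mulrA.
rewrite R1; case: eqVneq => [->|d0]; first by rewrite mul0r.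
by rewrite -[LHS]/((num.[x^-1] / den.[x^-1])^-1) invf_div.
Qed.

(** * Conjugation sending a fixed point other than [p] to infinity *)

Section Conjugate.
Variables (s : P1 R).
Hypothesis fs : f s = s.
Hypothesis sp : s <> p.

(** For finite [s = a], applying [1 / (z - a)] to the quotient of the two homogenizations gives this
    numerator and the denominator below. *)
Definition conj_num : {poly C} := if s is Some a then homog D den (a *: 'X + 1) 'X else num.
Definition conj_den : {poly C} := if s is Some a then
  homog D num (a *: 'X + 1) 'X - a *: homog D den (a *: 'X + 1) 'X else den.

(** The degree of the denominator drops because its coefficient of degree [D] is [num.[a] - a *
    den.[a]], zero at a fixed point. *)
Lemma conj_size : (1 < size conj_num)%N /\ (size conj_den < size conj_num)%N.
Proof.
rewrite /conj_num /conj_den; case: s fs => [a|] fs'.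
  have na : num.[a] = a * den.[a] by apply/fixed_finite.
  have [sN cN] := homog_shift a num_size; have [sD cD] := homog_shift a den_size.
  have sDE : size (homog D den (a *: 'X + 1) 'X) = D.+1.
    apply/eqP; rewrite eqn_leq sD ltnNge; apply/negP => sd.
    by have := den_fixed na; rewrite -cD nth_default ?eqxx.
  rewrite sDE ltnS D0; split=> //.
  set T := _ - _; have sT : (size T <= D.+1)%N.
    rewrite /T (leq_trans (size_polyD _ _)) // geq_max sN size_polyN.
    by rewrite (leq_trans (size_scale_leq _ _)).
  rewrite ltnS leqNgt; apply/negP => DT.
  have sTE : size T = D.+1 by apply/eqP; rewrite eqn_leq sT.
  have : lead_coef T = 0 by rewrite lead_coefE sTE /= /T coefD coefN coefZ cN cD na subrr.
  by move/eqP; rewrite lead_coef_eq0 -size_poly_eq0 sTE.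
have dD : den`_D = 0 by apply/fixed_infty.
have nD := top_coef dD.
have sn : size num = D.+1.
  apply/eqP; rewrite eqn_leq num_size ltnNge; apply/negP => dl.
  by move: nD; rewrite nth_default ?eqxx.
rewrite sn ltnS D0; split=> //; rewrite ltnS leqNgt; apply/negP => Dd.
have sd : size den = D.+1 by apply/eqP; rewrite eqn_leq den_size.
have := rden_neq0 f; rewrite -/den -lead_coef_eq0 lead_coefE sd /= dD.
by rewrite eqxx.
Qed.

Lemma conj_spec x : (conj_den.[x] = 0 -> conj_num.[x] != 0) /\
  f (pcoord s x) = if conj_den.[x] == 0 then s else pcoord s (conj_num.[x] / conj_den.[x]).
Proof.
rewrite /conj_num /conj_den; case: s => [a|]; last first.
  by split; [exact: no_common_root | rewrite f_finite].
set dh := homog D den _ _; set nh := homog D num _ _.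
have [E nz] : f (pcoord (Some a) x) = quot nh.[x] dh.[x] /\ (dh.[x] = 0 -> nh.[x] != 0).
  rewrite /pcoord; have [->|x0] := eqVneq x 0.
    have one : (a *: 'X + 1).[0] = 1 by rewrite hornerD hornerZ hornerX hornerC mulr0 add0r.
    rewrite f_infty /nh /dh !homog_pole ?hornerX // one expr1n !mulr1.
    by split=> //; exact: top_coef.
  have eE : (a *: 'X + 1).[x] / 'X.[x] = a + x^-1.
    by rewrite hornerD hornerZ hornerX hornerC; field.
  have x0' : 'X.[x] != 0 by rewrite hornerX.
  rewrite f_finite /nh /dh !homogE ?num_size ?den_size // eE hornerX.
  rewrite quot_scale ?expf_neq0 //; split=> // /eqP.
  rewrite mulf_eq0 expf_eq0 (negPf x0) andbF /= => /eqP/no_common_root n0.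
  by rewrite mulf_neq0 // expf_neq0.
rewrite hornerD hornerN hornerZ E /quot; have [d0|d0] := eqVneq dh.[x] 0.
  rewrite d0 mulr0 subr0 (negPf (nz d0)) mul0r /pcoord eqxx.
  by split=> // n0; have := nz d0; rewrite n0 eqxx.
split=> //; rewrite subr_eq0; have [->|na] := eqVneq nh.[x] (a * dh.[x]).
  by rewrite mulfK.
have na0 : nh.[x] - a * dh.[x] != 0 by rewrite subr_eq0.
rewrite /pcoord mulf_eq0 invr_eq0 (negPf d0) (negPf na0) /= invf_div.
by congr Some; field.
Qed.

Lemma conj_den_neq0 : conj_den != 0.
Proof.
have [sn sd] := conj_size.
have [x rx] : exists x, root conj_num x by apply/closed_rootP; rewrite gtn_eqF.
apply/eqP => d0; have [H _] := conj_spec x; move: H; rewrite d0 horner0 => /(_ erefl).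
by rewrite -rootE rx.
Qed.

Let pt := pcoord_inv s p.

Lemma ptK : pcoord s pt = p.
Proof. by apply: pcoord_invK => ps; apply: sp. Qed.

Lemma conj_fixed : conj_num.[pt] = pt * conj_den.[pt].
Proof.
have [_ E] := conj_spec pt; have [fpp _] := fp; rewrite ptK fpp in E.
case: eqVneq E => [_ ps|d0 pE]; first by exfalso; apply: sp.
by apply: (divIf d0); rewrite mulfK //; apply: (@pcoord_inj _ s); rewrite ptK.
Qed.

Lemma conj_multiplier :
  cabs ((wronskian conj_num conj_den).[pt] / conj_den.[pt] ^+ 2) < 1.
Proof.
have dpt : conj_den.[pt] != 0.
  apply/eqP => d0; have [H _] := conj_spec pt; have := H d0.
  by rewrite conj_fixed d0 mulr0 eqxx.
pose F x := conj_num.[x] / conj_den.[x].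
have hF : hol F pt _ := hol_ratio conj_num dpt.
set m := _ / _ in hF *.
have Fpt : F pt = pt by rewrite /F conj_fixed mulfK.
have cF : cts F pt by exact: cts_ratio.
have nd := @cts_neq0 _ _ (horner conj_den) pt (cts_horner conj_den (@cts_id _ pt)) dpt.
have fF x : conj_den.[x] != 0 -> f (pcoord s x) = pcoord s (F x).
  by move=> dx; have [_ ->] := conj_spec x; rewrite (negPf dx).
(* [T] and [S] are the transition maps between [pcoord s] and the chart at [p]. *)
suff [T [S [T' [S' [hT hS T'S' [S0 [nS nT]]]]]]] : exists T S T' S',
    [/\ hol T pt T', hol S (chart p p) S', T' * S' = 1 &
      S (chart p p) = pt /\
      (\forall x \near chart p p, chart_inv p x = pcoord s (S x)) /\
      (\forall y \near pt, chart p (pcoord s y) = T y)].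
  have cS : cts S (chart p p) by apply: dif_cts hS; exact: cts_id.
  apply: (@multiplier_lt1 (T \o (F \o S))); last first.
    rewrite (_ : m = S' * m * T'); last by rewrite mulrC mulrA T'S' mul1r.
    apply: dif_comp; [exact: cts_id | | by rewrite /= S0 Fpt].
    by apply: dif_comp; [exact: cts_id | exact: hS | rewrite S0].
  have cFS : {for chart p p, continuous (F \o S)}.
    apply/ctsP; apply: (@cts_comp _ _ _ S F); first exact/ctsP.
    by rewrite S0.
  have nd' : nbhs (S (chart p p)) [set x | conj_den.[x] != 0] by rewrite S0.
  have nT' : nbhs ((F \o S) (chart p p)) [set y | chart p (pcoord s y) = T y].
    by rewrite /= S0 Fpt.
  have := nbhsI nS (nbhsI (near_comp (iffLR (ctsP _ _) cS) nd') (near_comp cFS nT')).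
  by move/nbhsS; apply; move=> x [-> [/= dS <-]]; rewrite fF.
have hV (u : C) : u != 0 -> hol (fun x => x^-1) u (- 1 / u ^+ 2).
  by move=> u0; apply: difV; [exact: cts_id | exact: u0 | exact: dif_id].
move: sp; rewrite /pt; case: s => [a|]; case: p => [b|] //= ab.
- have ba : b - a != 0 by rewrite subr_eq0; apply/eqP => e; apply: ab; rewrite e.
  have u0 : (b - a)^-1 != 0 by rewrite invr_eq0.
  have hba : hol (fun x => x - a) b (1 - 0) by apply: difB; [exact: dif_id | exact: dif_cst].
  exists (fun y => a + y^-1), (fun x => (x - a)^-1),
    (0 + - 1 / (b - a)^-1 ^+ 2), (- (1 - 0) / (b - a) ^+ 2).
  split.
  + by apply: difD; [exact: dif_cst | exact: hV].
  + by apply: difV => //; exact: cts_id.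
  + by field.
  split => //; split.
    have := cts_neq0 (dif_cts (@cts_id _ b) hba) ba; move/nbhsS; apply; move=> x xa.
    by rewrite invr_eq0 (negPf xa) invrK addrC subrK.
  have := cts_neq0 (@cts_id _ (b - a)^-1) u0; move/nbhsS; apply; move=> y /= y0.
  by rewrite (negPf y0).
- have hl (c : C) : hol (fun x => 1 + c * x) 0 c by exact: hol_affine.
  have l0 (c : C) : 1 + c * 0 != 0 by rewrite mulr0 addr0 oner_neq0.
  have hM (c : C) : hol (fun x => x * (1 + c * x)^-1) 0 1.
    apply: dif_eq (difM (@cts_id _ 0) (dif_id _ _) (difV (@cts_id _ 0) (l0 c) (hl c))).
    by rewrite mul0r addr0 mulr0 addr0 invr1 mul1r.
  exists (fun y => y * (1 + a * y)^-1), (fun x => x * (1 + - a * x)^-1), 1, 1.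
  split; [exact: hM | exact: hM | by rewrite mulr1 |].
  split; first by rewrite mul0r.
  split.
    have := cts_neq0 (dif_cts (@cts_id _ 0) (hl (- a))) (l0 (- a)); move/nbhsS; apply; move=> x xa.
    have [->|x0] := eqVneq x 0; first by rewrite mul0r eqxx.
    rewrite mulf_eq0 invr_eq0 (negPf x0) (negPf xa) /= invf_div; congr Some.
    by field.
  have := cts_neq0 (dif_cts (@cts_id _ 0) (hl a)) (l0 a); move/nbhsS; apply; move=> y ya.
  have [->|y0] := eqVneq y 0; first by rewrite mul0r.
  have E : a + y^-1 = (1 + a * y) / y by field.
  by rewrite E invf_div.
exists id, id, 1, 1; split; [exact: dif_id | exact: dif_id | by rewrite mulr1 |].
by split => //; split; exact: nbhsW.
Qed.

End Conjugate.

Lemma not_in_basin s : f s = s -> s <> p -> ~ basin f p s.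
Proof.
move=> fs sp bs.
have sK : pcoord s (pcoord_inv s p) = p by apply: pcoord_invK => ps; apply: sp.
have := nbhs_pcoord s (pcoord_inv s p) ltr01; rewrite sK => /bs[N _ NP].
have iters k : iter k f s = s by elim: k => [//|k /= ->].
by have [y _ ys] := NP N (leqnn N); have := @pcoord_neq _ s y; rewrite ys iters.
Qed.

Lemma cobounded_nonconstant p0 : connected_component (basin f p) p p0 -> p0 <> p ->
  exists C0 : R, forall U, is_component (basin f p) U -> forall z0, U z0 ->
    exists2 q, (U `&` backward_orbit f p0) q & (kobayashi_dist U z0 q <= C0%:E)%E.
Proof.
move=> cp0 p0p; have [s fs sp] := exists_other_fixed_point.
have ns z : basin f p z -> pcoord s (pcoord_inv s z) = z.
  by move=> bz; apply: pcoord_invK => zs; apply: (not_in_basin fs sp); rewrite -zs.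
have pK := ptK sp.
have p0K := ns _ (connected_component_sub cp0).
have [sn sd] := conj_size fs.
have qp : pcoord_inv s p0 <> pcoord_inv s p.
  by move=> e; apply: p0p; rewrite -p0K e pK.
have := @backward_orbit_cobounded R (conj_num s) (conj_den s) f s (pcoord_inv s p)
  sd (conj_den_neq0 fs) (fun x => (conj_spec s x).1) fs (fun x => (conj_spec s x).2)
  (conj_fixed sp) (conj_multiplier sp) (pcoord_inv s p0) qp.
rewrite pK p0K => /(_ cp0)[C0 C0P]; exists C0 => U [w Aw ->] z0 Uz0.
have z0K := ns _ (connected_component_sub Uz0).
have bz0 : (pcoord s @^-1` basin f p) (pcoord_inv s z0).
  by rewrite /= z0K; exact: connected_component_sub Uz0.
have [z' bz' []] := C0P _ bz0; rewrite z0K -(same_connected_component Uz0) => cz' dz'.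
by exists (pcoord s z').
Qed.

End Map.

(** The basin is the whole sphere; both points lie in one affine coordinate [pcoord s], where a
    single segment joins them. *)
Lemma constant_dist (f : P1 R -> P1 R) (p z w : P1 R) : (forall u, f u = p) ->
  connected_component (basin f p) z w /\
  (kobayashi_dist (connected_component (basin f p) z) z w <= 2%:E)%E.
Proof.
move=> fp; have bT u : basin f p u.
  by move=> P /nbhs_singleton Pp; exists 1%N => // -[//|k] _ /=; rewrite fp.
have [s [sz sw]] : exists s : P1 R, s <> z /\ s <> w.
  case: z w => [z|] [w|].
  - by exists None.
  - exists (Some (z + 1)); split=> // -[] /eqP.
    by rewrite -subr_eq0 addrAC subrr add0r oner_eq0.
  - exists (Some (w + 1)); split=> // -[] /eqP.
    by rewrite -subr_eq0 addrAC subrr add0r oner_eq0.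
  - by exists (Some 0).
have zK : pcoord s (pcoord_inv s z) = z by apply: pcoord_invK => e; apply: sz.
have wK : pcoord s (pcoord_inv s w) = w by apply: pcoord_invK => e; apply: sw.
have := @reach_dist R (basin f p) s (pcoord_inv s z) (pcoord_inv s w) 1 isT.
rewrite zK wK mulr1; apply; exists (pcoord_inv s z) => //.
by apply: piece_segment => t x _ _; exact: bT.
Qed.

End Rational.

Theorem theoremA (R : realType) (f : ratfun R) (p : P1 R)
    (hp : attracting_fixed_point f p) :
  let A := basin f p in
  let Omega1 := connected_component A p in
  let all_sc := forall U, is_component A U -> simply_connected U in
  (all_sc -> f @^-1` [set p] `&` Omega1 <> [set p] ->
    exists C : R, forall U, is_component A U -> forall z0, U z0 ->
      exists2 q, (U `&` backward_orbit f p) q &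
        (kobayashi_dist U z0 q <= C%:E)%E)
  /\
  ((all_sc /\ f @^-1` [set p] `&` Omega1 = [set p]) \/
   (exists2 U, is_component A U & ~ simply_connected U) ->
    \forall p0 \near p, Omega1 p0 -> p0 <> p ->
      exists C : R, forall U, is_component A U -> forall z0, U z0 ->
        exists2 q, (U `&` backward_orbit f p0) q &
          (kobayashi_dist U z0 q <= C%:E)%E).
Proof.
move=> A Omega1 all_sc; have [fpp _] := hp.
have Ap : A p.
  move=> P /nbhs_singleton Pp; exists 0%N => // k _ /=.
  by rewrite (_ : iter k f p = p) //; elim: k => [//|k /= ->].
(* Constant maps have no second fixed point to send to infinity, and are settled apart. *)
have [D0|D0] := posnP (maxn (size (rnum f)) (size (rden f))).-1; last first.
  split=> [_ fp1|_]; last first.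
    by apply: nbhsW => p0; exact: cobounded_nonconstant hp D0 p0.
  have [p1 [fp1p Op1 p1p]] : exists p1, [/\ f p1 = p, Omega1 p1 & p1 <> p].
    apply: contrapT => H; apply: fp1; apply/seteqP; split=> [x [/= fx Ox]|x ->].
      by apply: contrapT => xp; apply: H; exists x.
    by split=> //; exact: connected_component_refl.
  have [C0 C0P] := cobounded_nonconstant hp D0 Op1 p1p.
  exists C0 => U cU z0 Uz0; have [q [Uq [k _ /= kq]] dq] := C0P U cU z0 Uz0.
  (* One step beyond [p1] the orbit is at [p], hence [k.+1]. *)
  by exists q => //; split=> //; exists k.+1 => //=; rewrite kq.
have fE x : f x = p.
  have s1 : (size (rnum f) <= 1)%N /\ (size (rden f) <= 1)%N.
    by apply/andP; rewrite -geq_max -subn_eq0 subn1 D0.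
  have fc y : f y = quot (rnum f)`_0 (rden f)`_0.
    case: y => [y|] /=; last by rewrite D0.
    by rewrite (size1_polyC s1.1) (size1_polyC s1.2) !hornerC !coefC.
  by rewrite -fpp !fc.
split=> [_ _|_].
  exists 2 => U [w Aw ->] z0 Uz0; rewrite (same_connected_component Uz0).
  have [c d] := constant_dist z0 z0 fE; exists z0 => //.
  by split=> //; exists 1%N => //=.
apply: nbhsW => p0 _ _; exists 2 => U [w Aw ->] z0 Uz0.
rewrite (same_connected_component Uz0).
by have [c d] := constant_dist z0 p0 fE; exists p0 => //; split=> //; exists 0%N.
Qed.
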